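(* Let $V$ be a vertex operator algebra, let $\sigma_1,\sigma_2$ be commuting automorphisms of $V$ and $T$ a positive integer with $\sigma_1^T=\sigma_2^T=1$, let $\sigma=(\sigma_1\sigma_2)^{-1}$, and let $z$ be a nonzero complex number. Let $W$ be a weak $\sigma$-twisted $V$-module, $W_1$ a weak $\sigma_1$-twisted $V$-module and $W_2$ a weak $\sigma_2$-twisted $V$-module, such that $L(0)$ acts semisimply on each of $W,W_1,W_2$. Then the linear map $$F^{(z)}:\ \mathcal Y\mapsto F^{(z)}_{\mathcal Y},\qquad F^{(z)}_{\mathcal Y}(w_{(1)}\otimes w_{(2)})=\mathcal Y(w_{(1)},e^{\log z})w_{(2)}\quad (w_{(1)}\in W_1,\ w_{(2)}\in W_2),$$ is a linear isomorphism from the space $I\binom{W'}{W_1\;W_2}$ of intertwining operators of type $\binom{W'}{W_1\;W_2}$ to the space $I_{P(z)}\binom{W^\star}{W_1\;W_2}$ of $P(z)$-intertwining maps $W_1\otimes W_2\to W^*$ with image in $W^\star$, and the latter space coincides with $\mathrm{Hom}_{V\otimes V}\left(W_1\otimes W_2,\ W^\star\cap\mathfrak D^{(z)}_{\sigma_1,\sigma_2}(W)\right)$, the space of homomorphisms of weak $\sigma_1\otimes\sigma_2$-twisted $V\otimes V$-modules.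
   Context: Formal calculus. Vector spaces are over $\mathbb C$; $\mathbb N=\{0,1,2,\dots\}$; $\delta(x)=\sum_{n\in\mathbb Z}x^n$; $U((x))$ is the space of Laurent series in integer powers of $x$ with finitely many negative powers; $U\{x\}$ is the space of formal sums $\sum_{h\in\mathbb C}a(h)x^h$, $a(h)\in U$. Complex powers of binomials are expanded in nonnegative integer powers of the second summand. For $\xi\in\mathbb C^\times$: $\log\xi=\ln|\xi|+i\arg\xi$ with $0\le\arg\xi<2\pi$, $\xi^\alpha=e^{\alpha\log\xi}$, $(x\pm\xi)^\alpha=\sum_{j\ge0}\binom{\alpha}{j}(\pm\xi)^jx^{\alpha-j}$, $(\xi\pm x)^\alpha=\sum_{j\ge0}\binom{\alpha}{j}\xi^{\alpha-j}(\pm x)^j$. An expression $y^{-1}\delta\left(\frac{a-b}{y}\right)\left(\frac{a-b}{y}\right)^\alpha$ means $\sum_{n\in\mathbb Z}y^{-n-1-\alpha}(a-b)^{n+\alpha}$, and $x_0^{-1}\delta\left(\frac{a-b}{-x_0}\right)\left(\frac{a-b}{x_0}\right)^\alpha$ means $\sum_{n\in\mathbb Z}(-1)^nx_0^{-n-1-\alpha}(a-b)^{n+\alpha}$. Twisted modules. $V$ is a vertex operator algebra with conformal vector $\omega$, $Y(\omega,x)=\sum_n L(n)x^{-n-2}$; automorphisms fix $\omega$. For an automorphism $\tau$ with $\tau^T=1$ and $V^j=\{v:\tau v=e^{2\pi ij/T}v\}$, a weak $\tau$-twisted $V$-module is a vector space $M$ with a linear map $Y_M(\cdot,x):V\to(\mathrm{End}\,M)[[x^{1/T},x^{-1/T}]]$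 such that $Y_M({\bf 1},x)=1$, $Y_M(v,x)w\in x^{-j/T}M((x))$ for $v\in V^j$, $w\in M$, and for $u\in V^j$, $v\in V$: $$x_0^{-1}\delta\left(\tfrac{x_1-x_2}{x_0}\right)Y_M(u,x_1)Y_M(v,x_2)-x_0^{-1}\delta\left(\tfrac{x_2-x_1}{-x_0}\right)Y_M(v,x_2)Y_M(u,x_1)=x_2^{-1}\delta\left(\tfrac{x_1-x_0}{x_2}\right)\left(\tfrac{x_1-x_0}{x_2}\right)^{-j/T}Y_M(Y(u,x_0)v,x_2).$$ $W_1\otimes W_2$ is a weak $\sigma_1\otimes\sigma_2$-twisted $V\otimes V$-module with $Y(u\otimes v,x)=Y_{W_1}(u,x)\otimes Y_{W_2}(v,x)$. Duals. $W=\bigoplus_{h\in\mathbb C}W_{(h)}$ with $W_{(h)}$ the $L(0)$-eigenspace of eigenvalue $h$; $W'=\bigoplus_hW_{(h)}^*\subset W^*=\prod_hW_{(h)}^*$. Set $Y_W^o(v,x)=Y_W(e^{xL(1)}(-x^{-2})^{L(0)}v,x^{-1})$ and define $Y_W^*(v,x)$ on $W^*$ by $\langle Y_W^*(v,x)\alpha,w\rangle=\langle\alpha,Y_W^o(v,x)w\rangle$; put $Y_W^*(v,x+z)\alpha=e^{z\frac{d}{dx}}Y_W^*(v,x)\alpha$. The coefficients of $Y_W^*(v,x)$ preserve $W'$; $Y_{W'}(v,x)$ denotes the restriction. ($W'$ need not be a weak $\sigma^{-1}$-twisted module, but the definition of intertwining operator below makes sense.) $W^\star$ is the subspace of all $f\in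 W^*$ such that for every $h\in\mathbb C$, $\langle f,W_{(h+n/T)}\rangle=0$ for all sufficiently negative integers $n$. The module $\mathfrak D$. $V^{(j_1,j_2)}=\{v\in V:\sigma_r(v)=e^{2\pi ij_r/T}v,\ r=1,2\}$. $\mathfrak D^{(z)}_{\sigma_1,\sigma_2}(W)$ is the set of all $\alpha\in W^*$ such that for every $v\in V^{(j_1,j_2)}$, $j_1,j_2\in\mathbb Z$, there is $k\in\mathbb N$ with $x^{j_2/T}(x-z)^{k+j_1/T}Y_W^*(v,x)\alpha\in W^*((x))$. For such $\alpha,v,k$ put $$Y_\sigma^R(v,x)\alpha=e^{-(k+j_1/T)\pi i}(z-x)^{-k-j_1/T}\left[(x-z)^{k+j_1/T}Y_W^*(v,x)\alpha\right],$$ $$Y_\sigma^L(v,x)\alpha=(z+x)^{-l-j_2/T}\left[(x+z)^{l+j_2/T}Y_W^*(v,x+z)\alpha\right],$$ where $l\in\mathbb N$ is any integer with $x^{j_1/T}(x+z)^{l+j_2/T}Y_W^*(v,x+z)\alpha\in W^*((x))$ (such $l$ exists; the definitions are independent of $k,l$). It is known that $\mathfrak D^{(z)}_{\sigma_1,\sigma_2}(W)$ is a weak $\sigma_1\otimes\sigma_2$-twisted $V\otimes V$-module with $Y_\sigma^{\rm reg}(u\otimes v,x)=Y_\sigma^L(u,x)Y_\sigma^R(v,x)$ and that $W^\star\cap\mathfrak D^{(z)}_{\sigma_1,\sigma_2}(W)$ is a submodule. Intertwining operators. An intertwining operator of type $\binom{W'}{W_1\;W_2}$ is a linear map $\mathcal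 Y(\cdot,x):W_1\to\mathrm{Hom}(W_2,W')\{x\}$, $\mathcal Y(w,x)=\sum_{h\in\mathbb C}w_hx^{-h-1}$, such that: for $w^{(i)}\in W_i$ ($i=1,2$) and $h\in\mathbb C$, $w^{(1)}_{h+n}w^{(2)}=0$ for $n\in\mathbb Q$ sufficiently large; for $v\in V^{(j_1,j_2)}$, $w^{(1)}\in W_1$, $$x_0^{-1}\left(\tfrac{x_1-x_2}{x_0}\right)^{j_1/T}\delta\left(\tfrac{x_1-x_2}{x_0}\right)Y_{W'}(v,x_1)\mathcal Y(w^{(1)},x_2)-e^{\frac{j_1}{T}\pi i}x_0^{-1}\left(\tfrac{x_2-x_1}{x_0}\right)^{j_1/T}\delta\left(\tfrac{x_2-x_1}{-x_0}\right)\mathcal Y(w^{(1)},x_2)Y_{W_2}(v,x_1)$$ $$=x_2^{-1}\left(\tfrac{x_1-x_0}{x_2}\right)^{-j_2/T}\delta\left(\tfrac{x_1-x_0}{x_2}\right)\mathcal Y(Y_{W_1}(v,x_0)w^{(1)},x_2)$$ on $W_2$; and $\mathcal Y(L(-1)w^{(1)},x)=\frac{d}{dx}\mathcal Y(w^{(1)},x)$. For $L(0)$-homogeneous $w_{(1)},w_{(2)}$ one has $(w_{(1)})_nw_{(2)}\in W^*_{(\mathrm{wt}\,w_{(1)}+\mathrm{wt}\,w_{(2)}-n-1)}$, so $\mathcal Y(w_{(1)},e^{\log z})w_{(2)}:=\sum_n e^{(-n-1)\log z}(w_{(1)})_nw_{(2)}$ is a well-defined element of $W^*$ (extended bilinearly).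 $P(z)$-intertwining maps. A $P(z)$-intertwining map is a linear map $F:W_1\otimes W_2\to W^*$ such that for $v\in V^{(j_1,j_2)}$, $w_{(1)}\in W_1$, $w_{(2)}\in W_2$: $$x_0^{-1}\delta\left(\tfrac{x_1-z}{x_0}\right)\left(\tfrac{x_1-z}{x_0}\right)^{j_1/T}Y_W^*(v,x_1)F(w_{(1)}\otimes w_{(2)})-e^{\frac{j_1}{T}\pi i}x_0^{-1}\delta\left(\tfrac{z-x_1}{-x_0}\right)\left(\tfrac{z-x_1}{x_0}\right)^{j_1/T}F(w_{(1)}\otimes Y(v,x_1)w_{(2)})$$ $$=z^{-1}\delta\left(\tfrac{x_1-x_0}{z}\right)\left(\tfrac{x_1-x_0}{z}\right)^{-j_2/T}F(Y(v,x_0)w_{(1)}\otimes w_{(2)}).$$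
   Formalization: In the truncation condition for intertwining operators, n runs over (1/T)Z for each complex h separately, not over all of Q with one bound; with the uniform bound surjectivity fails when W has weights in infinitely many classes of Q mod (1/T)Z going to minus infinity. *)

(* Defs.v *)
From HB Require Import structures.
From mathcomp Require Import all_boot all_order all_algebra generic_quotient.
From mathcomp Require Import all_classical all_reals all_analysis.
From mathcomp Require Import complex.

Set Implicit Arguments.
Unset Strict Implicit.
Unset Printing Implicit Defensive.

Import Order.TTheory GRing.Theory Num.Theory.

Local Open Scope classical_set_scope.
Local Open Scope ring_scope.
Local Open Scope complex_scope.

Definition bilin (K : pzRingType) (M N U : lmodType K) (f : M -> N -> U) :=
  (forall m, linear (f m)) /\ (forall n, linear (f^~ n)).

(* [tens M N] is the set of formal sums \sum_i c_i (m_i (x) n_i), two of them  *)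
(* being identified when all bilinear maps (to all modules) agree on them.    *)
(* [tlift f] is the linear map induced by f when f is bilinear, see           *)
(* [tlift_pure], [tlift_linear] and [tens_ind].                               *)
Section Tensor.
Variables (K : fieldType) (M N : lmodType K).

Definition teval (U : lmodType K) (f : M -> N -> U) (s : seq (K * M * N)) : U :=
  \sum_(p <- s) p.1.1 *: f p.1.2 p.2.

Definition teq (s t : seq (K * M * N)) : bool :=
  `[< forall (U : lmodType K) (f : M -> N -> U), bilin f ->
        teval f s = teval f t >].

Lemma teq_refl : reflexive teq.
Proof. by move=> s; apply/asboolP. Qed.

Lemma teq_sym : symmetric teq.
Proof.
by move=> s t; apply/asboolP/asboolP => h U f bf; rewrite (h U f bf).
Qed.

Lemma teq_trans : transitive teq.
Proof.
move=> t s u /asboolP h1 /asboolP h2; apply/asboolP => U f bf.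
by rewrite (h1 U f bf); exact: h2.
Qed.

Canonical teq_equiv := EquivRel teq teq_refl teq_sym teq_trans.

Definition tens : Type := {eq_quot teq}%qT.

HB.instance Definition _ := Choice.on tens.

Definition tclass (s : seq (K * M * N)) : tens := (\pi_{eq_quot teq} s)%qT.
Definition trepr (x : tens) : seq (K * M * N) := repr x.

Definition tpure (m : M) (n : N) : tens := tclass [:: (1, m, n)].

Definition tlift (U : lmodType K) (f : M -> N -> U) (x : tens) : U :=
  teval f (trepr x).

Lemma tlift_class (U : lmodType K) (f : M -> N -> U) s :
  bilin f -> tlift f (tclass s) = teval f s.
Proof.
move=> bf; suff /asboolP h : teq (trepr (tclass s)) s by exact: h.
by apply/eqmodP; rewrite reprK.
Qed.

Lemma tens_ext (x y : tens) :
  (forall (U : lmodType K) (f : M -> N -> U), bilin f ->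
     tlift f x = tlift f y) -> x = y.
Proof.
move=> h; rewrite -[x]reprK -[y]reprK; apply/eqmodP/asboolP => U f bf.
exact: h.
Qed.

Definition tadd (x y : tens) : tens := tclass (trepr x ++ trepr y).
Definition tscale (a : K) (x : tens) : tens :=
  tclass [seq (a * p.1.1, p.1.2, p.2) | p <- trepr x].

Section Lift.
Variables (U : lmodType K) (f : M -> N -> U).
Hypothesis bf : bilin f.

Lemma tlift0 : tlift f (tclass [::]) = 0.
Proof. by rewrite tlift_class // /teval big_nil. Qed.

Lemma tliftD x y : tlift f (tadd x y) = tlift f x + tlift f y.
Proof. by rewrite tlift_class // /teval big_cat. Qed.

Lemma tliftZ a x : tlift f (tscale a x) = a *: tlift f x.
Proof.
rewrite tlift_class // /tlift /teval big_map scaler_sumr.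
by apply: eq_bigr => p _; rewrite scalerA.
Qed.

Lemma tlift_pure m n : tlift f (tpure m n) = f m n.
Proof. by rewrite tlift_class // /teval big_seq1 /= scale1r. Qed.

End Lift.

Let taddA : associative tadd.
Proof. by move=> x y u; apply: tens_ext => U f bf; rewrite !tliftD // addrA. Qed.

Let taddC : commutative tadd.
Proof. by move=> x y; apply: tens_ext => U f bf; rewrite !tliftD // addrC. Qed.

Let tadd0 : left_id (tclass [::]) tadd.
Proof. by move=> x; apply: tens_ext => U f bf; rewrite tliftD // tlift0 // add0r. Qed.

Let taddN : left_inverse (tclass [::]) (tscale (-1)) tadd.
Proof.
move=> x; apply: tens_ext => U f bf.
by rewrite tliftD // tliftZ // tlift0 // scaleN1r addNr.
Qed.

HB.instance Definition _ :=
  GRing.isZmodule.Build tens taddA taddC tadd0 taddN.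

Let tscaleA a b x : tscale a (tscale b x) = tscale (a * b) x.
Proof. by apply: tens_ext => U f bf; rewrite !tliftZ // scalerA. Qed.

Let tscale1 : left_id 1 tscale.
Proof. by move=> x; apply: tens_ext => U f bf; rewrite tliftZ // scale1r. Qed.

Let tscaleDr : right_distributive tscale +%R.
Proof.
move=> a x y; apply: tens_ext => U f bf.
by rewrite tliftZ // !tliftD // !tliftZ // scalerDr.
Qed.

Let tscaleDl x : {morph tscale^~ x : a b / a + b}.
Proof.
move=> a b; apply: tens_ext => U f bf.
by rewrite tliftD // !tliftZ // scalerDl.
Qed.

HB.instance Definition _ := GRing.Zmodule_isLmodule.Build K tens
  tscaleA tscale1 tscaleDr tscaleDl.

Lemma tlift_linear (U : lmodType K) (f : M -> N -> U) :
  bilin f -> linear (tlift f).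
Proof. by move=> bf a x y; rewrite tliftD // tliftZ. Qed.

Lemma tpure_bilin : bilin tpure.
Proof.
split=> [m a x y|n a x y]; apply: tens_ext => U f bf;
  rewrite tlift_linear // !tlift_pure //; [exact: bf.1 | exact: bf.2].
Qed.

Lemma tens_ind (x : tens) :
  exists s : seq (K * M * N), x = \sum_(p <- s) p.1.1 *: tpure p.1.2 p.2.
Proof.
exists (trepr x); apply: tens_ext => U f bf.
pose g : {linear tens -> U} := HB.pack (tlift f)
  (GRing.isLinear.Build K tens U *:%R (tlift f) (tlift_linear bf)).
change (tlift f x = g (\sum_(p <- trepr x) p.1.1 *: tpure p.1.2 p.2)).
rewrite linear_sum; apply: eq_bigr => p _.
by rewrite linearZ /= tlift_pure.
Qed.

End Tensor.

Section FormalCalculus.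
Variable R : realType.
Local Notation C := R[i].

Definition cexp (a : C) : C :=
  let: x +i* y := a in (expR x * cos y) +i* (expR x * sin y).

Definition carg (a : C) : R :=
  xget 0 [set t : R | 0 <= t < 2 * pi /\ a = `|a| * (cos t +i* sin t)].

Definition clog (a : C) : C := ln (complex.Re `|a|) +i* carg a.

Definition cpow (xi al : C) : C := cexp (al * clog xi).

Definition binc (al : C) (j : nat) : C :=
  (\prod_(i < j) (al - i%:R)) / (j`!)%:R.

Definition frac (T : nat) (j : int) : C := j%:~R / T%:R.

(* e^{i pi a} and e^{2 pi i j / T} *)
Definition expipi (a : C) : C := cexp (a * (0 +i* pi)).
Definition rootu (T : nat) (j : int) : C := expipi (2 * frac T j).

(* Elements of U{x}: a formal series is given by its coefficient function.    *)
Definition ser (U : Type) := C -> U.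

Definition mono (h : C) : ser C := fun e => (e == h)%:R.

(* membership in U((x)) *)
Definition laurent (U : nmodType) (f : ser U) :=
  (forall e, f e <> 0 -> exists n : int, e = n%:~R) /\
  (exists N : int, forall n : int, n < N -> f n%:~R = 0).

(* x^h f(x) *)
Definition xshift (U : Type) (h : C) (f : ser U) : ser U := fun e => f (e - h).

Definition dser (U : lmodType C) (f : ser U) : ser U :=
  fun e => (e + 1) *: f (e + 1).

(* The product of a scalar series and of a U-valued series, in one or several *)
(* variables (E = C, C * C or C * C * C is the set of exponents).  Sums over  *)
(* infinite sets of indices are finitely supported sums.                      *)
Definition fmul (E : zmodType) (U : lmodType C) (K : E -> C) (A : E -> U) :
    E -> U :=
  fun e => \sum_(p \in [set: E]) K (e - p) *: A p.

(* (x + c)^al, in nonnegative powers of the number c *)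
Definition pow_xc (c al : C) : ser C := fun e =>
  \sum_(j \in [set: nat]) binc al j * c ^+ j * mono (al - j%:R) e.

(* (xi + s x)^al, in nonnegative powers of x; s = 1 or -1 *)
Definition pow_cx (xi s al : C) : ser C := fun e =>
  \sum_(j \in [set: nat])
    binc al j * cpow xi (al - j%:R) * s ^+ j * mono j%:R e.

(* (a - b)^al, in nonnegative powers of the variable b *)
Definition pow_sub (al : C) (ea eb : C) : C :=
  \sum_(j \in [set: nat])
    binc al j * (-1) ^+ j * mono (al - j%:R) ea * mono j%:R eb.

(* y^{-1} delta((a - b)/y) ((a - b)/y)^al *)
Definition delta (al : C) (ey ea eb : C) : C :=
  \sum_(n \in [set: int])
    mono (- n%:~R - 1 - al) ey * pow_sub (n%:~R + al) ea eb.

(* y^{-1} delta((a - b)/(-y)) ((a - b)/y)^al *)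
Definition deltaN (al : C) (ey ea eb : C) : C :=
  \sum_(n \in [set: int])
    (-1) ^ n * mono (- n%:~R - 1 - al) ey * pow_sub (n%:~R + al) ea eb.

(* y^{-1} delta((a - z)/y) ((a - z)/y)^al *)
Definition delta_xz (z al : C) (ey ea : C) : C :=
  \sum_(n \in [set: int])
    mono (- n%:~R - 1 - al) ey * pow_xc (- z) (n%:~R + al) ea.

(* y^{-1} delta((z - b)/(-y)) ((z - b)/y)^al *)
Definition deltaN_zx (z al : C) (ey eb : C) : C :=
  \sum_(n \in [set: int])
    (-1) ^ n * mono (- n%:~R - 1 - al) ey * pow_cx z (-1) (n%:~R + al) eb.

(* z^{-1} delta((a - b)/z) ((a - b)/z)^al *)
Definition delta_z (z al : C) (ea eb : C) : C :=
  \sum_(n \in [set: int])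
    cpow z (- n%:~R - 1 - al) * pow_sub (n%:~R + al) ea eb.

(* The Jacobi identity, coefficientwise in (x0, x1, x2) and applied to any    *)
(* vector.  For V itself, al = 0; in a twisted module, al = - j / T.          *)
Definition jacobi (V M : lmodType C) (YV : V -> V -> ser V)
    (YM : V -> M -> ser M) (al : C) (u v : V) :=
  forall (w : M) (e : C * C * C),
    fmul (fun '(e0, e1, e2) => delta 0 e0 e1 e2)
         (fun '(p0, p1, p2) => if p0 == 0 then YM u (YM v w p2) p1 else 0) e
    - fmul (fun '(e0, e1, e2) => deltaN 0 e0 e2 e1)
         (fun '(p0, p1, p2) => if p0 == 0 then YM v (YM u w p1) p2 else 0) e
    = fmul (fun '(e0, e1, e2) => delta al e2 e1 e0)
         (fun '(p0, p1, p2) => if p1 == 0 then YM (YV u v p0) w p2 else 0) e.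

Definition eigdec (U : lmodType C) (L : U -> U) (d : C -> U) (u : U) :=
  [/\ finite_set [set h | d h <> 0], forall h, L (d h) = h *: d h &
      u = \sum_(h \in [set: C]) d h].

Definition semisimple (U : lmodType C) (L : U -> U) :=
  forall u, exists d, eigdec L d u.

(* the component of u in the eigenspace of eigenvalue h *)
Definition eigcomp (U : lmodType C) (L : U -> U) (h : C) (u : U) : U :=
  xget 0 [set x | exists d, eigdec L d u /\ x = d h].

(* L(n), where Y(omega, x) = \sum_n L(n) x^{-n-2} *)
Definition Lmode (V M : lmodType C) (YM : V -> M -> ser M) (om : V) (n : int) :
    M -> M :=
  fun w => YM om w (- n%:~R - 2).

Record voa := VOA {
  voa_car :> lmodType C;
  voaY : voa_car -> voa_car -> ser voa_car;
  vac : voa_car;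
  omega : voa_car;
  cencharge : C;
  voaY_bilin : forall e, bilin (fun u v => voaY u v e);
  voaY_laurent : forall u v, laurent (voaY u v);
  voaY_vac : forall v e, voaY vac v e = mono 0 e *: v;
  voaY_creation : forall v,
    voaY v vac 0 = v /\ forall n : int, n < 0 -> voaY v vac n%:~R = 0;
  voaY_jacobi : forall u v, jacobi voaY voaY 0 u v;
  voa_virasoro : forall (m n : int) v,
    Lmode voaY omega m (Lmode voaY omega n v)
    - Lmode voaY omega n (Lmode voaY omega m v)
    = (m - n)%:~R *: Lmode voaY omega (m + n) v
      + (if m + n == 0 then ((m ^+ 3 - m)%:~R / 12 * cencharge) *: v else 0);
  voa_grading : forall v, exists d,
    eigdec (Lmode voaY omega 0) d v /\
    forall h, d h <> 0 -> exists n : int, h = n%:~R;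
  voa_fdim : forall n : int, exists s : seq voa_car, forall v,
    Lmode voaY omega 0 v = n%:~R *: v ->
    exists c : voa_car -> C, v = \sum_(b <- s) c b *: b;
  voa_bounded : exists N : int, forall (n : int) v, n < N ->
    Lmode voaY omega 0 v = n%:~R *: v -> v = 0;
  voa_L1der : forall v w,
    voaY (Lmode voaY omega (-1) v) w = dser (voaY v w)
}.

Definition voa_aut (V : voa) (g : V -> V) :=
  [/\ linear g, bijective g, g (vac V) = vac V, g (omega V) = omega V &
      forall u v e, g (voaY u v e) = voaY (g u) (g v) e].

Definition eigV (V : voa) (T : nat) (tau : V -> V) (j : int) (v : V) :=
  tau v = rootu T j *: v.

Record twmod (V : voa) (T : nat) (tau : V -> V) := TwMod {
  tw_car :> lmodType C;
  twY : V -> tw_car -> ser tw_car;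
  twY_bilin : forall e, bilin (fun v w => twY v w e);
  twY_supp : forall v w e, twY v w e <> 0 -> exists n : int, e = frac T n;
  twY_vac : forall w e, twY (vac V) w e = mono 0 e *: w;
  twY_laurent : forall (j : int) v w, eigV T tau j v ->
    laurent (xshift (frac T j) (twY v w));
  twY_jacobi : forall (j : int) u v, eigV T tau j u ->
    jacobi (@voaY V) twY (- frac T j) u v
}.

Section Modules.
Variables (V : voa) (T : nat).

Definition L0 (tau : V -> V) (M : twmod T tau) : M -> M :=
  Lmode (@twY V T tau M) (omega V) 0.

Definition eigV2 (s1 s2 : V -> V) (j1 j2 : int) (v : V) :=
  eigV T s1 j1 v /\ eigV T s2 j2 v.

(* The projection of V onto V^{(j1, j2)} = [eigV2 s1 s2 j1 j2]. *)
Definition proj2 (s1 s2 : V -> V) (j1 j2 : int) (v : V) : V :=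
  (T%:R ^- 2) *: \sum_(a < T) \sum_(b < T)
    rootu T (- (a%:Z * j1 + b%:Z * j2)) *: iter a s1 (iter b s2 v).

Section Dual.
Variables (sigma : V -> V) (W : twmod T sigma).

(* W^* is the subspace [dual] of the space of all functions W -> C.  Scalar   *)
(* series times W^*-valued series are evaluated against each w in W, as the   *)
(* sums involved are in general infinite in W^* and only finite after that.   *)
Definition fmulW (K : ser C) (f : ser (W -> C^o)) : ser (W -> C^o) :=
  fun e w => fmul K (fun p => f p w) e.

Definition dual : set (W -> C^o) := [set f | linear f].

(* e^{x L(1)} (- x^{-2})^{L(0)} v *)
Definition oppser (v : V) : ser V := fun e =>
  \sum_(n \in [set: int]) \sum_(i \in [set: nat])
    (mono (i%:R - 2 * n%:~R) e * (-1) ^ n / (i`!)%:R) *: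
      iter i (Lmode (@voaY V) (omega V) 1)
        (eigcomp (Lmode (@voaY V) (omega V) 0) n%:~R v).

(* Y_W^o(v, x) w; the coefficient of x^(e - p) in Y_W(-, x^{-1}) is the       *)
(* coefficient of x^(p - e) in Y_W(-, x).                                     *)
Definition Yo (v : V) (w : W) : ser W := fun e =>
  \sum_(p \in [set: C]) twY (oppser v p) w (p - e).

Definition Ystar (v : V) (f : W -> C^o) : ser (W -> C^o) :=
  fun e w => f (Yo v w e).

(* Y_W^*(v, x + z) f = e^{z d/dx} Y_W^*(v, x) f *)
Definition Ystar_shift (z : C) (v : V) (f : W -> C^o) : ser (W -> C^o) :=
  fun e w => \sum_(i \in [set: nat])
    (z ^+ i / (i`!)%:R) * iter i (@dser C^o) (fun p => Ystar v f p w) e.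

(* W', a functional on W_(h) being extended by 0 to the other W_(h') *)
Definition rdual : set (W -> C^o) :=
  [set f | dual f /\ exists s : seq C, forall h w,
    h \notin s -> L0 w = h *: w -> f w = 0].

(* the space denoted by W with a five-pointed star *)
Definition stardual : set (W -> C^o) :=
  [set f | dual f /\ forall h : C, exists N : int, forall (n : int) w,
    n < N -> L0 w = (h + frac T n) *: w -> f w = 0].

Variables (s1 s2 : V -> V) (z : C).

(* (x - z)^{k + j1/T} Y_W^*(v, x) f and (x + z)^{l + j2/T} Y_W^*(v, x + z) f  *)
Definition clearR (j1 : int) (v : V) (f : W -> C^o) (k : nat) :=
  fmulW (pow_xc (- z) (k%:R + frac T j1)) (Ystar v f).

Definition clearL (j2 : int) (v : V) (f : W -> C^o) (l : nat) :=
  fmulW (pow_xc z (l%:R + frac T j2)) (Ystar_shift z v f).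

Definition Dz : set (W -> C^o) :=
  [set f | dual f /\ forall (j1 j2 : int) v, eigV2 s1 s2 j1 j2 v ->
    exists k : nat, laurent (xshift (frac T j2) (clearR j1 v f k))].

(* Y^R and Y^L for v in V^{(j1, j2)} *)
Definition YRhom (j1 j2 : int) (v : V) (f : W -> C^o) : ser (W -> C^o) :=
  let k := xget 0%N
    [set k : nat | laurent (xshift (frac T j2) (clearR j1 v f k))] in
  let al := k%:R + frac T j1 in
  fun e => expipi (- al) *: fmulW (pow_cx z (-1) (- al)) (clearR j1 v f k) e.

Definition YLhom (j1 j2 : int) (v : V) (f : W -> C^o) : ser (W -> C^o) :=
  let l := xget 0%N
    [set l : nat | laurent (xshift (frac T j1) (clearL j2 v f l))] in
  fmulW (pow_cx z 1 (- (l%:R + frac T j2))) (clearL j2 v f l).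

Definition YR (v : V) (f : W -> C^o) : ser (W -> C^o) := fun e =>
  \sum_(j1 < T) \sum_(j2 < T) YRhom j1 j2 (proj2 s1 s2 j1 j2 v) f e.

Definition YL (v : V) (f : W -> C^o) : ser (W -> C^o) := fun e =>
  \sum_(j1 < T) \sum_(j2 < T) YLhom j1 j2 (proj2 s1 s2 j1 j2 v) f e.

(* Y^reg(u (x) v, x) = Y^L(u, x) Y^R(v, x) *)
Definition Yreg (a : tens V V) (f : W -> C^o) : ser (W -> C^o) := fun e =>
  tlift (fun u v => \sum_(p \in [set: C]) YL u (YR v f p) (e - p)) a.

End Dual.

Section Intertwining.
Variables (s1 s2 sigma : V -> V).
Variables (W : twmod T sigma) (W1 : twmod T s1) (W2 : twmod T s2).

Definition itw_jacobi (Y : W1 -> W2 -> ser (W -> C^o)) :=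
  forall (j1 j2 : int) v (w1 : W1) (w2 : W2) (w : W) (e : C * C * C),
  eigV2 s1 s2 j1 j2 v ->
    fmul (fun '(e0, e1, e2) => delta (frac T j1) e0 e1 e2)
         (fun '(p0, p1, p2) =>
            if p0 == 0 then Ystar v (Y w1 w2 p2) p1 w else 0) e
    - expipi (frac T j1) *:
      fmul (fun '(e0, e1, e2) => deltaN (frac T j1) e0 e2 e1)
         (fun '(p0, p1, p2) =>
            if p0 == 0 then Y w1 (twY v w2 p1) p2 w else 0) e
    = fmul (fun '(e0, e1, e2) => delta (- frac T j2) e2 e1 e0)
         (fun '(p0, p1, p2) =>
            if p1 == 0 then Y (twY v w1 p0) w2 p2 w else 0) e.

(* The coefficient of x^{-h-1} in Y(w1, x) w2 is (w1)_h w2.  In the           *)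
(* truncation condition (w1)_{h+n} w2 = 0 for n large, n runs over (1/T) Z,   *)
(* for each h in C separately, as in the definition of [stardual].  A bound   *)
(* on n uniform over all of Q would be a genuinely stronger condition when W  *)
(* has weights in infinitely many classes of Q modulo (1/T) Z, and the        *)
(* correspondence with P(z)-intertwining maps into [stardual] would fail.     *)
Definition itw_op : set (W1 -> W2 -> ser (W -> C^o)) :=
  [set Y |
    [/\ forall e, bilin (fun w1 w2 => Y w1 w2 e),
        forall w1 w2 e, rdual (Y w1 w2 e),
        forall w1 w2 (h : C), exists N : int, forall n : int, N < n ->
          Y w1 w2 (- (h + frac T n) - 1) = 0,
        itw_jacobi Y &
        forall w1 w2, Y (Lmode (@twY V T s1 W1) (omega V) (-1) w1) w2
                      = dser (Y w1 w2)]].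

Variable z : C.

Definition Pz_jacobi (F : tens W1 W2 -> (W -> C^o)) :=
  forall (j1 j2 : int) v (w1 : W1) (w2 : W2) (w : W) (e : C * C),
  eigV2 s1 s2 j1 j2 v ->
    fmul (fun '(e0, e1) => delta_xz z (frac T j1) e0 e1)
         (fun '(p0, p1) =>
            if p0 == 0 then Ystar v (F (tpure w1 w2)) p1 w else 0) e
    - expipi (frac T j1) *:
      fmul (fun '(e0, e1) => deltaN_zx z (frac T j1) e0 e1)
         (fun '(p0, p1) =>
            if p0 == 0 then F (tpure w1 (twY v w2 p1)) w else 0) e
    = fmul (fun '(e0, e1) => delta_z z (- frac T j2) e1 e0)
         (fun '(p0, p1) =>
            if p1 == 0 then F (tpure (twY v w1 p0) w2) w else 0) e.

Definition Pz_map : set (tens W1 W2 -> (W -> C^o)) :=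
  [set F | [/\ linear F, forall t, dual (F t) & Pz_jacobi F]].

Definition Pz_map_star : set (tens W1 W2 -> (W -> C^o)) :=
  [set F | Pz_map F /\ forall t, stardual (F t)].

(* F^{(z)}; against each w in W the sum over n has finite support *)
Definition Fz (Y : W1 -> W2 -> ser (W -> C^o)) : tens W1 W2 -> (W -> C^o) :=
  tlift (fun w1 w2 => (fun w =>
    \sum_(n \in [set: C]) cexp ((- n - 1) * clog z) * Y w1 w2 (- n - 1) w)
      : W -> C^o).

(* Y(u (x) v, x) (w1 (x) w2) = Y_{W1}(u, x) w1 (x) Y_{W2}(v, x) w2 *)
Definition Ytens (a : tens V V) (t : tens W1 W2) : ser (tens W1 W2) := fun e =>
  tlift (fun u v => tlift (fun w1 w2 =>
    \sum_(p \in [set: C]) tpure (twY u w1 p) (twY v w2 (e - p))) t) a.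

Definition homVV : set (tens W1 W2 -> (W -> C^o)) :=
  [set F | [/\ linear F,
      forall t, (@stardual sigma W `&` Dz s1 s2 z) (F t) &
      forall (a : tens V V) (t : tens W1 W2) (e : C),
        F (Ytens a t e) = Yreg s1 s2 z a (F t) e]].

End Intertwining.
End Modules.

Definition is_subspace (U : lmodType C) (A : set U) :=
  A 0 /\ forall (a : C) x y, A x -> A y -> A (a *: x + y).

Definition linear_iso (U U' : lmodType C) (A : set U) (B : set U')
    (f : U -> U') :=
  [/\ is_subspace A, is_subspace B,
      forall (a : C) x y, A x -> A y -> f (a *: x + y) = a *: f x + f y &
      set_bij A B f].

End FormalCalculus.

Arguments itw_op {R V T s1 s2 sigma} W W1 W2 _.
Arguments Pz_map_star {R V T s1 s2 sigma} W W1 W2 z _.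
Arguments homVV {R V T s1 s2 sigma} W W1 W2 z _.

(* Main.v *)
Require Import Defs.
From mathcomp Require Import all_boot all_order all_algebra.
From mathcomp Require Import all_classical all_reals all_analysis.
From mathcomp Require Import complex.
From mathcomp Require Import ring lra zify.

(* Idea.  For v in V^{(j1, j2)}, fixed vectors w1, w2, w and n in Z, let J_n(x) be the
   coefficient of x0^{-n-1-j1/T} in the difference of the two sides of the Jacobi
   identity of a P(z)-intertwining map F, evaluated at w.  Then
   J_{n+1}(x) = (x - z) J_n(x), so J_n = 0 for all n if and only if J_n = 0 for n large
   (this says that Y^R(v, x) F(w1 (x) w2) = F(w1 (x) Y(v, x) w2)) and the coefficients
   of x^{-j2/T-l-1} in all the J_n vanish for l large (this says that
   Y^L(v, x) F(w1 (x) w2) = F(Y(v, x) w1 (x) w2)): if J_{n+1} = 0, J_n is a multiple of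
   x^{-j2/T} delta(x/z).  This identifies P(z)-intertwining maps with homomorphisms into
   D(W).  As homomorphisms are tested on V (x) V, one also needs that D(W) is stable
   under Y^R and that Y^reg is bilinear, which follows from weak commutativity of Y^*.

   As L(0) is semisimple, the Jacobi identity for omega shows that the matrix
   coefficient <Y(w1, x) w2, w> of an intertwining operator between vectors of weights
   h1, h2, h is a multiple of x^{h-h1-h2}.  Hence Y is determined by its value F at
   x = z, and each coefficient of the Jacobi identity for Y on weight vectors is either
   trivial or a power of z times a coefficient of the one for F. *)

Set Implicit Arguments.
Unset Strict Implicit.
Unset Printing Implicit Defensive.

Import Order.TTheory GRing.Theory Num.Theory.
Local Open Scope classical_set_scope.
Local Open Scope ring_scope.
Local Open Scope complex_scope.

(** * Finitely supported sums *)

(** Everything attached to v and a functional f sits in one array, [clr z s v f e], the coefficient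
    of x^e in (x - z)^s Y_W^*(v, x) f, with s and e complex. A row (s fixed) is the series from
    which Y^R is built; by the residue identity [mul_xc_shift] a column (e fixed, s varying) is the
    series of Y_W^*(v, x + z) f, times a power of x + z, from which Y^L is built. This is why the
    condition defining D(W), stated for x - z only, also controls Y^L.

    The obstacle is summability. Against each w the series Y_W^* is truncated above, so it can be
    multiplied by (x - z)^s, expanded in descending powers of x; powers of z - x and z + x need
    truncation below. The two kinds of product never meet before a pole has been cleared.

    On the side of intertwining operators, one coefficient of the identity for omega serves twice:
    with the L(-1)-derivative property it forces the single exponent h - h1 - h2, and for the
    operator rebuilt from F it gives that property back. Since weight h of w sits at this exponent,
    values in [stardual] correspond to the truncation condition. *)

Definition fins (I : choiceType) (U : nmodType) (f : I -> U) :=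
  exists r : seq I, forall i, i \notin r -> f i = 0.

Lemma fsum_seq (I : choiceType) (U : nmodType) (f : I -> U) (r : seq I) :
  uniq r -> (forall i, i \notin r -> f i = 0) ->
  \sum_(i \in [set: I]) f i = \sum_(i <- r) f i.
Proof.
move=> ur hf; rewrite (@fsbigE _ _ _ _ _ r) //; last by move=> i _; exact: hf.
by apply: eq_bigl => i; rewrite in_setT.
Qed.

Lemma fins_uniq (I : choiceType) (U : nmodType) (f : I -> U) : fins f ->
  exists r : seq I, uniq r /\ forall i, i \notin r -> f i = 0.
Proof.
by case=> r hr; exists (undup r); split; rewrite ?undup_uniq// => i;
  rewrite mem_undup; exact: hr.
Qed.

Lemma fins2 (I : choiceType) (U U' : nmodType) (f : I -> U) (g : I -> U') :
  fins f -> fins g ->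
  exists r : seq I, [/\ uniq r, forall i, i \notin r -> f i = 0
                      & forall i, i \notin r -> g i = 0].
Proof.
move=> [r hr] [s hs]; exists (undup (r ++ s)); split; rewrite ?undup_uniq// => i;
  rewrite mem_undup mem_cat => /norP[h1 h2]; [exact: hr|exact: hs].
Qed.

Lemma eq_fsum (I : choiceType) (U : nmodType) (f g : I -> U) : f =1 g ->
  \sum_(i \in [set: I]) f i = \sum_(i \in [set: I]) g i.
Proof. by move=> fg; rewrite (_ : f = g) //; apply/funext. Qed.

Lemma fsum0 (I : choiceType) (U : nmodType) (f : I -> U) : (forall i, f i = 0) ->
  \sum_(i \in [set: I]) f i = 0.
Proof. by move=> f0; rewrite (@fsum_seq _ _ _ [::]) ?big_nil. Qed.

Lemma fsum1 (I : choiceType) (U : nmodType) (f : I -> U) (i0 : I) :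
  (forall i, i != i0 -> f i = 0) -> \sum_(i \in [set: I]) f i = f i0.
Proof.
move=> f0; rewrite (@fsum_seq _ _ _ [:: i0]) ?big_seq1 // => i.
by rewrite inE; exact: f0.
Qed.

Lemma fsumD (I : choiceType) (U : nmodType) (f g : I -> U) : fins f -> fins g ->
  \sum_(i \in [set: I]) (f i + g i) =
  \sum_(i \in [set: I]) f i + \sum_(i \in [set: I]) g i.
Proof.
move=> /fins2 H /H[r [ur hf hg]].
rewrite !(@fsum_seq _ _ _ r) ?big_split // => i ir.
by rewrite hf ?hg ?addr0.
Qed.

Lemma fsum_lin (I : choiceType) (U U' : nmodType) (h : U -> U') (f : I -> U) :
  h 0 = 0 -> {morph h : x y / x + y} -> fins f ->
  h (\sum_(i \in [set: I]) f i) = \sum_(i \in [set: I]) h (f i).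
Proof.
move=> h0 hD /fins_uniq[r [ur hf]]; rewrite !(@fsum_seq _ _ _ r) //; last first.
  by move=> i ir; rewrite hf ?h0.
by elim: (r) => [|i s IH]; rewrite ?big_nil ?big_cons // hD IH.
Qed.

Lemma fsumZ (K : pzRingType) (I : choiceType) (U : lmodType K) (c : K) (f : I -> U) :
  fins f ->
  \sum_(i \in [set: I]) c *: f i = c *: \sum_(i \in [set: I]) f i.
Proof.
by move=> hf; rewrite (fsum_lin (h := fun x => c *: x)) ?scaler0 // => x y;
  rewrite scalerDr.
Qed.

(** For c different from 0 the supports of f and of its multiple agree, and a sum with infinite
    support takes the default value 0 on both sides. *)
Lemma fsumZr (K : fieldType) (I : choiceType) (U : lmodType K) (c : K) (f : I -> U) :
  \sum_(i \in [set: I]) c *: f i = c *: \sum_(i \in [set: I]) f i.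
Proof.
have [->|c0] := eqVneq c 0.
  by rewrite scale0r fsum0 // => i; rewrite scale0r.
have [[r hr]|nf] := pselect (fins f); first by rewrite fsumZ //; exists r.
have inf (g : I -> U) : (forall i, g i = 0 -> f i = 0) ->
    \sum_(i \in [set: I]) g i = 0.
  move=> gf; apply: fsbig_dflt => -/finite_seqP[r hr]; apply: nf; exists r => i ir.
  apply: gf; apply: contrapT => gi; move/negP: ir; apply.
  have : (setT `&` g @^-1` [set~ 0]) i by split.
  by rewrite hr.
rewrite !inf ?scaler0 // => i /eqP; rewrite scaler_eq0 (negPf c0) => /eqP //.
Qed.

Lemma fsum_lincomb (K : fieldType) (I : choiceType) (U : lmodType K) (a : K)
    (f g : I -> U) : fins f -> fins g ->
  \sum_(i \in [set: I]) (a *: f i + g i) =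
  a *: (\sum_(i \in [set: I]) f i) + \sum_(i \in [set: I]) g i.
Proof.
move=> [r hr] fg; rewrite -fsumZr fsumD //.
by exists r => i /hr ->; rewrite scaler0.
Qed.

Lemma fsum_neq0 (I : choiceType) (U : nmodType) (f : I -> U) :
  \sum_(i \in [set: I]) f i <> 0 -> exists i, f i <> 0.
Proof.
move=> h; apply: contrapT => nf; apply: h; apply: fsum0 => i.
by apply: contrapT => fi; apply: nf; exists i.
Qed.

Lemma fsum_reindex (I J : choiceType) (U : nmodType) (g : J -> I) (f : I -> U) :
  injective g -> (forall i, f i <> 0 -> exists j, i = g j) ->
  \sum_(i \in [set: I]) f i = \sum_(j \in [set: J]) f (g j).
Proof.
move=> ginj gf.
rewrite -(@fsbig_widen _ _ _ _ (g @` setT)) //; last first.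
  move=> i [_ /= ni]; apply: contrapT => fi; apply: ni.
  by have [j ->] := gf _ fi; exists j.
by rewrite fsbig_image // => x y _ _; exact: ginj.
Qed.

Lemma fins_supp (I : choiceType) (U U' : nmodType) (f : I -> U) (g : I -> U') :
  fins f -> (forall i, f i = 0 -> g i = 0) -> fins g.
Proof. by move=> [r hr] fg; exists r => i /hr /fg. Qed.

Lemma finsD (I : choiceType) (U : nmodType) (f g : I -> U) :
  fins f -> fins g -> fins (fun i => f i + g i).
Proof.
by move=> /fins2 H /H[r [_ hf hg]]; exists r => i ir; rewrite hf ?hg ?addr0.
Qed.

Lemma fins_nat (U : nmodType) (f : nat -> U) (B : nat) :
  (forall j, (B <= j)%N -> f j = 0) -> fins f.
Proof.
by move=> h; exists (iota 0 B) => j; rewrite mem_iota add0n -leqNgt; exact: h.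
Qed.

Lemma fsum_nat (U : nmodType) (f : nat -> U) (B : nat) :
  (forall j, (B <= j)%N -> f j = 0) ->
  \sum_(j \in [set: nat]) f j = \sum_(j < B) f j.
Proof.
move=> h; rewrite (@fsum_seq _ _ _ (iota 0 B)) ?iota_uniq //; last first.
  by move=> j; rewrite mem_iota add0n -leqNgt; exact: h.
by rewrite -(big_mkord xpredT) /index_iota subn0.
Qed.

Lemma fins_natP (U : nmodType) (f : nat -> U) : fins f ->
  exists B, forall j, (B <= j)%N -> f j = 0.
Proof.
move=> [r hr]; exists (\max_(i <- r) i).+1 => j jB; apply: hr.
by apply/negP => jr; move: jB; rewrite ltnNge leq_bigmax_seq.
Qed.


Lemma fsum_recl (U : nmodType) (f : nat -> U) : fins f ->
  \sum_(j \in [set: nat]) f j = f 0%N + \sum_(j \in [set: nat]) f j.+1.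
Proof.
move=> /fins_natP[B hB]; rewrite (@fsum_nat _ _ B.+1); last first.
  by move=> j jB; apply: hB; exact: ltnW.
by rewrite big_ord_recl (@fsum_nat _ _ B) // => j jB; apply: hB; exact: leqW.
Qed.

Lemma fsum_antidiag (U : nmodType) (f : nat -> nat -> U) (B : nat) :
  (forall i j, (B <= i + j)%N -> f i j = 0) ->
  \sum_(i \in [set: nat]) \sum_(j \in [set: nat]) f i j =
  \sum_(m \in [set: nat]) \sum_(i < m.+1) f i (m - i)%N.
Proof.
move=> h.
rewrite (@fsum_nat _ _ B); last first.
  by move=> i iB; apply: fsum0 => j; apply: h; lia.
rewrite (eq_bigr (fun i : 'I_B => \sum_(j < B) f i j)); last first.
  by move=> i _; apply: fsum_nat => j jB; apply: h; lia.
rewrite (@fsum_nat _ _ B); last first.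
  by move=> m mB; apply: big1 => i _; apply: h; have := ltn_ord i; lia.
rewrite [RHS](eq_bigr (fun m : 'I_B => \sum_(i < B | (i <= m)%N) f i (m - i)%N)); last first.
  by move=> m _; rewrite (big_ord_widen B (fun i => f i (m - i)%N) (ltn_ord m)).
have E : forall i : 'I_B, \sum_(j < B) f i j =
    \sum_(m < B | (i <= m)%N) f i (m - i)%N.
  move=> i; rewrite [RHS]big_mkcond /=.
  rewrite -(big_mkord xpredT (fun m => if (i <= m)%N then f i (m - i)%N else 0)).
  rewrite (big_cat_nat (n := i)) //=; last exact: ltnW.
  rewrite [X in _ = X + _]big_nat_cond [X in _ = X + _]big1 ?add0r; last first.
    by move=> m; case/andP => /andP[_ mi]; rewrite leqNgt mi.
  have shft (F : nat -> U) :
      \sum_(i <= m < B) F m = \sum_(0 <= j < B - i) F (j + i)%N.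
    by rewrite -{1}(add0n (nat_of_ord i)) big_addn.
  rewrite shft.
  rewrite -(big_mkord xpredT (fun j => f i j)).
  rewrite (big_cat_nat (n := (B - i)%N)) //=; last exact: leq_subr.
  rewrite [X in _ + X]big_nat_cond [X in _ + X]big1 ?addr0; last first.
    by move=> j; case/andP => /andP[h1 h2] _; apply: h; lia.
  by apply: eq_bigr => j _; rewrite leq_addl addnK.
rewrite (eq_bigr _ (fun i _ => E i)) (exchange_big_dep predT) //=.
Qed.

Section Scalars.
Variable R : realType.
Local Notation C := R[i].

(** * Complex exponentials and binomial coefficients *)

Lemma cexpD (a b : C) : cexp (a + b) = cexp a * cexp b.
Proof.
case: a => ax ay; case: b => bx by_ /=; rewrite expRD cosD sinD.
by apply/eqP; rewrite eq_complex /=; apply/andP; split; apply/eqP; ring.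
Qed.

Lemma cexp0 : cexp 0 = 1 :> C.
Proof. by rewrite /= expR0 cos0 sin0 !mul1r. Qed.

Lemma cexp_neq0 (a : C) : cexp a != 0.
Proof.
apply/eqP => h; have := cexpD a (- a); rewrite addrN cexp0 h mul0r => /eqP.
by rewrite oner_eq0.
Qed.

Lemma cexpN (a : C) : cexp (- a) = (cexp a)^-1.
Proof.
by apply: (mulfI (cexp_neq0 a)); rewrite -cexpD addrN cexp0 mulfV ?cexp_neq0.
Qed.

Lemma polar_angle (x y : R) : x ^+ 2 + y ^+ 2 = 1 ->
  exists t : R, [/\ 0 <= t < 2 * pi, x = cos t & y = sin t].
Proof.
move=> xy1.
have y2 : y ^+ 2 = 1 - x ^+ 2 by rewrite -xy1 addrC addKr.
have x1 : -1 <= x <= 1.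
  rewrite -ler_norml; rewrite -(@ler_pXn2r _ 2) ?nnegrE // expr1n -normrX.
  rewrite ger0_norm ?sqr_ge0 // -xy1 lerDl sqr_ge0 //.
have pi0 := pi_gt0 R.
have /andP[a0 api] : 0 <= acos x <= pi by rewrite acos_ge0 ?acos_lepi.
have sa : sin (acos x) = `|y| by rewrite sin_acos // -y2 sqrtr_sqr.
case: (leP 0 y) => y0.
  exists (acos x); rewrite acosK ?in_itv //= sa ger0_norm //; split => //.
  by rewrite a0 /=; lra.
(* Lower half circle: [acos] only reaches [0, pi], while [carg] takes its values in [0, 2 pi). *)
exists (2 * pi - acos x); split.
- have : acos x != 0.
    by apply/eqP => a00; move: sa; rewrite a00 sin0 => /esym/normr0_eq0; lra.
  rewrite neq_lt => ?; lra.
- have -> : 2 * pi - acos x = - acos x + pi *+ 2 by rewrite mulr2n; lra.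
  by rewrite cosD2pi cosN acosK ?in_itv.
- have -> : 2 * pi - acos x = - acos x + pi *+ 2 by rewrite mulr2n; lra.
  by rewrite sinD2pi sinN sa ltr0_norm // opprK.
Qed.
End Scalars.

Section Powers.
Variable R : realType.
Local Notation C := R[i].

Lemma normC_real (a : C) : `|a| = (complex.Re `|a|)%:C.
Proof. by rewrite normc_def. Qed.

(** The choice made by [xget] is a genuine argument because the set of angles is nonempty:
    [polar_angle] applies to a / |a|, a point of the unit circle. *)
Lemma carg_spec (a : C) : a != 0 ->
  a = `|a| * (cos (carg a) +i* sin (carg a)).
Proof.
move=> a0; rewrite /carg.
set P := [set t : R | _]; suff : P (xget 0 P) by case.
apply: xgetPex.
have na0 : `|a| != 0 by rewrite normr_eq0.
case E : (a / `|a|) => [x y].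
have n1 : `|x +i* y| = 1 by rewrite -E normrM normfV normr_id mulfV.
have [|t [t0 xt yt]] := @polar_angle _ x y.
  move: n1; rewrite normc_def => /complexI/eqP.
  rewrite -{1}sqrtr1 eqr_sqrt ?addr_ge0 ?sqr_ge0 //= => /eqP.
  by [].
exists t; split => //; rewrite -xt -yt -E mulrCA mulfV ?mulr1 //.
Qed.

Lemma clogK (a : C) : a != 0 -> cexp (clog a) = a.
Proof.
move=> a0; rewrite [in RHS](carg_spec a0) [in RHS]normC_real /clog /=.
have na0 : 0 < `|a| by rewrite normr_gt0.
rewrite lnK ?posrE; last first.
  by move: na0; rewrite normC_real ltcR.
by apply/eqP; rewrite eq_complex /=; apply/andP; split; apply/eqP; ring.
Qed.

Lemma cpowD (z s t : C) : cpow z (s + t) = cpow z s * cpow z t.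
Proof. by rewrite /cpow mulrDl cexpD. Qed.

Lemma cpow0 (z : C) : cpow z 0 = 1.
Proof. by rewrite /cpow mul0r cexp0. Qed.

Lemma cpow1 (z : C) : z != 0 -> cpow z 1 = z.
Proof. by move=> z0; rewrite /cpow mul1r clogK. Qed.

Lemma cpow_neq0 (z s : C) : cpow z s != 0.
Proof. exact: cexp_neq0. Qed.

Lemma cpowN (z s : C) : cpow z (- s) = (cpow z s)^-1.
Proof. by rewrite /cpow mulNr cexpN. Qed.

Lemma cpow_nat (z : C) (n : nat) : z != 0 -> cpow z n%:R = z ^+ n.
Proof.
move=> z0; elim: n => [|n IH]; first by rewrite cpow0 expr0.
by rewrite -natr1 cpowD cpow1 // IH exprSr.
Qed.

Lemma expipiD (a b : C) : expipi (a + b) = expipi a * expipi b.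
Proof. by rewrite /expipi mulrDl cexpD. Qed.

Lemma expipi0 : expipi 0 = 1 :> C.
Proof. by rewrite /expipi mul0r cexp0. Qed.

Lemma expipi1 : expipi 1 = -1 :> C.
Proof.
rewrite /expipi mul1r /= expR0 cospi sinpi mul1r mulr0.
by apply/eqP; rewrite eq_complex /= oppr0 !eqxx.
Qed.

Lemma expipi_neq0 (a : C) : expipi a != 0.
Proof. exact: cexp_neq0. Qed.

Lemma expipiN (a : C) : expipi (- a) = (expipi a)^-1.
Proof. by rewrite /expipi mulNr cexpN. Qed.

Lemma expipi_int (n : int) : expipi n%:~R = (-1) ^ n :> C.
Proof.
have pos (m : nat) : expipi m%:R = (-1) ^+ m :> C.
  elim: m => [|m IH]; first by rewrite expipi0.
  by rewrite -natr1 expipiD IH expipi1 exprSr.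
case: n => n; first exact: pos.
by rewrite NegzE mulrNz expipiN pos.
Qed.

Lemma binc0 (al : C) : binc al 0 = 1.
Proof. by rewrite /binc big_ord0 fact0 divr1. Qed.

Lemma bincS (al : C) (j : nat) : (j.+1)%:R * binc al j.+1 = (al - j%:R) * binc al j.
Proof.
rewrite /binc big_ord_recr factS natrM /= invfM.
have : (j.+1)%:R != 0 :> C by rewrite pnatr_eq0.
have : (j`!)%:R != 0 :> C by rewrite pnatr_eq0 -lt0n fact_gt0.
move: (j.+1%:R) (j`!%:R) (\prod_(_ < j) _) => x y p hy hx; field.
by rewrite hx hy.
Qed.

Lemma pascal (al : C) (j : nat) : binc (al + 1) j.+1 = binc al j.+1 + binc al j.
Proof.
elim: j => [|j IH].
  have := bincS (al + 1) 0; have := bincS al 0.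
  by rewrite !binc0 !mulr1 !mul1r !subr0 => -> ->.
have nz : (j.+2)%:R != 0 :> C by rewrite pnatr_eq0.
apply: (mulfI nz); rewrite bincS IH [RHS]mulrDr bincS.
have h := bincS al j; rewrite mulrDr.
have -> : (al + 1 - (j.+1)%:R) * binc al j = (j.+1)%:R * binc al j.+1.
  by rewrite h -natr1; ring.
rewrite -[j.+2%:R]natr1; ring.
Qed.

Lemma vandermonde (al be : C) (m : nat) :
  \sum_(i < m.+1) binc al i * binc be (m - i)%N = binc (al + be) m.
Proof.
elim: m => [|m IH]; first by rewrite big_ord1 !binc0 mulr1.
have nz : (m.+1)%:R != 0 :> C by rewrite pnatr_eq0.
apply: (mulfI nz); rewrite bincS -IH !mulr_sumr.
(* Writing m + 1 = i + (m + 1 - i) lets [bincS] lower one index in each half; the halves recombine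
   with the factor (al - i) + (be - (m - i)) = al + be - m. *)
have -> : \sum_(i < m.+2) m.+1%:R * (binc al i * binc be (m.+1 - i)%N) =
   \sum_(i < m.+2) (i%:R * binc al i) * binc be (m.+1 - i)%N +
   \sum_(i < m.+2) binc al i * ((m.+1 - i)%:R * binc be (m.+1 - i)%N).
  rewrite -big_split; apply: eq_bigr => i _ /=.
  by rewrite natrB; [ring|rewrite -ltnS; exact: ltn_ord].
have -> : \sum_(i < m.+2) (i%:R * binc al i) * binc be (m.+1 - i)%N =
    \sum_(i < m.+1) (i.+1%:R * binc al i.+1) * binc be (m - i)%N.
  by rewrite big_ord_recl !mul0r add0r.
have -> : \sum_(i < m.+2) binc al i * ((m.+1 - i)%:R * binc be (m.+1 - i)%N) =
    \sum_(i < m.+1) binc al i * ((m.+1 - i)%:R * binc be (m.+1 - i)%N).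
  by rewrite big_ord_recr /= subnn mul0r mulr0 addr0.
rewrite -big_split; apply: eq_bigr => i _ /=.
have im : (i <= m)%N by rewrite -ltnS; exact: ltn_ord.
rewrite bincS subSn // bincS natrB //; ring.
Qed.

(** Upper negation. A delta series produces binomial coefficients whose upper entry moves with j;
    this turns them into the coefficients of one fixed power. *)
Lemma binc_neg (e : C) (j : nat) : binc (e + j%:R) j * (-1) ^+ j = binc (- e - 1) j.
Proof.
rewrite /binc mulrAC; congr (_ / _).
have -> : \prod_(i < j) (e + j%:R - i%:R) = \prod_(i < j) (e + i%:R + 1).
  rewrite (reindex_inj rev_ord_inj); apply: eq_bigr => i _ /=.
  rewrite natrB // -natr1; ring.
elim: j => [|j IH]; first by rewrite !big_ord0 mulr1.
by rewrite !big_ord_recr /= -IH exprSr; ring.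
Qed.

Lemma binc_nat (n j : nat) : binc n%:R j = ('C(n, j))%:R :> C.
Proof.
elim: n j => [|n IH] [|j]; rewrite ?binc0 ?bin0 //.
  by apply/eqP; rewrite /binc big_ord_recl subrr mul0r mul0r.
by rewrite -natr1 pascal !IH binS natrD.
Qed.

Lemma binc_small (n j : nat) : (n < j)%N -> binc n%:R j = 0 :> C.
Proof. by move=> nj; rewrite binc_nat bin_small. Qed.

Lemma binc0S (j : nat) : binc 0 j.+1 = 0 :> C.
Proof. exact: (@binc_small 0). Qed.

Lemma binc1SS (j : nat) : binc 1 j.+2 = 0 :> C.
Proof. exact: (@binc_small 1). Qed.

End Powers.

(** * Truncation of series with complex exponents *)

Section Truncation.
Variable R : realType.
Local Notation C := R[i].

(** The bound depends on q: exponents are complex, and truncation is only required along each coset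
    of the integers. *)
Definition uptr (U : nmodType) (A : C -> U) :=
  forall q, exists J : nat, forall j, (J <= j)%N -> A (q + j%:R) = 0.
Definition lowtr (U : nmodType) (A : C -> U) :=
  forall q, exists J : nat, forall j, (J <= j)%N -> A (q - j%:R) = 0.

Lemma lowtrD (U : nmodType) (A B : C -> U) :
  lowtr A -> lowtr B -> lowtr (fun e => A e + B e).
Proof.
move=> hA hB q; have [J hJ] := hA q; have [K hK] := hB q.
by exists (maxn J K) => j; rewrite geq_max => /andP[j1 j2]; rewrite hJ ?hK ?addr0.
Qed.

Lemma lowtr_supp (U U' : nmodType) (A : C -> U) (B : C -> U') :
  lowtr A -> (forall e, A e = 0 -> B e = 0) -> lowtr B.
Proof. by move=> hA AB q; have [J hJ] := hA q; exists J => j /hJ /AB. Qed.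

Lemma lowtr_lin (U : lmodType C) a (A B : C -> U) :
  lowtr A -> lowtr B -> lowtr (fun e => a *: A e + B e).
Proof.
by move=> hA hB; apply: lowtrD => //; apply: (lowtr_supp hA) => e ->; rewrite scaler0.
Qed.

Lemma lowtr_sum (I : Type) (r : seq I) (U : nmodType) (A : I -> C -> U) :
  (forall i, lowtr (A i)) -> lowtr (fun e => \sum_(i <- r) A i e).
Proof.
move=> hA; elim: r => [|i r IH].
  by move=> q; exists 0%N => j _; rewrite big_nil.
apply: (lowtr_supp (lowtrD (hA i) IH)) => e /=.
by rewrite big_cons.
Qed.

Lemma lowtr_fins (U : nmodType) (A : C -> U) q : lowtr A ->
  fins (fun j : nat => A (q - j%:R)).
Proof. by move=> /(_ q) [J hJ]; apply: (fins_nat (B := J)). Qed.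

Lemma uptr_fins (U : nmodType) (A : C -> U) q : uptr A ->
  fins (fun j : nat => A (q + j%:R)).
Proof. by move=> /(_ q) [J hJ]; apply: (fins_nat (B := J)). Qed.

End Truncation.

(** * Multiplication by complex powers of binomials *)

Section Binomials.
Variables (R : realType) (z : R[i]).
Local Notation C := R[i].
Implicit Types (U : lmodType C).

(* (x + c)^s A(x) and (z + sg x)^s A(x) *)
Definition mul_xc U (c s : C) (A : C -> U) (e : C) : U :=
  \sum_(j \in [set: nat]) (binc s j * c ^+ j) *: A (e - s + j%:R).
Definition mul_cx U (sg s : C) (A : C -> U) (e : C) : U :=
  \sum_(j \in [set: nat]) (binc s j * cpow z (s - j%:R) * sg ^+ j) *: A (e - j%:R).

Lemma pow_xcE (c s : C) (j : nat) : pow_xc c s (s - j%:R) = binc s j * c ^+ j.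
Proof.
rewrite /pow_xc (@fsum1 _ _ _ j) /mono ?eqxx ?mulr1 // => i /negPf ij.
by rewrite (inj_eq (addrI s)) eqr_opp eqr_nat eq_sym ij mulr0.
Qed.

Lemma pow_xc_supp (c s e : C) : pow_xc c s e <> 0 -> exists j : nat, e = s - j%:R.
Proof.
case/fsum_neq0 => j; rewrite /mono; case: eqP => [ej|]; last by rewrite mulr0.
by exists j.
Qed.

Lemma pow_cxE (sg s : C) (j : nat) :
  pow_cx z sg s j%:R = binc s j * cpow z (s - j%:R) * sg ^+ j.
Proof.
rewrite /pow_cx (@fsum1 _ _ _ j) /mono ?eqxx ?mulr1 // => i /negPf ij.
by rewrite eqr_nat eq_sym ij mulr0.
Qed.

Lemma pow_cx_supp (sg s e : C) : pow_cx z sg s e <> 0 -> exists j : nat, e = j%:R.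
Proof.
case/fsum_neq0 => j; rewrite /mono; case: eqP => [ej|]; last by rewrite mulr0.
by exists j.
Qed.

Lemma fmul_xc U (c s : C) (A : C -> U) e : fmul (pow_xc c s) A e = mul_xc c s A e.
Proof.
rewrite /fmul /mul_xc (@fsum_reindex _ nat _ (fun j => e - s + j%:R)).
- by apply: eq_fsum => j; rewrite -pow_xcE; congr (pow_xc _ _ _ *: _); ring.
- by move=> i j /addrI /eqP; rewrite eqr_nat => /eqP.
- move=> p; have [->|/eqP h _] := eqVneq (pow_xc c s (e - p)) 0.
    by rewrite scale0r.
  have [j hj] := pow_xc_supp h; exists j.
  by transitivity (e - (e - p)); [ring|rewrite hj; ring].
Qed.

Lemma fmul_cx U (sg s : C) (A : C -> U) e :
  fmul (pow_cx z sg s) A e = mul_cx sg s A e.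
Proof.
rewrite /fmul /mul_cx (@fsum_reindex _ nat _ (fun j => e - j%:R)).
- by apply: eq_fsum => j; rewrite -pow_cxE; congr (pow_cx _ _ _ _ *: _); ring.
- by move=> i j /addrI /oppr_inj /eqP; rewrite eqr_nat => /eqP.
- move=> p; have [->|/eqP h _] := eqVneq (pow_cx z sg s (e - p)) 0.
    by rewrite scale0r.
  have [j hj] := pow_cx_supp h; exists j.
  by transitivity (e - (e - p)); [ring|rewrite hj; ring].
Qed.

Lemma eq_mul_xc U c s (A B : C -> U) e : A =1 B -> mul_xc c s A e = mul_xc c s B e.
Proof. by move=> AB; apply: eq_fsum => j; rewrite AB. Qed.

Lemma eq_mul_cx U c s (A B : C -> U) e : A =1 B -> mul_cx c s A e = mul_cx c s B e.
Proof. by move=> AB; apply: eq_fsum => j; rewrite AB. Qed.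

Lemma fins_xc U c s (A : C -> U) e : uptr A ->
  fins (fun j : nat => (binc s j * c ^+ j) *: A (e - s + j%:R)).
Proof.
by move=> h; apply: (fins_supp (uptr_fins (e - s) h)) => j ->; rewrite scaler0.
Qed.

Lemma fins_cx U c s (A : C -> U) e : lowtr A ->
  fins (fun j : nat => (binc s j * cpow z (s - j%:R) * c ^+ j) *: A (e - j%:R)).
Proof.
by move=> h; apply: (fins_supp (lowtr_fins e h)) => j ->; rewrite scaler0.
Qed.

Lemma mul_xc_lin U c s a (A B : C -> U) e : uptr A -> uptr B ->
  mul_xc c s (fun p => a *: A p + B p) e = a *: mul_xc c s A e + mul_xc c s B e.
Proof.
move=> hA hB; rewrite /mul_xc -fsum_lincomb; [|exact: fins_xc|exact: fins_xc].
by apply: eq_fsum => j; rewrite scalerDr !scalerA [_ * a]mulrC.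
Qed.

Lemma mul_cx_lin U c s a (A B : C -> U) e : lowtr A -> lowtr B ->
  mul_cx c s (fun p => a *: A p + B p) e = a *: mul_cx c s A e + mul_cx c s B e.
Proof.
move=> hA hB; rewrite /mul_cx -fsum_lincomb; [|exact: fins_cx|exact: fins_cx].
by apply: eq_fsum => j; rewrite scalerDr !scalerA [_ * a]mulrC.
Qed.

Lemma mul_xc0 U c s (A : C -> U) e : (forall p, A p = 0) -> mul_xc c s A e = 0.
Proof. by move=> h; apply: fsum0 => j; rewrite h scaler0. Qed.

Lemma mul_cx0 U c s (A : C -> U) e : (forall p, A p = 0) -> mul_cx c s A e = 0.
Proof. by move=> h; apply: fsum0 => j; rewrite h scaler0. Qed.

Lemma lin_mul_cx U U' (h : U -> U') c s (A : C -> U) e : linear h -> lowtr A ->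
  h (mul_cx c s A e) = mul_cx c s (fun p => h (A p)) e.
Proof.
move=> lh uA.
have h0 : h 0 = 0 by have := lh (-1) 0 0; rewrite !scaler0 addr0 scaleN1r addNr.
have hD : {morph h : x y / x + y} by move=> x y; have := lh 1 x y; rewrite !scale1r.
rewrite (fsum_lin h0 hD); last exact: fins_cx.
by apply: eq_fsum => j; have := lh (binc s j * cpow z (s - j%:R) * c ^+ j) (A (e - j%:R)) 0;
  rewrite h0 !addr0.
Qed.

Lemma scale_linear U (c : C) : linear (fun x : U => c *: x).
Proof. by move=> a x y; rewrite scalerDr !scalerA mulrC. Qed.

(** Pascal's rule. Every recursion in the exponent s, in particular [clrS] and [Jcoef_rec], comes
    from here or from [mul_cxS]. *)
Lemma mul_xcS U c s (A : C -> U) e : uptr A ->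
  mul_xc c (s + 1) A e = mul_xc c s A (e - 1) + c *: mul_xc c s A e.
Proof.
move=> hA; rewrite /mul_xc -fsumZ; last exact: fins_xc.
rewrite (fsum_recl (fins_xc c (s + 1) e hA)) (fsum_recl (fins_xc c s (e - 1) hA)).
rewrite -[RHS]addrA; congr (_ + _).
  by rewrite !binc0; congr (_ *: A _); ring.
rewrite -fsumD.
- apply: eq_fsum => j; rewrite scalerA pascal mulrDl scalerDl.
  congr (_ *: A _ + _ *: A _); first ring.
    by rewrite exprS; ring.
  by rewrite -natr1; ring.
- have [J hJ] := fins_natP (fins_xc c s (e - 1) hA).
  by apply: (fins_nat (B := J)) => j jJ; rewrite hJ // leqW.
- apply: (fins_supp (fins_xc c s e hA)) => j ->; rewrite scaler0 //.
Qed.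

Lemma mul_cx_s0 U sg (A : C -> U) e : mul_cx sg 0 A e = A e.
Proof.
rewrite /mul_cx (@fsum1 _ _ _ 0%N) ?binc0 ?subr0 ?cpow0 ?mulr1 ?scale1r //.
by move=> [|j] // _; rewrite binc0S !mul0r scale0r.
Qed.

(** Vandermonde along antidiagonals. With t = - s it inverts multiplication by (z + sg x)^s, which
    allows a cleared pole to be put back or removed. *)
Lemma mul_cx_comp U sg s t (A : C -> U) e : lowtr A ->
  mul_cx sg s (mul_cx sg t A) e = mul_cx sg (s + t) A e.
Proof.
move=> hA; rewrite /mul_cx.
have [J hJ] := hA e.
rewrite (eq_fsum (fun i => esym (fsumZ _ (fins_cx sg t (e - i%:R) hA)))).
rewrite (@fsum_antidiag _ _ J); last first.
  move=> i j ij; rewrite (_ : e - i%:R - j%:R = e - (i + j)%:R).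
    by rewrite hJ // !scaler0.
  by rewrite natrD; ring.
apply: eq_fsum => m; rewrite -vandermonde !mulr_suml scaler_suml.
apply: eq_bigr => i _.
have im : (i <= m)%N by rewrite -ltnS; exact: ltn_ord.
rewrite scalerA; congr (_ *: A _); last by rewrite natrB //; ring.
have -> : cpow z (s + t - m%:R) = cpow z (s - i%:R) * cpow z (t - (m - i)%:R).
  by rewrite -cpowD natrB //; congr (cpow z _); ring.
have -> : sg ^+ m = sg ^+ i * sg ^+ (m - i) by rewrite -exprD subnKC.
ring.
Qed.

Lemma lowtr_mul_cx U sg s (A : C -> U) : lowtr A -> lowtr (mul_cx sg s A).
Proof.
move=> hA q; have [J hJ] := hA q; exists J => j jJ; apply: fsum0 => i.
rewrite (_ : q - j%:R - i%:R = q - (j + i)%:R); last by rewrite natrD; ring.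
by rewrite hJ ?scaler0 //; apply: (leq_trans jJ); exact: leq_addr.
Qed.

Hypothesis z0 : z != 0.

Lemma mul_cx_s1 U sg (A : C -> U) e :
  mul_cx sg 1 A e = z *: A e + sg *: A (e - 1).
Proof.
rewrite /mul_cx (@fsum_nat _ _ 2); last first.
  by move=> [|[|j]] // _; rewrite binc1SS !mul0r scale0r.
rewrite !big_ord_recl big_ord0 addr0 /= !subr0 binc0 cpow1 // mul1r mulr1.
congr (_ + _ *: A _).
by rewrite subrr cpow0 /bump /= (binc_nat R 1 1) bin1 mulr1 mul1r expr1.
Qed.

Lemma mul_cxS U sg s (A : C -> U) e : lowtr A ->
  mul_cx sg (s + 1) A e = z *: mul_cx sg s A e + sg *: mul_cx sg s A (e - 1).
Proof. by move=> hA; rewrite addrC -mul_cx_comp // mul_cx_s1. Qed.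

(* e^{z d/dx} A(x) *)
Definition shiftser U (A : C -> U) (e : C) : U :=
  \sum_(i \in [set: nat]) (z ^+ i * binc (e + i%:R) i) *: A (e + i%:R).

(* (x + z)^be A(x + z) = Res_y x^{-1} delta((y - z)/x) y^be A(y) *)
Lemma mul_xc_shift U be (A : C -> U) e : uptr A ->
  mul_xc z be (shiftser A) e = mul_xc (- z) (- e - 1) A (- be - 1).
Proof.
move=> hA; rewrite /mul_xc /shiftser.
have [J hJ] := hA (e - be).
have fA i : fins (fun j : nat => (z ^+ j * binc (e - be + i%:R + j%:R) j) *:
    A (e - be + i%:R + j%:R)).
  by apply: (fins_supp (uptr_fins (e - be + i%:R) hA)) => j ->; rewrite scaler0.
rewrite (eq_fsum (fun i => esym (fsumZ _ (fA i)))).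
rewrite (@fsum_antidiag _ _ J); last first.
  move=> i j ij; rewrite (_ : e - be + i%:R + j%:R = e - be + (i + j)%:R).
    by rewrite hJ // !scaler0.
  by rewrite natrD; ring.
apply: eq_fsum => m.
have -> : - be - 1 - (- e - 1) + m%:R = e - be + m%:R by ring.
(* The coefficients of A (e - be + m) are compared. On the left they form a Vandermonde sum with
   upper entries be and e - be + m, of total e + m; upper negation brings the right side to the same
   form. *)
have -> : binc (- e - 1) m * (- z) ^+ m = binc (e + m%:R) m * z ^+ m.
  by rewrite exprNn -binc_neg -!mulrA signrMK.
have {1}-> : e + m%:R = be + (e - be + m%:R) by ring.
rewrite -vandermonde !mulr_suml scaler_suml.
apply: eq_bigr => i _.
have im : (i <= m)%N by rewrite -ltnS; exact: ltn_ord.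
have -> : e - be + i%:R + (m - i)%:R = e - be + m%:R by rewrite natrB //; ring.
have -> : z ^+ m = z ^+ i * z ^+ (m - i) by rewrite -exprD subnKC.
by rewrite scalerA; congr (_ *: _); ring.
Qed.

End Binomials.

(* The recursion says that f (n + 1) is f n multiplied by x - c.  If f (n + 1) = 0,
   f n is a multiple of delta(x/c), hence 0 as soon as one coefficient vanishes. *)
Lemma recursive_array_eq0 (K : fieldType) (c : K) (f : int -> int -> K) :
  c != 0 -> (forall n m, f (n + 1) m = f n (m - 1) - c * f n m) ->
  (exists k, forall n m, k <= n -> f n m = 0) ->
  (exists m0, forall n m, m <= m0 -> f n m = 0) ->
  forall n m, f n m = 0.
Proof.
move=> c0 rec [k hk] [m0 hm0].
have main (i : nat) : forall m, f (k - i%:Z) m = 0.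
  elim: i => [|i IH] m; first by apply: hk; rewrite subr0.
  have step m' : f (k - i.+1%:Z) (m' - 1) = c * f (k - i.+1%:Z) m'.
    apply/eqP; rewrite -subr_eq0 -rec.
    by rewrite (_ : k - i.+1%:Z + 1 = k - i%:Z) ?IH //; lia.
  have up (j : nat) : f (k - i.+1%:Z) (m0 + j%:Z) = 0.
    elim: j => [|j IHj]; first by apply: hm0; rewrite addr0.
    apply: (mulfI c0); rewrite -step mulr0.
    by rewrite (_ : m0 + j.+1%:Z - 1 = m0 + j%:Z) ?IHj //; lia.
  have [mm|mm] := leP m m0; first exact: hm0.
  by rewrite (_ : m = m0 + `|m - m0|%N%:Z) ?up //; lia.
move=> n m; have [nk|nk] := leP k n; first exact: hk.
by rewrite (_ : n = k - `|k - n|%N%:Z) ?main //; lia.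
Qed.

(** * Coefficients of products with delta functions *)

Section Kernels.
Variables (R : realType) (z : R[i]).
Local Notation C := R[i].
Implicit Types (U : lmodType C).

Lemma natC_inj : injective (fun j : nat => j%:R : C).
Proof. by move=> i j /eqP; rewrite eqr_nat => /eqP. Qed.

Lemma intC_inj : injective (fun n : int => n%:~R : C).
Proof. by move=> i j /eqP; rewrite eqr_int => /eqP. Qed.

(** Once the support of the series is used, each kernel below only meets a one-parameter family of
    exponents p = g j; this replaces a sum over all complex exponents by one over j. *)
Lemma fmul_nat (E : zmodType) U (K : E -> C) (A : E -> U) e (g : nat -> E)
    (c : nat -> C) :
  injective g -> (forall p, K (e - p) <> 0 -> A p <> 0 -> exists j, p = g j) ->
  (forall j, K (e - g j) = c j) ->
  fmul K A e = \sum_(j \in [set: nat]) c j *: A (g j).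
Proof.
move=> gi gs gc; rewrite /fmul (fsum_reindex gi).
  by apply: eq_fsum => j; rewrite gc.
move=> p; have [->|/eqP h1] := eqVneq (K (e - p)) 0; first by rewrite scale0r.
have [->|/eqP h2 _] := eqVneq (A p) 0; first by rewrite scaler0.
exact: gs.
Qed.

Lemma fmul_eq0 (E : zmodType) U (K : E -> C) (A : E -> U) e :
  (forall p, K (e - p) <> 0 -> A p <> 0 -> False) -> fmul K A e = 0.
Proof.
move=> h; apply: fsum0 => p.
have [->|/eqP h1] := eqVneq (K (e - p)) 0; first by rewrite scale0r.
by have [->|/eqP h2] := eqVneq (A p) 0; [rewrite scaler0|case: (h p)].
Qed.

Lemma pow_subE s j : pow_sub s (s - j%:R) j%:R = binc s j * (-1) ^+ j :> C.
Proof.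
rewrite /pow_sub (@fsum1 _ _ _ j) /mono ?eqxx ?mulr1 // => i /negPf ij.
by rewrite [j%:R == _]eqr_nat [j == i]eq_sym ij mulr0.
Qed.

Lemma pow_sub_supp (s ea eb : C) : pow_sub s ea eb <> 0 ->
  exists j : nat, ea = s - j%:R /\ eb = j%:R.
Proof.
move=> h; apply: contrapT => nj; apply: h; apply: fsum0 => j.
rewrite /mono; case: eqP => [ej|_]; case: eqP => [ej'|_]; rewrite ?mulr0 ?mul0r //.
by case: nj; exists j.
Qed.

Lemma exponentE (al : C) (n i : int) :
  (- n%:~R - 1 - al == - i%:~R - 1 - al) = (i == n).
Proof.
by rewrite !(inj_eq (addIr _)) eqr_opp (inj_eq intC_inj) eq_sym.
Qed.

Lemma deltaE (al : C) (n : int) ea eb :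
  delta al (- n%:~R - 1 - al) ea eb = pow_sub (n%:~R + al) ea eb.
Proof.
rewrite /delta (@fsum1 _ _ _ n) /mono ?eqxx ?mul1r // => i /negPf ni.
by rewrite exponentE ni mul0r.
Qed.

Lemma delta_supp (al ey ea eb : C) : delta al ey ea eb <> 0 ->
  exists n : int, ey = - n%:~R - 1 - al.
Proof.
case/fsum_neq0 => n; rewrite /mono; case: eqP => [ej|_]; last by rewrite mul0r.
by exists n.
Qed.

Lemma deltaNE (al : C) (n : int) ea eb :
  deltaN al (- n%:~R - 1 - al) ea eb = (-1) ^ n * pow_sub (n%:~R + al) ea eb.
Proof.
rewrite /deltaN (@fsum1 _ _ _ n) /mono ?eqxx ?mulr1 // => i /negPf ni.
by rewrite exponentE ni mulr0 mul0r.
Qed.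

Lemma deltaN_supp (al ey ea eb : C) : deltaN al ey ea eb <> 0 ->
  exists n : int, ey = - n%:~R - 1 - al.
Proof.
case/fsum_neq0 => n; rewrite /mono; case: eqP => [ej|_]; last by rewrite mulr0 mul0r.
by exists n.
Qed.

Lemma delta_xzE (al : C) (n : int) ea :
  delta_xz z al (- n%:~R - 1 - al) ea = pow_xc (- z) (n%:~R + al) ea.
Proof.
rewrite /delta_xz (@fsum1 _ _ _ n) /mono ?eqxx ?mul1r // => i /negPf ni.
by rewrite exponentE ni mul0r.
Qed.

Lemma delta_xz_supp (al ey ea : C) : delta_xz z al ey ea <> 0 ->
  exists n : int, ey = - n%:~R - 1 - al.
Proof.
case/fsum_neq0 => n; rewrite /mono; case: eqP => [ej|_]; last by rewrite mul0r.
by exists n.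
Qed.

Lemma deltaN_zxE (al : C) (n : int) eb :
  deltaN_zx z al (- n%:~R - 1 - al) eb = (-1) ^ n * pow_cx z (-1) (n%:~R + al) eb.
Proof.
rewrite /deltaN_zx (@fsum1 _ _ _ n) /mono ?eqxx ?mulr1 // => i /negPf ni.
by rewrite exponentE ni mulr0 mul0r.
Qed.

Lemma deltaN_zx_supp (al ey eb : C) : deltaN_zx z al ey eb <> 0 ->
  exists n : int, ey = - n%:~R - 1 - al.
Proof.
case/fsum_neq0 => n; rewrite /mono; case: eqP => [ej|_]; last by rewrite mulr0 mul0r.
by exists n.
Qed.

(** This is the identity z^{-1} delta((x1 - x0)/z) ((x1 - x0)/z)^al = x1^{-1} delta((z + x0)/x1) ((z
    + x0)/x1)^{-al}: at x1^ea one reads off (z + x0)^(- ea - 1). The factor 1 ^+ j gives it the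
    shape of [mul_cx z 1]. *)
Lemma delta_zE (al ea : C) (m : int) (j : nat) : ea = m%:~R + al ->
  delta_z z al ea j%:R =
  binc (- ea - 1) j * cpow z (- ea - 1 - j%:R) * 1 ^+ j.
Proof.
move=> em; rewrite /delta_z (@fsum1 _ _ _ (m + j%:Z)).
  rewrite (_ : ea = (m + j%:Z)%:~R + al - j%:R); last by rewrite em intrD /=; ring.
  rewrite pow_subE -binc_neg expr1n mulr1 mulrC.
  congr (binc _ j * _ * cpow z _); ring.
move=> n nm; have [->|/eqP] := eqVneq (pow_sub (n%:~R + al) ea j%:R) 0.
  by rewrite mulr0.
case/pow_sub_supp => i [h1 /natC_inj ij]; move: nm; rewrite -(inj_eq intC_inj).
case/negP; apply/eqP; rewrite intrD; apply: (addIr (al - j%:R)).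
transitivity ea; [rewrite h1 ij; ring|rewrite em; ring].
Qed.

Lemma delta_z_supp (al ea eb : C) : delta_z z al ea eb <> 0 ->
  exists (m : int) (j : nat), ea = m%:~R + al /\ eb = j%:R.
Proof.
move=> h; apply: contrapT => nj; apply: h; apply: fsum0 => n.
have [->|/eqP/pow_sub_supp[j [h1 h2]]] := eqVneq (pow_sub (n%:~R + al) ea eb) 0.
  by rewrite mulr0.
by case: nj; exists (n - j%:Z), j; split=> //; rewrite h1 intrB; ring.
Qed.

Section ThreeVariables.
Variables (U : lmodType C) (al : C) (A : C -> C -> U).

Lemma fmul_delta12 (n : int) e1 e2 :
  fmul (fun '(e0, e1, e2) => delta al e0 e1 e2)
    (fun '(p0, p1, p2) => if p0 == 0 then A p1 p2 else 0) (- n%:~R - 1 - al, e1, e2)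
  = \sum_(j \in [set: nat]) (binc (n%:~R + al) j * (-1) ^+ j) *:
      A (e1 - (n%:~R + al) + j%:R) (e2 - j%:R).
Proof.
rewrite (@fmul_nat _ _ _ _ _ (fun j => (0, e1 - (n%:~R + al) + j%:R, e2 - j%:R))
  (fun j => binc (n%:~R + al) j * (-1) ^+ j)).
- by apply: eq_fsum => j; rewrite eqxx.
- by move=> i j [_ /addrI/oppr_inj/natC_inj].
- move=> [[p0 p1] p2] /=; case: eqP => [->|//]; rewrite subr0 deltaE.
  case/pow_sub_supp => j [h1 h2] _; exists j; congr (_, _, _).
    by transitivity (e1 - (e1 - p1)); [ring|rewrite h1; ring].
  by transitivity (e2 - (e2 - p2)); [ring|rewrite h2].
- move=> j /=; rewrite subr0 deltaE -pow_subE.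
  have -> : e1 - (e1 - (n%:~R + al) + j%:R) = n%:~R + al - j%:R by ring.
  by have -> : e2 - (e2 - j%:R) = j%:R by ring.
Qed.

Lemma fmul_delta12_eq0 e0 e1 e2 : (forall n : int, e0 <> - n%:~R - 1 - al) ->
  fmul (fun '(e0, e1, e2) => delta al e0 e1 e2)
    (fun '(p0, p1, p2) => if p0 == 0 then A p1 p2 else 0) (e0, e1, e2) = 0.
Proof.
move=> h; apply: fmul_eq0 => -[[p0 p1] p2] /=; case: eqP => [->|//].
by rewrite subr0 => /delta_supp[n /h].
Qed.

Lemma fmul_delta21 (n : int) e1 e2 :
  fmul (fun '(e0, e1, e2) => deltaN al e0 e2 e1)
    (fun '(p0, p1, p2) => if p0 == 0 then A p1 p2 else 0) (- n%:~R - 1 - al, e1, e2)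
  = (-1) ^ n *: \sum_(j \in [set: nat]) (binc (n%:~R + al) j * (-1) ^+ j) *:
      A (e1 - j%:R) (e2 - (n%:~R + al) + j%:R).
Proof.
rewrite (@fmul_nat _ _ _ _ _ (fun j => (0, e1 - j%:R, e2 - (n%:~R + al) + j%:R))
  (fun j => (-1) ^ n * (binc (n%:~R + al) j * (-1) ^+ j))); first last.
- move=> j /=; rewrite subr0 deltaNE -pow_subE.
  have -> : e2 - (e2 - (n%:~R + al) + j%:R) = n%:~R + al - j%:R by ring.
  by have -> : e1 - (e1 - j%:R) = j%:R by ring.
- move=> [[p0 p1] p2] /=; case: eqP => [->|//]; rewrite subr0 deltaNE.
  have [->|/eqP] := eqVneq (pow_sub (n%:~R + al) (e2 - p2) (e1 - p1)) 0.
    by rewrite mulr0.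
  case/pow_sub_supp => j [h1 h2] _; exists j; congr (_, _, _).
    by transitivity (e1 - (e1 - p1)); [ring|rewrite h2].
  by transitivity (e2 - (e2 - p2)); [ring|rewrite h1; ring].
- by move=> i j [/addrI/oppr_inj/natC_inj].
by rewrite -fsumZr; apply: eq_fsum => j; rewrite eqxx scalerA.
Qed.

Lemma fmul_delta21_eq0 e0 e1 e2 : (forall n : int, e0 <> - n%:~R - 1 - al) ->
  fmul (fun '(e0, e1, e2) => deltaN al e0 e2 e1)
    (fun '(p0, p1, p2) => if p0 == 0 then A p1 p2 else 0) (e0, e1, e2) = 0.
Proof.
move=> h; apply: fmul_eq0 => -[[p0 p1] p2] /=; case: eqP => [->|//].
by rewrite subr0 => /deltaN_supp[n /h].
Qed.

(** The rewriting of the delta function in [delta_zE], with x2 in place of z: at x1^e1 the kernel is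
    (x2 + x0)^(- e1 - 1). *)
Lemma fmul_delta02 (m : int) e0 e1 e2 : e1 = m%:~R + al ->
  fmul (fun '(e0, e1, e2) => delta al e2 e1 e0)
    (fun '(p0, p1, p2) => if p1 == 0 then A p0 p2 else 0) (e0, e1, e2)
  = \sum_(j \in [set: nat]) binc (- e1 - 1) j *:
      A (e0 - j%:R) (e2 + e1 + 1 + j%:R).
Proof.
move=> em.
rewrite (@fmul_nat _ _ _ _ _ (fun j => (e0 - j%:R, 0, e2 + e1 + 1 + j%:R))
  (fun j => binc (- e1 - 1) j)).
- by apply: eq_fsum => j; rewrite eqxx.
- by move=> i j [/addrI/oppr_inj/natC_inj].
- move=> [[p0 p1] p2] /=; case: eqP => [->|//]; rewrite subr0 => h.
  have [n hn] := delta_supp h; move: h; rewrite hn deltaE.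
  case/pow_sub_supp => j [h1 h2] _; exists j; congr (_, _, _).
    by transitivity (e0 - (e0 - p0)); [ring|rewrite h2].
  by transitivity (e2 - (e2 - p2)); [ring|rewrite hn h1; ring].
- move=> j /=; rewrite subr0.
  have -> : e2 - (e2 + e1 + 1 + j%:R) = - (m + j%:Z)%:~R - 1 - al.
    by rewrite em intrD /=; ring.
  have -> : e0 - (e0 - j%:R) = j%:R by ring.
  rewrite deltaE -binc_neg.
  have -> : (m + j%:Z)%:~R + al = e1 + j%:R by rewrite em intrD /=; ring.
  by rewrite -pow_subE addrK.
Qed.

Lemma fmul_delta02_eq0 e0 e1 e2 : (forall m : int, e1 <> m%:~R + al) ->
  fmul (fun '(e0, e1, e2) => delta al e2 e1 e0)
    (fun '(p0, p1, p2) => if p1 == 0 then A p0 p2 else 0) (e0, e1, e2) = 0.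
Proof.
move=> h; apply: fmul_eq0 => -[[p0 p1] p2] /=; case: eqP => [->|//].
rewrite subr0 => h'; have [n hn] := delta_supp h'; move: h'; rewrite hn deltaE.
case/pow_sub_supp => j [h1 h2] _; apply: (h (n - j%:Z)).
by rewrite h1 intrB; ring.
Qed.

End ThreeVariables.

Section TwoVariables.
Variables (U : lmodType C) (al : C) (A : C -> U).

Lemma fmul_delta_xz (n : int) e1 :
  fmul (fun '(e0, e1) => delta_xz z al e0 e1)
    (fun '(p0, p1) => if p0 == 0 then A p1 else 0) (- n%:~R - 1 - al, e1)
  = mul_xc (- z) (n%:~R + al) A e1.
Proof.
rewrite (@fmul_nat _ _ _ _ _ (fun j => (0, e1 - (n%:~R + al) + j%:R))
  (fun j => binc (n%:~R + al) j * (- z) ^+ j)).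
- by apply: eq_fsum => j; rewrite eqxx.
- by move=> i j [/addrI/natC_inj].
- move=> [p0 p1] /=; case: eqP => [->|//]; rewrite subr0 delta_xzE.
  case/pow_xc_supp => j h1 _; exists j; congr (_, _).
  by transitivity (e1 - (e1 - p1)); [ring|rewrite h1; ring].
- move=> j /=; rewrite subr0 delta_xzE -pow_xcE.
  by have -> : e1 - (e1 - (n%:~R + al) + j%:R) = n%:~R + al - j%:R by ring.
Qed.

Lemma fmul_delta_xz_eq0 e0 e1 : (forall n : int, e0 <> - n%:~R - 1 - al) ->
  fmul (fun '(e0, e1) => delta_xz z al e0 e1)
    (fun '(p0, p1) => if p0 == 0 then A p1 else 0) (e0, e1) = 0.
Proof.
move=> h; apply: fmul_eq0 => -[p0 p1] /=; case: eqP => [->|//].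
by rewrite subr0 => /delta_xz_supp[n /h].
Qed.

Lemma fmul_delta_zx (n : int) e1 :
  fmul (fun '(e0, e1) => deltaN_zx z al e0 e1)
    (fun '(p0, p1) => if p0 == 0 then A p1 else 0) (- n%:~R - 1 - al, e1)
  = (-1) ^ n *: mul_cx z (-1) (n%:~R + al) A e1.
Proof.
rewrite (@fmul_nat _ _ _ _ _ (fun j => (0, e1 - j%:R))
  (fun j => (-1) ^ n *
    (binc (n%:~R + al) j * cpow z (n%:~R + al - j%:R) * (-1) ^+ j))).
- by rewrite -fsumZr; apply: eq_fsum => j; rewrite eqxx scalerA.
- by move=> i j [/addrI/oppr_inj/natC_inj].
- move=> [p0 p1] /=; case: eqP => [->|//]; rewrite subr0 deltaN_zxE.
  have [->|/eqP] := eqVneq (pow_cx z (-1) (n%:~R + al) (e1 - p1)) 0.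
    by rewrite mulr0.
  case/pow_cx_supp => j h1 _ _; exists j; congr (_, _).
  by transitivity (e1 - (e1 - p1)); [ring|rewrite h1; ring].
- move=> j /=; rewrite subr0 deltaN_zxE -pow_cxE.
  by have -> : e1 - (e1 - j%:R) = j%:R by ring.
Qed.

Lemma fmul_delta_zx_eq0 e0 e1 : (forall n : int, e0 <> - n%:~R - 1 - al) ->
  fmul (fun '(e0, e1) => deltaN_zx z al e0 e1)
    (fun '(p0, p1) => if p0 == 0 then A p1 else 0) (e0, e1) = 0.
Proof.
move=> h; apply: fmul_eq0 => -[p0 p1] /=; case: eqP => [->|//].
by rewrite subr0 => /deltaN_zx_supp[n /h].
Qed.

Lemma fmul_delta_z (m : int) e0 e1 : e1 = m%:~R + al ->
  fmul (fun '(e0, e1) => delta_z z al e1 e0)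
    (fun '(p0, p1) => if p1 == 0 then A p0 else 0) (e0, e1)
  = mul_cx z 1 (- e1 - 1) A e0.
Proof.
move=> em.
rewrite (@fmul_nat _ _ _ _ _ (fun j => (e0 - j%:R, 0))
  (fun j => binc (- e1 - 1) j * cpow z (- e1 - 1 - j%:R) * 1 ^+ j)).
- by apply: eq_fsum => j; rewrite eqxx.
- by move=> i j [/addrI/oppr_inj/natC_inj].
- move=> [p0 p1] /=; case: eqP => [->|//]; rewrite subr0.
  case/delta_z_supp => n [j [h1 h2]] _; exists j; congr (_, _).
  by transitivity (e0 - (e0 - p0)); [ring|rewrite h2].
- move=> j /=; rewrite subr0.
  have -> : e0 - (e0 - j%:R) = j%:R by ring.
  exact: delta_zE em.
Qed.

Lemma fmul_delta_z_eq0 e0 e1 : (forall m : int, e1 <> m%:~R + al) ->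
  fmul (fun '(e0, e1) => delta_z z al e1 e0)
    (fun '(p0, p1) => if p1 == 0 then A p0 else 0) (e0, e1) = 0.
Proof.
move=> h; apply: fmul_eq0 => -[p0 p1] /=; case: eqP => [->|//].
by rewrite subr0 => /delta_z_supp[n [j [/h]]].
Qed.

End TwoVariables.
End Kernels.

(** * Eigenspace decompositions *)

Section Eigen.
Variables (R : realType).
Local Notation C := R[i].
Variables (U : lmodType C) (L : U -> U).
Hypothesis linL : linear L.

Lemma lin0 (U1 U2 : lmodType C) (f : U1 -> U2) : linear f -> f 0 = 0.
Proof. by move=> lf; have := lf (-1) 0 0; rewrite scaler0 addr0 scaleN1r addNr. Qed.

Lemma linD (U1 U2 : lmodType C) (f : U1 -> U2) : linear f -> {morph f : x y / x + y}.
Proof. by move=> lf x y; have := lf 1 x y; rewrite !scale1r. Qed.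

Lemma linZ (U1 U2 : lmodType C) (f : U1 -> U2) : linear f ->
  forall c x, f (c *: x) = c *: f x.
Proof. by move=> lf c x; have := lf c x 0; rewrite (lin0 lf) !addr0. Qed.

Lemma linN (U1 U2 : lmodType C) (f : U1 -> U2) : linear f ->
  forall x, f (- x) = - f x.
Proof. by move=> lf x; rewrite -scaleN1r (linZ lf) scaleN1r. Qed.

Lemma lin_sum (U1 U2 : lmodType C) (f : U1 -> U2) : linear f ->
  forall (I : Type) (r : seq I) (F : I -> U1),
  f (\sum_(i <- r) F i) = \sum_(i <- r) f (F i).
Proof.
move=> lf I r F; elim: r => [|i r IH]; first by rewrite !big_nil lin0.
by rewrite !big_cons linD // IH.
Qed.

Lemma lin_fsum (U1 U2 : lmodType C) (f : U1 -> U2) : linear f ->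
  forall (I : choiceType) (F : I -> U1), fins F ->
  f (\sum_(i \in [set: I]) F i) = \sum_(i \in [set: I]) f (F i).
Proof. by move=> lf I F; apply: fsum_lin; [exact: lin0|exact: linD]. Qed.

Lemma eig_indep (r : seq C) (d : C -> U) : uniq r ->
  (forall h, L (d h) = h *: d h) -> \sum_(h <- r) d h = 0 ->
  forall h, h \in r -> d h = 0.
Proof.
elim: r d => [|h0 r IH] d //= /andP[h0r ur] Ld sd.
have d'0 : forall h, h \in r -> d h = 0.
  move=> h hr; have : (h - h0) *: d h = 0.
    (* Applying L - h0 removes the component at h0 and multiplies the others by h - h0. *)
    apply: (IH (fun h => (h - h0) *: d h)) => //.
      by move=> k; rewrite (linZ linL) Ld !scalerA mulrC.
    have E : forall h, (h - h0) *: d h = L (d h) - h0 *: d h.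
      by move=> k; rewrite Ld scalerBl.
    rewrite (eq_bigr _ (fun h _ => E h)) sumrB -(lin_sum linL) -scaler_sumr.
    move: sd; rewrite big_cons => /eqP; rewrite addrC addr_eq0 => /eqP ->.
    by rewrite (linN linL) Ld scalerN subrr.
  move/eqP; rewrite scaler_eq0 subr_eq0 => /orP[/eqP hh|/eqP //].
  by move: h0r; rewrite -hh hr.
move=> h; rewrite inE => /orP[/eqP ->|]; last exact: d'0.
move: sd; rewrite big_cons big_seq big1 ?addr0 // => k; exact: d'0.
Qed.

Lemma eigdec_fins (d : C -> U) u : eigdec L d u -> fins d.
Proof.
case=> /finite_seqP[r hr] _ _; exists r => h hr'; apply: contrapT => dh.
by move/negP: hr'; apply; have : [set h | d h <> 0] h by []; rewrite hr.
Qed.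

Lemma eigdec_uniq (d d' : C -> U) u : eigdec L d u -> eigdec L d' u -> d = d'.
Proof.
move=> hd hd'; have [r [ur h1 h2]] := fins2 (eigdec_fins hd) (eigdec_fins hd').
case: hd => _ Ld su; case: hd' => _ Ld' su'.
apply/funext => h; have [hr|hr] := boolP (h \in r); last by rewrite h1 ?h2.
apply/eqP; rewrite -subr_eq0; apply/eqP.
apply: (@eig_indep r (fun h => d h - d' h)) => //.
  by move=> k; rewrite (linD linL) (linN linL) Ld Ld' scalerBr.
rewrite sumrB; move: su su'; rewrite (fsum_seq ur) // (fsum_seq ur) // => <- <-.
exact: subrr.
Qed.

Lemma eigcompE (d : C -> U) u h : eigdec L d u -> eigcomp L h u = d h.
Proof.
move=> hd; rewrite /eigcomp; set P := [set x | _].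
have : P (xget 0 P) by apply: xgetPex; exists (d h); exists d.
by case=> d' [hd' ->]; rewrite (eigdec_uniq hd hd').
Qed.

Lemma eigdec_of_fins (d : C -> U) : fins d -> (forall h, L (d h) = h *: d h) ->
  eigdec L d (\sum_(h \in [set: C]) d h).
Proof.
move=> [r hr] Ld; split => //.
apply: (sub_finite_set (B := [set` r])); last exact: finite_seq.
by move=> h /= dh; apply: contrapT => /negP/hr.
Qed.

Lemma eigdec_hom k u : L u = k *: u -> eigdec L (fun h => if h == k then u else 0) u.
Proof.
move=> Lu.
have := @eigdec_of_fins (fun h => if h == k then u else 0).
rewrite (@fsum1 _ _ _ k) ?eqxx => [|h /negPf -> //]; apply.
  by exists [:: k] => h; rewrite inE => /negPf ->.
by move=> h; case: eqP => [->|] //; rewrite (lin0 linL) scaler0.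
Qed.

Lemma eigcomp_hom k h u : L u = k *: u -> eigcomp L h u = if h == k then u else 0.
Proof. by move=> /eigdec_hom /eigcompE ->. Qed.

Hypothesis ss : semisimple L.

Lemma eigdec_eigcomp u : eigdec L (fun h => eigcomp L h u) u.
Proof.
have [d hd] := ss u; rewrite (_ : (fun h => _) = d) //.
by apply/funext => h; exact: eigcompE.
Qed.

Lemma eigcomp_fins u : fins (fun h => eigcomp L h u).
Proof. exact: eigdec_fins (eigdec_eigcomp u). Qed.

Lemma eigcomp_eig h u : L (eigcomp L h u) = h *: eigcomp L h u.
Proof. by case: (eigdec_eigcomp u). Qed.

Lemma eigcomp_sum u : u = \sum_(h \in [set: C]) eigcomp L h u.
Proof. by case: (eigdec_eigcomp u). Qed.

Lemma eigcomp_linear h : linear (eigcomp L h).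
Proof.
move=> a u v; apply: (eigcompE h (d := fun h => a *: eigcomp L h u + eigcomp L h v)).
have fu := eigcomp_fins u; have fv := eigcomp_fins v.
rewrite {2}[u]eigcomp_sum {2}[v]eigcomp_sum -fsum_lincomb //.
apply: eigdec_of_fins; first by apply: finsD => //; apply: (fins_supp fu) => k ->; rewrite scaler0.
by move=> k; rewrite linL !eigcomp_eig scalerDr !scalerA mulrC.
Qed.

Lemma ss_ind (P : U -> Prop) :
  (forall h u, L u = h *: u -> P u) -> (forall u v, P u -> P v -> P (u + v)) ->
  forall u, P u.
Proof.
move=> Phom PD u; rewrite [u]eigcomp_sum.
have [r [ur hr]] := fins_uniq (eigcomp_fins u); rewrite (fsum_seq ur) //.
elim: (r) => [|h s IH].
  by rewrite big_nil; apply: (Phom 0); rewrite (lin0 linL) scale0r.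
by rewrite big_cons; apply: PD => //; apply: (Phom h); exact: eigcomp_eig.
Qed.

Lemma eigcomp_comm (g : U -> U) h u : linear g -> (forall v, g (L v) = L (g v)) ->
  eigcomp L h (g u) = g (eigcomp L h u).
Proof.
move=> lg gL; apply: (eigcompE h (d := fun h => g (eigcomp L h u))).
rewrite {2}[u]eigcomp_sum (lin_fsum lg); last exact: eigcomp_fins.
apply: eigdec_of_fins.
  by apply: (fins_supp (eigcomp_fins u)) => k ->; exact: lin0.
by move=> k; rewrite -gL eigcomp_eig (linZ lg).
Qed.

End Eigen.

(** * Roots of unity and projections onto eigenspaces *)

Section Roots.
Variables (R : realType) (T : nat).
Local Notation C := R[i].
Local Notation frac := (Defs.frac R).
Local Notation rootu := (Defs.rootu R).
Hypothesis T_gt0 : (0 < T)%N.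

Let T0 : T%:R != 0 :> C.
Proof. by rewrite pnatr_eq0 -lt0n. Qed.

Lemma fracD (i j : int) : frac T (i + j) = frac T i + frac T j.
Proof. by rewrite /Defs.frac intrD mulrDl. Qed.

Lemma fracN (i : int) : frac T (- i) = - frac T i.
Proof. by rewrite /Defs.frac intrN mulNr. Qed.

Lemma frac0 : frac T 0 = 0.
Proof. by rewrite /Defs.frac mul0r. Qed.

Lemma frac_mul (i : int) : frac T (i * T%:Z) = i%:~R.
Proof. by rewrite /Defs.frac intrM mulfK. Qed.

Lemma frac_inj : injective (frac T).
Proof. by move=> i j /(mulIf (invr_neq0 T0)) /intC_inj. Qed.

Lemma rootuD (i j : int) : rootu T (i + j) = rootu T i * rootu T j.
Proof. by rewrite /Defs.rootu fracD mulrDr expipiD. Qed.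

Lemma rootu0 : rootu T 0 = 1.
Proof. by rewrite /Defs.rootu frac0 mulr0 expipi0. Qed.

Lemma rootu_neq0 (i : int) : rootu T i != 0.
Proof. exact: expipi_neq0. Qed.

Lemma rootuN (i : int) : rootu T (- i) = (rootu T i)^-1.
Proof. by rewrite /Defs.rootu fracN mulrN expipiN. Qed.

Lemma rootu_mulT (i : int) : rootu T (i * T%:Z) = 1.
Proof.
rewrite /Defs.rootu frac_mul mulrC.
have -> : i%:~R * 2 = (i * 2)%:~R :> C by rewrite intrM.
by rewrite expipi_int mulrC -exprz_exp -exprnP sqrrN expr1n exp1rz.
Qed.

Lemma rootuMn (i : int) (n : nat) : rootu T (n%:Z * i) = rootu T i ^+ n.
Proof.
elim: n => [|n IH]; first by rewrite mul0r rootu0 expr0.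
by rewrite -addn1 PoszD mulrDl mul1r rootuD IH addn1 exprSr.
Qed.

Lemma rootu_eq1 (i : int) : rootu T i = 1 -> exists m, i = m * T%:Z.
Proof.
rewrite {1}(divz_eq i T%:Z) rootuD rootu_mulT mul1r.
have TZ : T%:Z != 0 by rewrite -lt0n.
have r0 : 0 <= (i %% T%:Z)%Z by exact: modz_ge0.
have rT : (i %% T%:Z)%Z < T%:Z by apply: ltz_pmod; rewrite ltz_nat.
have [m0|rn0] := eqVneq (i %% T%:Z)%Z 0.
  by move=> _; exists (i %/ T%:Z)%Z; rewrite {1}(divz_eq i T%:Z) m0 addr0.
have : (0 < (i %% T%:Z)%Z)%R by rewrite lt_neqAle eq_sym rn0.
case: (i %% T%:Z)%Z r0 rT rn0 => // r _ rT _ rp.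
rewrite /Defs.rootu /expipi /Defs.frac.
have -> : 2 * (r%:Z%:~R / T%:R) * (0 +i* pi) = 0 +i* (2 * (pi * (r%:R / T%:R))) :> C.
  have -> : 2 * (r%:Z%:~R / T%:R) = (2 * (r%:R / T%:R))%:C :> C.
    by rewrite rmorphM fmorph_div !rmorph_nat.
  by apply/eqP; rewrite eq_complex /=; apply/andP; split; apply/eqP; ring.
move=> /= /eqP; rewrite eq_complex /= expR0 mul1r => /andP[/eqP c1 _].
have pi0 := pi_gt0 R.
have TR : 0 < T%:R :> R by rewrite ltr0n.
(* Here t lies strictly between 0 and pi, so sin t > 0 and the real part cos (2 t) = 1 - 2 sin^2 t
   cannot be 1. *)
set t := pi * (r%:R / T%:R) in c1.
have t0 : 0 < t by rewrite mulr_gt0 // divr_gt0 // ltr0n.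
have tpi : t < pi.
  by rewrite -[X in _ < X]mulr1 ltr_pM2l // ltr_pdivrMr // mul1r ltr_nat.
have st : 0 < sin t by apply: sin_gt0_pi; rewrite t0 tpi.
move: c1; rewrite mulr_natl mulr2n cosD -!expr2 cos2sin2.
by move=> c1; have := exprn_gt0 2 st; lra.
Qed.

Lemma rootu_orth (k : int) :
  \sum_(i < T) rootu T (i%:Z * k) =
  if `[< exists m, k = m * T%:Z >] then T%:R else 0.
Proof.
case: asboolP => [[m ->]|nk].
  rewrite (eq_bigr (fun=> 1)) ?sumr_const ?card_ord // => i _.
  by rewrite mulrA rootu_mulT.
have r1 : rootu T k != 1 by apply/eqP => /rootu_eq1.
rewrite (eq_bigr (fun i : 'I_T => rootu T k ^+ i)); last first.
  by move=> i _; rewrite rootuMn.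
apply: (mulfI (x := rootu T k - 1)); first by rewrite subr_eq0.
by rewrite -subrX1 -rootuMn mulrC rootu_mulT subrr mulr0.
Qed.

End Roots.

Section CyclicProjection.
Variables (R : realType) (T : nat) (U : lmodType R[i]) (s : U -> U).
Local Notation C := R[i].
Local Notation rootu := (Defs.rootu R).
Hypotheses (T_gt0 : (0 < T)%N) (lins : linear s) (order : forall v, iter T s v = v).

(** Averaging over the cyclic group generated by s: the projection onto the eigenspace of
    [rootu T j]. By [proj2E], [proj2] is a composite of two of these. *)
Definition cyc_proj (j : int) (v : U) : U :=
  T%:R^-1 *: \sum_(a < T) rootu T (- (a%:Z * j)) *: iter a s v.

Lemma linear_iter (n : nat) : linear (iter n s).
Proof. by elim: n => [|n IH] a x y //; rewrite !iterS IH lins. Qed.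

Lemma cyc_proj_linear j : linear (cyc_proj j).
Proof.
move=> a x y; rewrite /cyc_proj scalerA mulrC -scalerA -scalerDr; congr (_ *: _).
rewrite scaler_sumr -big_split; apply: eq_bigr => b _ /=.
by rewrite linear_iter scalerDr !scalerA mulrC.
Qed.

Lemma cyc_proj_comm (g : U -> U) j v : linear g -> (forall v, g (s v) = s (g v)) ->
  g (cyc_proj j v) = cyc_proj j (g v).
Proof.
move=> lg gs; rewrite (linZ lg) (lin_sum lg); congr (_ *: _).
apply: eq_bigr => a _; rewrite (linZ lg); congr (_ *: _).
by elim: (nat_of_ord a) => // n IH; rewrite !iterS gs IH.
Qed.

Lemma cyc_proj_eig j v : s (cyc_proj j v) = rootu T j *: cyc_proj j v.
Proof.
rewrite (linZ lins) (lin_sum lins) scalerA mulrC -scalerA; congr (_ *: _).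
have [n Tn] : exists n, T = n.+1 by case: (T) T_gt0 => // n _; exists n.
rewrite scaler_sumr.
pose F (a : nat) := (rootu T j * rootu T (- (a%:Z * j))) *: iter a s v.
transitivity (\sum_(a < T) F a.+1).
  apply: eq_bigr => a _; rewrite (linZ lins) -iterS /F -rootuD; congr (rootu T _ *: _).
  by rewrite -addn1 PoszD mulrDl mul1r; ring.
transitivity (\sum_(a < T) F a); last by apply: eq_bigr => a _; rewrite scalerA.
(* Applying s shifts the summation index by one; the sum closes up because s and the root of unity
   both have order dividing T. *)
have FT : F T = F 0%N.
  rewrite /F order /= mul0r oppr0 rootu0 mulr1; congr (_ *: _).
  by rewrite (_ : - (T%:Z * j) = - j * T%:Z) ?rootu_mulT ?mulr1 //; ring.
move: FT; clear; case: (T) => [|n FT]; first by rewrite !big_ord0.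
by rewrite big_ord_recr [RHS]big_ord_recl /= FT addrC.
Qed.

(** Exchanging the sums, orthogonality of roots of unity leaves only a = 0, the one multiple of T
    with 0 <= a < T. *)
Lemma cyc_proj_sum v : \sum_(j < T) cyc_proj j v = v.
Proof.
rewrite /cyc_proj -scaler_sumr exchange_big.
rewrite (eq_bigr (fun a : 'I_T => (if a == 0%N :> nat then T%:R else 0) *: iter a s v)).
  case: (T) T_gt0 => // n _; rewrite big_ord_recl big1 /= ?addr0.
    by rewrite scalerA mulVf ?scale1r // pnatr_eq0.
  by move=> i _; rewrite scale0r.
move=> a _; rewrite -scaler_suml; congr (_ *: _).
rewrite (eq_bigr (fun j : 'I_T => rootu T (j%:Z * - a%:Z))); last first.
  by move=> j _; rewrite mulrN mulrC.
rewrite rootu_orth //; case: eqP => [a0|a0]; case: asboolP => //.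
  by case; exists 0; rewrite a0 mul0r oppr0.
case=> m hm; exfalso; have aT := ltn_ord a.
have [m0|m0] := leP 0 m; first by nia.
have : m * T%:Z <= - T%:Z by nia.
by rewrite -hm; lia.
Qed.

Lemma cyc_proj_of_eig (i : int) j v : s v = rootu T i *: v ->
  cyc_proj j v = (if `[< exists m, i - j = m * T%:Z >] then 1 else 0) *: v.
Proof.
move=> sv; have it a : iter a s v = rootu T (a%:Z * i) *: v.
  elim: a => [|a IH]; first by rewrite mul0r rootu0 scale1r.
  by rewrite iterS IH (linZ lins) sv scalerA -rootuD -addn1 PoszD mulrDl mul1r.
rewrite /cyc_proj (eq_bigr (fun a : 'I_T => rootu T (a%:Z * (i - j)) *: v)).
  rewrite -scaler_suml rootu_orth // scalerA.
  by case: asboolP => _; rewrite ?mulr0 // mulVf // pnatr_eq0 -lt0n.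
by move=> a _; rewrite it scalerA -rootuD; congr (rootu T _ *: _); ring.
Qed.

End CyclicProjection.

(** * Joint eigenspaces of the two automorphisms *)

Section Twisting.
Variables (R : realType) (V : voa R) (T : nat).
Local Notation C := R[i].
Local Notation frac := (Defs.frac R).
Local Notation rootu := (Defs.rootu R).

Record twisting (s1 s2 sigma : V -> V) : Prop := Twisting {
  tws_aut1 : voa_aut s1;
  tws_aut2 : voa_aut s2;
  tws_comm : forall v, s1 (s2 v) = s2 (s1 v);
  tws_gt0 : (0 < T)%N;
  tws_order1 : forall v, iter T s1 v = v;
  tws_order2 : forall v, iter T s2 v = v;
  tws_K : cancel (s1 \o s2) sigma;
  tws_VK : cancel sigma (s1 \o s2)
}.

Variables (s1 s2 sigma : V -> V).
Hypothesis H : twisting s1 s2 sigma.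

Let T_gt0 := tws_gt0 H.
Let o1 := tws_order1 H.
Let o2 := tws_order2 H.

Lemma tws_lin1 : linear s1. Proof. by case: (tws_aut1 H). Qed.
Lemma tws_lin2 : linear s2. Proof. by case: (tws_aut2 H). Qed.

Let l1 := tws_lin1.
Let l2 := tws_lin2.

Lemma tws_sigma_lin : linear sigma.
Proof.
move=> a u v; rewrite -[a *: sigma u + sigma v](tws_K H) /= l2 l1.
by rewrite -/((s1 \o s2) _) -/((s1 \o s2) (sigma v)) !(tws_VK H).
Qed.

Lemma proj2E j1 j2 v : proj2 T s1 s2 j1 j2 v = cyc_proj T s1 j1 (cyc_proj T s2 j2 v).
Proof.
rewrite /proj2 /cyc_proj.
rewrite [in RHS](eq_bigr (fun a : 'I_T => T%:R^-1 *: \sum_(b < T)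
    rootu T (- (a%:Z * j1 + b%:Z * j2)) *: iter a s1 (iter b s2 v))).
  by rewrite -scaler_sumr scalerA -invfM -expr2.
move=> a _; rewrite (linZ (linear_iter l1 a)) (lin_sum (linear_iter l1 a)).
rewrite scalerA mulrC -scalerA scaler_sumr; congr (_ *: _).
apply: eq_bigr => b _; rewrite (linZ (linear_iter l1 a)) scalerA -rootuD //.
by rewrite opprD.
Qed.

Lemma proj2_linear j1 j2 : linear (proj2 T s1 s2 j1 j2).
Proof.
by move=> a u v; rewrite !proj2E (cyc_proj_linear T l2) (cyc_proj_linear T l1).
Qed.

Lemma proj2_eig j1 j2 v : eigV2 T s1 s2 j1 j2 (proj2 T s1 s2 j1 j2 v).
Proof.
rewrite proj2E; split; rewrite /eigV; first exact: cyc_proj_eig.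
rewrite (cyc_proj_comm T j1 _ l2) => [|w]; last by rewrite (tws_comm H).
by rewrite cyc_proj_eig // (linZ (cyc_proj_linear T l1 j1)).
Qed.

Lemma proj2_sum v : \sum_(j1 < T) \sum_(j2 < T) proj2 T s1 s2 j1 j2 v = v.
Proof.
rewrite -[RHS](cyc_proj_sum s1 T_gt0); apply: eq_bigr => j1 _.
rewrite -[in RHS](cyc_proj_sum s2 T_gt0 v).
rewrite (lin_sum (cyc_proj_linear T l1 j1)); apply: eq_bigr => j2 _.
exact: proj2E.
Qed.

(** Indices of [eigV2] are arbitrary integers and only count modulo T, hence the two congruences. *)
Lemma proj2_of_eig i1 i2 j1 j2 v : eigV2 T s1 s2 i1 i2 v ->
  proj2 T s1 s2 j1 j2 v =
  (if `[< (exists m, i1 - j1 = m * T%:Z) /\ (exists m, i2 - j2 = m * T%:Z) >]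
   then 1 else 0) *: v.
Proof.
case=> e1 e2; rewrite proj2E (cyc_proj_of_eig T_gt0 l2 _ e2).
rewrite (linZ (cyc_proj_linear T l1 j1)) (cyc_proj_of_eig T_gt0 l1 _ e1) scalerA.
case: (asboolP (exists m, i1 - j1 = _)) => h1;
  case: (asboolP (exists m, i2 - j2 = _)) => h2;
  case: asboolP => [[]|h] //; rewrite ?mulr0 ?mul0r ?mulr1 //.
by case: h.
Qed.

Lemma eigV2_sigma j1 j2 v : eigV2 T s1 s2 j1 j2 v -> eigV T sigma (- (j1 + j2)) v.
Proof.
case=> e1 e2; rewrite /eigV.
have : s1 (s2 v) = rootu T (j1 + j2) *: v.
  by rewrite e2 (linZ l1) e1 scalerA -rootuD addrC.
move/(congr1 sigma); rewrite -/((s1 \o s2) v) (tws_K H) (linZ tws_sigma_lin).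
by move=> {2}->; rewrite scalerA rootuN mulVf ?rootu_neq0 // scale1r.
Qed.

Lemma eigV2_lin j1 j2 c u v : eigV2 T s1 s2 j1 j2 u -> eigV2 T s1 s2 j1 j2 v ->
  eigV2 T s1 s2 j1 j2 (c *: u + v).
Proof.
move=> [u1 u2] [v1 v2]; split; rewrite /eigV.
  by rewrite l1 u1 v1 scalerDr !scalerA mulrC.
by rewrite l2 u2 v2 scalerDr !scalerA mulrC.
Qed.

Lemma eigV2_mod j1 j2 i1 i2 v : (exists m, j1 - i1 = m * T%:Z) ->
  (exists m, j2 - i2 = m * T%:Z) -> eigV2 T s1 s2 j1 j2 v -> eigV2 T s1 s2 i1 i2 v.
Proof.
move=> [m h1] [n h2] [e1 e2]; split; rewrite /eigV.
  by rewrite e1 (_ : j1 = i1 + m * T%:Z) ?rootuD ?rootu_mulT ?mulr1 // -h1; ring.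
by rewrite e2 (_ : j2 = i2 + n * T%:Z) ?rootuD ?rootu_mulT ?mulr1 // -h2; ring.
Qed.

Lemma eigV2_ind (P : V -> Prop) :
  (forall j1 j2 v, eigV2 T s1 s2 j1 j2 v -> P v) ->
  (forall u v, P u -> P v -> P (u + v)) -> forall v, P v.
Proof.
move=> Pe PD v; rewrite -[v]proj2_sum.
have P0 : P 0.
  by apply: (Pe 0 0); split; rewrite /eigV (lin0 l1, lin0 l2) scaler0.
do 2![elim/big_ind: _ => // ? _]; apply: Pe; exact: proj2_eig.
Qed.

End Twisting.

(** * Modes of the vertex operator algebra *)

Section VOAModes.
Variables (R : realType) (V : voa R).
Local Notation C := R[i].

Definition LV (n : int) : V -> V := Lmode (@voaY R V) (omega V) n.

Lemma voaY_linr (u : V) e : linear (fun v => voaY u v e).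
Proof. by case: (voaY_bilin V e). Qed.

Lemma LV_linear n : linear (LV n).
Proof. exact: voaY_linr. Qed.

Lemma LV_comm (m n : int) v : m + n != 0 ->
  LV m (LV n v) - LV n (LV m v) = (m - n)%:~R *: LV (m + n) v.
Proof. by move=> mn; rewrite voa_virasoro (negPf mn) addr0. Qed.

Lemma semisimple_LV : semisimple (LV 0).
Proof. by move=> v; have [d [hd _]] := voa_grading v; exists d. Qed.

Lemma weight_int k v : LV 0 v = k *: v -> v <> 0 -> exists n : int, k = n%:~R.
Proof.
move=> kv v0; have [d [hd di]] := voa_grading v.
apply: di; rewrite (eigdec_uniq (LV_linear 0) hd (eigdec_hom (LV_linear 0) kv)).
by rewrite eqxx.
Qed.

Lemma weightV_ind (P : V -> Prop) :
  (forall (n : int) v, LV 0 v = n%:~R *: v -> P v) ->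
  (forall u v, P u -> P v -> P (u + v)) -> forall v, P v.
Proof.
move=> Ph PD; apply: (ss_ind (LV_linear 0) semisimple_LV) => // k v kv.
have [v0|/eqP v0] := eqVneq v 0.
  by apply: (Ph 0); rewrite v0 (lin0 (LV_linear 0)) scaler0.
by have [n hn] := weight_int kv v0; apply: (Ph n); rewrite -hn.
Qed.

Lemma LV1_weight k v : LV 0 v = k *: v -> LV 0 (LV 1 v) = (k - 1) *: LV 1 v.
Proof.
move=> kv; have := @LV_comm 0 1 v isT; rewrite kv (linZ (LV_linear 1)) !add0r.
by move=> /(canRL (subrK _)) ->; rewrite scalerBl scale1r scaleN1r addrC.
Qed.

Lemma LV1_iter_weight k v i : LV 0 v = k *: v ->
  LV 0 (iter i (LV 1) v) = (k - i%:R) *: iter i (LV 1) v.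
Proof.
move=> kv; elim: i => [|i IH]; first by rewrite subr0.
rewrite iterS (LV1_weight IH) -natr1; congr (_ *: _); ring.
Qed.

(** L(1) lowers weights by one and weights are bounded below. This makes e^{x L(1)} v a finite
    sum. *)
Lemma LV1_nilp v : exists B : nat, forall i, (B <= i)%N -> iter i (LV 1) v = 0.
Proof.
elim/weightV_ind: v => [n v nv|u v [B hB] [B' hB']].
  have [N hN] := voa_bounded V; exists (`|n - N|.+1)%N => i iB.
  apply: (hN (n - i%:Z)); first by lia.
  by have := LV1_iter_weight i nv; rewrite intrB.
exists (maxn B B') => i; rewrite geq_max => /andP[h1 h2].
by rewrite (linD (linear_iter (LV_linear 1) i)) hB // hB' // addr0.
Qed.

Lemma vac_creation (v : V) : voaY v (vac V) 0 = v.
Proof. by case: (voaY_creation v). Qed.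

Lemma vac_creation_neg (v : V) (n : int) : n < 0 -> voaY v (vac V) n%:~R = 0.
Proof. by case: (voaY_creation v) => _; exact. Qed.

Lemma LV_vac (n : int) : -1 <= n -> LV n (vac V) = 0.
Proof.
move=> n1; rewrite /LV /Lmode.
have -> : - n%:~R - 2 = (- n - 2)%:~R :> C by rewrite intrB intrN.
by apply: vac_creation_neg; lia.
Qed.

(** With omega written as L(-2) applied to the vacuum, the Virasoro relations show that omega is
    quasi-primary of weight 2. *)
Lemma LV_m2_vac : LV (-2) (vac V) = omega V.
Proof.
rewrite /LV /Lmode; have -> : - (-2)%:~R - 2 = 0 :> C by rewrite mulrNz opprK subrr.
exact: vac_creation.
Qed.

Lemma LV0_omega : LV 0 (omega V) = 2 *: omega V.
Proof.
rewrite -LV_m2_vac; have := @LV_comm 0 (-2) (vac V) isT.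
by rewrite (LV_vac (n := 0)) // (lin0 (LV_linear _)) subr0 => ->.
Qed.

Lemma LV1_omega : LV 1 (omega V) = 0.
Proof.
rewrite -LV_m2_vac; have := @LV_comm 1 (-2) (vac V) isT.
rewrite (LV_vac (n := 1)) // (lin0 (LV_linear _)) subr0 => ->.
by rewrite LV_vac ?scaler0.
Qed.

Lemma LV_m1E (v : V) : voaY v (vac V) 1 = LV (-1) v.
Proof.
have := congr1 (fun f => f 0) (voa_L1der v (vac V)).
by rewrite vac_creation /dser add0r scale1r.
Qed.

Lemma voaY_low (u v : V) : exists N : nat, forall n : int,
  n < - N%:Z -> voaY u v n%:~R = 0.
Proof.
have [_ [N hN]] := voaY_laurent u v; exists `|N|%N => n nN.
by apply: hN; lia.
Qed.

Section Automorphism.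
Variables (g : V -> V).
Hypothesis ag : voa_aut g.

Lemma aut_lin : linear g. Proof. by case: ag. Qed.

Lemma aut_LV n v : g (LV n v) = LV n (g v).
Proof. by case: ag => _ _ _ go gY; rewrite /LV /Lmode gY go. Qed.

End Automorphism.

(** * The opposite vertex operators *)

Lemma oppser_term_fins (v : V) e (n : int) :
  fins (fun i : nat => (mono (i%:R - 2 * n%:~R) e * (-1) ^ n / (i`!)%:R) *:
      iter i (LV 1) (eigcomp (LV 0) n%:~R v)).
Proof.
have [B hB] := LV1_nilp (eigcomp (LV 0) n%:~R v).
by apply: (fins_nat (B := B)) => i /hB ->; rewrite scaler0.
Qed.

Let opps (v : V) e (n : int) : V :=
  \sum_(i \in [set: nat])
    (mono (i%:R - 2 * n%:~R) e * (-1) ^ n / (i`!)%:R) *: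
      iter i (LV 1) (eigcomp (LV 0) n%:~R v).

Lemma iter_LV1_0 i : iter i (LV 1) 0 = 0.
Proof. exact: lin0 (linear_iter (LV_linear 1) i). Qed.

Let opps_fins v e : fins (opps v e).
Proof.
have [r hr] := eigcomp_fins (LV_linear 0) semisimple_LV v.
(* The sum runs over integers n while eigenvalues are complex; the floor of the real part recovers n
   from its image in the complex numbers. *)
exists [seq Num.floor (complex.Re h) | h <- r] => n nr.
apply: fsum0 => i; rewrite hr ?iter_LV1_0 ?scaler0 //.
apply: contra nr => nr; apply/mapP; exists (n%:~R) => //.
have -> : complex.Re (n%:~R : C) = n%:~R by rewrite -(rmorph_int (real_complex R)).
by rewrite intrKfloor.
Qed.

Lemma oppser_linear e : linear (fun v : V => oppser v e).
Proof.
move=> a u v; rewrite /oppser -fsum_lincomb; [|exact: opps_fins|exact: opps_fins].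
apply: eq_fsum => n; rewrite -fsum_lincomb; [|exact: oppser_term_fins|exact: oppser_term_fins].
apply: eq_fsum => i; rewrite (eigcomp_linear (LV_linear 0) semisimple_LV).
by rewrite (linear_iter (LV_linear 1)) scalerDr !scalerA [_ * a]mulrC.
Qed.

Lemma oppser_hom (n : int) (v : V) e : LV 0 v = n%:~R *: v ->
  oppser v e = \sum_(i \in [set: nat])
    (mono (i%:R - 2 * n%:~R) e * (-1) ^ n / (i`!)%:R) *: iter i (LV 1) v.
Proof.
move=> nv; rewrite /oppser (@fsum1 _ _ _ n).
  by apply: eq_fsum => i; rewrite (eigcomp_hom (LV_linear 0) _ nv) eqxx.
move=> m mn; apply: fsum0 => i.
by rewrite (eigcomp_hom (LV_linear 0) _ nv) eqr_int (negPf mn) iter_LV1_0 scaler0.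
Qed.

Lemma oppser_fins (v : V) : fins (oppser v).
Proof.
elim/weightV_ind: v => [n v nv|u v [r hr] [s hs]]; last first.
  exists (r ++ s) => p; rewrite mem_cat => /norP[h1 h2].
  by rewrite (linD (oppser_linear p)) hr // hs // addr0.
have [B hB] := LV1_nilp v.
exists [seq i%:R - 2 * n%:~R | i <- iota 0 B] => p pr.
rewrite (oppser_hom _ nv); apply: fsum0 => i.
have [iB|iB] := leqP B i; first by rewrite hB // scaler0.
rewrite /mono; case: eqP => [pe|_]; last by rewrite !mul0r scale0r.
by case/negP: pr; rewrite pe; apply/mapP; exists i; rewrite // mem_iota.
Qed.

Lemma oppser_int (v : V) e : oppser v e <> 0 -> exists n : int, e = n%:~R.
Proof.
elim/weightV_ind: v => [n v nv|u v IHu IHv].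
  move=> h; apply: contrapT => ni; apply: h; rewrite (oppser_hom _ nv).
  apply: fsum0 => i; rewrite /mono; case: eqP => [pe|_]; last by rewrite !mul0r scale0r.
  by case: ni; exists (i%:Z - 2 * n); rewrite pe intrB intrM.
rewrite (linD (oppser_linear e)).
have [->|/eqP] := eqVneq (oppser u e) 0; first by rewrite add0r.
by move=> /IHu.
Qed.

Lemma aut_oppser (g : V -> V) (v : V) e : voa_aut g -> g (oppser v e) = oppser (g v) e.
Proof.
move=> ag; have lg := aut_lin ag.
rewrite /oppser (lin_fsum lg (opps_fins v e)); apply: eq_fsum => n.
rewrite (lin_fsum lg (oppser_term_fins v e n)); apply: eq_fsum => i.
rewrite (linZ lg); congr (_ *: _).
rewrite (eigcomp_comm (LV_linear 0) semisimple_LV _ _ lg); last exact: aut_LV.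
by elim: i => // i IH; rewrite !iterS aut_LV // IH.
Qed.

Lemma oppser_eig T (g : V -> V) j (v : V) e : voa_aut g -> eigV T g j v ->
  eigV T g j (oppser v e).
Proof.
by move=> ag gv; rewrite /eigV aut_oppser // gv (linZ (oppser_linear e)).
Qed.

Lemma oppser_vac e : oppser (vac V) e = mono 0 e *: vac V.
Proof.
have v0 : LV 0 (vac V) = (0 : int)%:~R *: vac V by rewrite LV_vac // scale0r.
rewrite (oppser_hom _ v0) (@fsum1 _ _ _ 0%N).
  by rewrite /= expr0z fact0 divr1 mulr1 mulr0z mulr0 subr0.
move=> [|i] // _; rewrite iterSr LV_vac // iter_LV1_0 scaler0 //.
Qed.

Lemma oppser_omega e : oppser (omega V) e = mono (-4) e *: omega V.
Proof.
rewrite (oppser_hom (n := 2) _ LV0_omega) (@fsum1 _ _ _ 0%N).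
  rewrite /= fact0 divr1 -exprnP sqrrN expr1n mulr1 sub0r; congr (mono _ _ *: _).
  by rewrite -natrM.
move=> [|i] // _; rewrite iterSr LV1_omega // iter_LV1_0 scaler0 //.
Qed.

End VOAModes.

(** * Twisted modules *)

Section TwistedModule.
Variables (R : realType) (V : voa R) (T : nat) (tau : V -> V) (M : twmod T tau).
Local Notation C := R[i].
Local Notation frac := (Defs.frac R).
Local Notation Y := (@twY R V T tau M).
Local Notation LM n := (Lmode Y (omega V) n).

Lemma tw_linr v e : linear (fun w : M => Y v w e).
Proof. by case: (twY_bilin M e). Qed.

Lemma tw_linl (w : M) e : linear (fun v : V => Y v w e).
Proof. by case: (twY_bilin M e) => _; exact. Qed.

Lemma L0_linear : linear (L0 (M := M)).
Proof. exact: tw_linr. Qed.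

Lemma tw_supp_eig j v (w : M) e : eigV T tau j v -> Y v w e <> 0 ->
  exists n : int, e = n%:~R - frac T j.
Proof.
move=> /(twY_laurent w) [h _] ye; have [] := h (e + frac T j).
  by rewrite /xshift addrK.
by move=> n hn; exists n; rewrite -hn addrK.
Qed.

(** [spanned] expresses as an induction principle that V is the sum of the eigenspaces of [tau]; in
    this form it serves [sigma], [s1] and [s2] alike. *)
Hypotheses (aut : voa_aut tau)
  (spanned : forall P : V -> Prop, (forall j v, eigV T tau j v -> P v) ->
     (forall u v, P u -> P v -> P (u + v)) -> forall v, P v).

Lemma tw_lowtr v (w : M) : lowtr (Y v w).
Proof.
elim/spanned: v => [j v jv|u v hu hv]; last first.
  by apply: (lowtr_supp (lowtrD hu hv)) => e; rewrite (linD (tw_linl w e)).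
move=> q; have [_ [N hN]] := twY_laurent w jv.
have [[n hn]|nq] := pselect (exists n : int, q = n%:~R - frac T j).
  exists `|n - N|.+1%N => i iB.
  have := hN (n - i%:Z); rewrite /xshift hn intrB; move=> h.
  by rewrite (_ : _ - _ = n%:~R - i%:R - frac T j) ?h //; [lia|ring].
exists 0%N => i _; apply: contrapT => /(tw_supp_eig jv)[n hn]; apply: nq.
by exists (n + i%:Z); rewrite intrD /= addrAC -hn subrK.
Qed.

Lemma tw_jacobi_coef j u v (w : M) (n m : int) e1 e2 : eigV T tau j u ->
  e1 = m%:~R - frac T j ->
  \sum_(i \in [set: nat]) (binc n%:~R i * (-1) ^+ i) *:
      Y u (Y v w (e2 - i%:R)) (e1 - n%:~R + i%:R)
  - (-1) ^ n *: \sum_(i \in [set: nat]) (binc n%:~R i * (-1) ^+ i) *: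
      Y v (Y u w (e1 - i%:R)) (e2 - n%:~R + i%:R)
  = \sum_(i \in [set: nat]) binc (- e1 - 1) i *:
      Y (voaY u v (- n%:~R - 1 - i%:R)) w (e2 + e1 + 1 + i%:R).
Proof.
move=> ju em; have := twY_jacobi v ju w (- n%:~R - 1 - 0, e1, e2).
rewrite fmul_delta12 fmul_delta21.
rewrite (fmul_delta02 _ _ _ em) !addr0 subr0.
by [].
Qed.

(** The derivative property is not an axiom of [twmod]; it follows from the Jacobi identity for v
    and the vacuum. *)
Lemma tw_L1der v (w : M) e : Y (LV (-1) v) w e = (e + 1) *: Y v w (e + 1).
Proof.
elim/spanned: v e => [j v jv|u v hu hv] e; last first.
  by rewrite (linD (LV_linear (-1))) !(linD (tw_linl w _)) hu hv scalerDr.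
have jLv : eigV T tau j (LV (-1) v).
  by rewrite /eigV aut_LV // jv (linZ (LV_linear (-1))).
have [[m em]|ne] := pselect (exists m : int, e = m%:~R - frac T j); last first.
  have -> : Y (LV (-1) v) w e = 0.
    by apply: contrapT => /(tw_supp_eig jLv)[m em]; apply: ne; exists m.
  suff -> : Y v w (e + 1) = 0 by rewrite scaler0.
  apply: contrapT => /(tw_supp_eig jv)[m em]; apply: ne; exists (m - 1).
  by rewrite intrB addrAC -em addrK.
(* On the left the vacuum is met at the exponents -1 - i and 1 + i only, so both products vanish. On
   the right n = -2 selects the coefficients of x and of 1 in Y(v, x) applied to the vacuum, namely
   L(-1) v and v. *)
have := tw_jacobi_coef (vac V) w (-2) (-1) jv em.
rewrite [X in X - _]fsum0 => [|i]; last first.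
  rewrite (twY_vac w) /mono.
  have -> : (-1 - i%:R == 0 :> C) = false.
    by apply/negP; rewrite -opprD oppr_eq0 -(natrD _ 1) pnatr_eq0.
  by rewrite scale0r (lin0 (tw_linr v _)) scaler0.
rewrite [X in _ - _ *: X]fsum0 => [|i]; last first.
  rewrite (twY_vac (Y v w _)) /mono mulrNz opprK.
  have -> : (-1 + 2%:~R + i%:R == 0 :> C) = false.
    have -> : -1 + 2%:~R + i%:R = (1 + i)%:R :> C by rewrite natrD /=; ring.
    by rewrite pnatr_eq0.
  by rewrite scale0r scaler0.
rewrite scaler0 subrr.
rewrite (@fsum_nat _ _ 2).
  rewrite !big_ord_recl big_ord0 addr0 /= mulrNz opprK.
  have -> : 2%:~R - 1 - 0%:R = 1 :> C by ring.
  have -> : 2%:~R - 1 - (bump 0 0)%:R = 0 :> C by rewrite /bump /=; ring.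
  rewrite LV_m1E vac_creation binc0 scale1r.
  have -> : binc (- e - 1) (bump 0 0) = - (e + 1).
    have := bincS (- e - 1) 0; rewrite binc0 subr0 mulr1 mul1r => ->; ring.
  have -> : -1 + e + 1 = e by ring.
  have -> : (bump 0 0)%:R = 1 :> C by [].
  by rewrite addr0 scaleNr => /esym/eqP; rewrite subr_eq0 => /eqP.
move=> [|[|i]] // _.
have -> : - (-2)%:~R - 1 - i.+2%:R = (- i.+1%:Z)%:~R :> C.
  by rewrite !mulrNz opprK -[i.+2%:R]natr1 -pmulrn; ring.
by rewrite vac_creation_neg // (lin0 (tw_linl w _)) scaler0.
Qed.

Lemma tw_L0comm v (w : M) e :
  L0 (Y v w e) - Y v (L0 w) e = e *: Y v w e + Y (LV 0 v) w e.
Proof.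
have ow : eigV T tau 0 (omega V).
  by rewrite /eigV rootu0 scale1r; case: aut.
have e2 : - 2 = (-2)%:~R - frac T 0 by rewrite frac0 subr0.
(* n = 0 gives the commutator and the exponent -2 of x1 selects L(0). As - e1 - 1 = 1, two terms
   remain on the right, with L(-1) v and L(0) v; [tw_L1der] makes the first a derivative. *)
have := tw_jacobi_coef v w 0 e ow e2.
rewrite (@fsum1 _ _ _ 0%N) => [|[|i] // _]; last by rewrite binc0S mul0r scale0r.
rewrite (@fsum1 _ _ _ 0%N) => [|[|i] // _]; last by rewrite binc0S mul0r scale0r.
rewrite (@fsum_nat _ _ 2) => [|[|[|i]] // _]; last first.
  by rewrite opprK (_ : 2 - 1 = 1) ?binc1SS ?scale0r //; ring.
rewrite !big_ord_recl big_ord0 !binc0 !mulr1 expr0z !scale1r !subr0 !addr0 /=.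
have -> : binc (- - 2 - 1) (bump 0 0) = 1 :> C.
  rewrite opprK (_ : 2 - 1 = 1); last ring.
  have := bincS (1 : C) 0; rewrite binc0 subr0 mulr1 mul1r => ->.
  by [].
rewrite scale1r /L0 /Lmode.
have -> : - (0:int)%:~R - 2 = -2 :> C by rewrite oppr0 sub0r.
move=> ->.
have := tw_L1der v w (e - 1); rewrite subrK => <-; rewrite /LV /Lmode.
have -> : (bump 0 0)%:R = 1 :> C by [].
rewrite !mulrNz opprK mulr0z oppr0 !sub0r -opprD.
have -> : e - 2 + 1 + 1 = e by ring.
have -> : e - 2 + 1 = e - 1 by ring.
by have -> : 1%:~R - 2 = -1 :> C by rewrite -pmulrn; ring.
Qed.

Lemma tw_weight k h v (w : M) e : LV 0 v = k *: v -> L0 w = h *: w ->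
  L0 (Y v w e) = (h + k + e) *: Y v w e.
Proof.
move=> kv hw; have := tw_L0comm v w e.
rewrite hw kv (linZ (tw_linr v e)) (linZ (tw_linl w e)).
by move=> /(canRL (subrK _)) ->; rewrite -!scalerDl; congr (_ *: _); ring.
Qed.

(** For n beyond the pole order of Y(u, x0) v the right side of the Jacobi identity disappears. The
    bound is chosen before w, so it passes to functionals on the module. *)
Lemma tw_weak_comm u v : exists N : nat, forall n, (N <= n)%N ->
  forall (w : M) e1 e2, \sum_(i < n.+1) ((-1) ^+ i * 'C(n, i)%:R) *:
    (Y u (Y v w (e2 - i%:R)) (e1 - n%:R + i%:R)
     - Y v (Y u w (e1 - n%:R + i%:R)) (e2 - i%:R)) = 0.
Proof.
elim/spanned: u => [j u ju|u u' [N hN] [N' hN']]; last first.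
  exists (maxn N N') => n; rewrite geq_max => /andP[n1 n2] w e1 e2.
  rewrite -[RHS](addr0 0) -[X in _ = X + _](hN n n1 w e1 e2).
  rewrite -[X in _ = _ + X](hN' n n2 w e1 e2) -big_split; apply: eq_bigr => i _ /=.
  rewrite -scalerDr (linD (tw_linl _ _)) (linD (tw_linl _ _)) (linD (tw_linr _ _)).
  by congr (_ *: _); rewrite opprD addrACA.
have [N hN] := voaY_low u v; exists N => n nN w e1 e2.
have [[m em]|ne] := pselect (exists m : int, e1 = m%:~R - frac T j); last first.
  apply: big1 => i _.
  have z w' : Y u w' (e1 - n%:R + i%:R) = 0.
    apply: contrapT => /(tw_supp_eig ju)[m hm]; apply: ne; exists (m + n%:Z - i%:Z).
    by rewrite intrB intrD addrAC [X in X - _]addrAC -hm /=; ring.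
  by rewrite !z (lin0 (tw_linr v _)) subr0 scaler0.
have := tw_jacobi_coef v w n e2 ju em.
rewrite [X in _ = X]fsum0; last first.
  move=> i; have -> : - n%:~R - 1 - i%:R = (- n%:Z - 1 - i%:Z)%:~R :> C.
    by rewrite !intrB intrN.
  by rewrite hN ?(lin0 (tw_linl _ _)) ?scaler0 //; lia.
have bz (i : nat) : (n.+1 <= i)%N -> binc (n%:Z%:~R : C) i = 0.
  by move=> ni; exact: binc_small.
rewrite !(@fsum_nat _ _ n.+1); first last.
- by move=> i /bz ->; rewrite mul0r scale0r.
- by move=> i /bz ->; rewrite mul0r scale0r.
(* As n is a natural number, the two expansions of (x1 - x2)^n are the same polynomial; reversing
   the second sum aligns its terms with the first. *)
rewrite [X in _ - _ *: X](reindex_inj rev_ord_inj) /= scaler_sumr -sumrB => E.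
rewrite -[RHS]E; apply: eq_bigr => i _.
have im : (i <= n)%N by rewrite -ltnS; exact: ltn_ord.
rewrite subSS scalerBr !(binc_nat R n) [_ * (-1) ^+ i]mulrC scalerA; congr (_ - _ *: Y v (Y u w _) _).
- have sg : (-1) ^+ n * (-1) ^+ (n - i) = (-1) ^+ i :> C.
    by rewrite -{1}(subnK im) exprD mulrAC -expr2 sqrr_sign mul1r.
  by rewrite bin_sub // -exprnP -sg; move: ((-1) ^+ n) => x; ring.
- by rewrite natrB //; ring.
- by rewrite natrB //; rewrite /intmul; ring.
Qed.

End TwistedModule.

Lemma seq_bound (I : eqType) (r : seq I) (P : I -> nat -> Prop) :
  (forall i, exists N, forall n, (N <= n)%N -> P i n) ->
  exists N, forall i n, i \in r -> (N <= n)%N -> P i n.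
Proof.
move=> hP; elim: r => [|i r [N hN]]; first by exists 0%N.
have [N' hN'] := hP i; exists (maxn N N') => k n; rewrite inE geq_max.
by case/orP => [/eqP ->|kr] /andP[n1 n2]; [exact: hN'|exact: hN].
Qed.

(** * Opposite vertex operators on a twisted module *)

Section OppositeOperators.
Variables (R : realType) (V : voa R) (T : nat) (sigma : V -> V) (W : twmod T sigma).
Local Notation C := R[i].
Local Notation frac := (Defs.frac R).
Local Notation Y := (@twY R V T sigma W).
Hypotheses (aut : voa_aut sigma)
  (spanned : forall P : V -> Prop, (forall j v, eigV T sigma j v -> P v) ->
     (forall u v, P u -> P v -> P (u + v)) -> forall v, P v).

Lemma Yo_fins v (w : W) e : fins (fun p => Y (oppser v p) w (p - e)).
Proof.
by apply: (fins_supp (oppser_fins v)) => p ->; rewrite (lin0 (tw_linl w _)).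
Qed.

Lemma Yo_seq v : exists r : seq C, uniq r /\ forall (w : W) e,
  Yo v w e = \sum_(p <- r) Y (oppser v p) w (p - e).
Proof.
have [r [ur hr]] := fins_uniq (oppser_fins v); exists r; split => // w e.
by rewrite /Yo (fsum_seq ur) // => p /hr ->; rewrite (lin0 (tw_linl w _)).
Qed.

Lemma Yo_linr v e : linear (fun w : W => Yo v w e).
Proof.
move=> a x y; have [r [_ hr]] := Yo_seq v; rewrite !hr scaler_sumr -big_split.
by apply: eq_bigr => p _ /=; exact: tw_linr.
Qed.

Lemma Yo_linl (w : W) e : linear (fun v => Yo v w e).
Proof.
move=> a u v; rewrite /Yo -fsum_lincomb; [|exact: Yo_fins|exact: Yo_fins].
by apply: eq_fsum => p; rewrite (oppser_linear p) (tw_linl w _).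
Qed.

(** Inverting x turns lower truncation into upper truncation. This is what allows products with
    powers of x - z in descending powers of x. *)
Lemma Yo_uptr v (w : W) : uptr (Yo v w).
Proof.
move=> q; have [r [_ hr]] := Yo_seq v.
have := @seq_bound _ r (fun p j => Y (oppser v p) w (p - q - j%:R) = 0).
case=> [p|J hJ]; first exact: tw_lowtr.
exists J => j jJ; rewrite hr big_seq big1 // => p pr.
by rewrite opprD addrA hJ.
Qed.

Lemma Yo_supp j v (w : W) e : eigV T sigma j v -> Yo v w e <> 0 ->
  exists n : int, e = n%:~R + frac T j.
Proof.
move=> jv h; apply: contrapT => ne; apply: h; apply: fsum0 => p.
have [->|/eqP p0] := eqVneq (oppser v p) 0; first by rewrite (lin0 (tw_linl w _)).
have [m pm] := oppser_int p0; apply: contrapT => h.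
have [n hn] := tw_supp_eig (oppser_eig p aut jv) h.
apply: ne; exists (m - n); rewrite intrB -pm; transitivity (p - (p - e)); first ring.
by rewrite hn; ring.
Qed.

(** In the term with L(1)^i v the weight k - i of the vector and the exponent i - 2 k - e add up to
    - k - e, whatever i is. *)
Lemma Yo_weight (k : int) h v (w : W) e : LV 0 v = k%:~R *: v -> L0 w = h *: w ->
  L0 (Yo v w e) = (h - k%:~R - e) *: Yo v w e.
Proof.
move=> kv hw; rewrite (lin_fsum (L0_linear (M := W)) (Yo_fins v w e)) -fsumZr.
apply: eq_fsum => p; rewrite (oppser_hom _ kv).
set F := fun i : nat => _.
have fF : fins F.
  have [B hB] := LV1_nilp v.
  by apply: (fins_nat (B := B)) => i /hB; rewrite /F => ->; rewrite scaler0.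
have lY := tw_linl w (p - e).
rewrite !(lin_fsum lY fF).
have fY : fins (fun i => Y (F i) w (p - e)).
  by apply: (fins_supp fF) => i ->; rewrite (lin0 lY).
rewrite (lin_fsum (L0_linear (M := W)) fY) -fsumZr; apply: eq_fsum => i.
rewrite /F !(linZ lY) (linZ (L0_linear (M := W))).
rewrite (tw_weight aut spanned _ (LV1_iter_weight i kv) hw) !scalerA.
rewrite /mono; case: eqP => [->|_]; last by rewrite !mul0r !mulr0 !scale0r.
by congr (_ *: _); ring.
Qed.

Lemma Yo_vac (w : W) e : Yo (vac V) w e = mono 0 e *: w.
Proof.
rewrite /Yo (@fsum1 _ _ _ 0); last first.
  by move=> p /negPf p0; rewrite oppser_vac /mono p0 scale0r (lin0 (tw_linl w _)).
by rewrite oppser_vac /mono eqxx scale1r sub0r twY_vac /mono oppr_eq0.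
Qed.

(** The factor x^{-4} of [oppser_omega] makes the exponent -2 invariant under inversion of x: L(0)
    acts on functionals by transposition. *)
Lemma Yo_omega (w : W) : Yo (omega V) w (- 2) = L0 w.
Proof.
rewrite /Yo (@fsum1 _ _ _ (-4)); last first.
  by move=> p /negPf p0; rewrite oppser_omega /mono p0 scale0r (lin0 (tw_linl w _)).
rewrite oppser_omega /mono eqxx scale1r /L0 /Lmode; congr (twY _ _ _); ring.
Qed.

Lemma Yo_weak_comm u v : exists n : nat, forall (w : W) e1 e2,
  \sum_(i < n.+1) ((-1) ^+ i * 'C(n, i)%:R) *:
    (Yo u (Yo v w (e2 - i%:R)) (e1 - n%:R + i%:R)
     - Yo v (Yo u w (e1 - n%:R + i%:R)) (e2 - i%:R)) = 0.
Proof.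
have [r [_ hr]] := Yo_seq u; have [s [_ hs]] := Yo_seq v.
pose P (pq : C * C) (n : nat) := forall (w : W) e1 e2,
  \sum_(i < n.+1) ((-1) ^+ i * 'C(n, i)%:R) *:
    (Y (oppser u pq.1) (Y (oppser v pq.2) w (e2 - i%:R)) (e1 - n%:R + i%:R)
     - Y (oppser v pq.2) (Y (oppser u pq.1) w (e1 - n%:R + i%:R)) (e2 - i%:R)) = 0.
have [[p q]|n hn] := @seq_bound _ [seq (p, q) | p <- r, q <- s] P.
  exact: tw_weak_comm.
exists n => w e1 e2.
rewrite (eq_bigr (fun i : 'I_n.+1 => \sum_(p <- r) \sum_(q <- s)
   ((-1) ^+ i * 'C(n, i)%:R) *:
    (Y (oppser u p) (Y (oppser v q) w (q - e2 + i%:R)) (p - e1 + n%:R - i%:R)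
     - Y (oppser v q) (Y (oppser u p) w (p - e1 + n%:R - i%:R)) (q - e2 + i%:R)))).
  rewrite exchange_big big_seq big1 // => p pr.
  rewrite exchange_big big_seq big1 // => q qs.
  (* Inversion of both variables preserves (x1 - x2)^n up to the sign (-1)^n and a monomial; the
     reversal of the index and the scaling below account for these. *)
  have := hn (p, q) n (allpairs_f pair pr qs) (leqnn n) w (p - e1 + n%:R) (q - e2 + n%:R).
  rewrite /= (reindex_inj rev_ord_inj) => /(congr1 (fun x => (-1) ^+ n *: x)).
  rewrite scaler0 scaler_sumr => E; rewrite -[RHS]E; apply: eq_bigr => i _ /=.
  have im : (i <= n)%N by rewrite -ltnS; exact: ltn_ord.
  rewrite subSS scalerA bin_sub // mulrA.
  have -> : (-1) ^+ n * (-1) ^+ (n - i) = (-1) ^+ i :> C.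
    by rewrite -{1}(subnK im) exprD mulrAC -expr2 sqrr_sign mul1r.
  rewrite natrB //.
  have -> : q - e2 + n%:R - (n%:R - i%:R) = q - e2 + i%:R by ring.
  by have -> : p - e1 + n%:R - n%:R + (n%:R - i%:R) = p - e1 + n%:R - i%:R by ring.
move=> i _.
have -> : Yo u (Yo v w (e2 - i%:R)) (e1 - n%:R + i%:R) =
    \sum_(p <- r) \sum_(q <- s)
      Y (oppser u p) (Y (oppser v q) w (q - e2 + i%:R)) (p - e1 + n%:R - i%:R).
  rewrite hr; apply: eq_bigr => p _; rewrite hs (lin_sum (tw_linr (oppser u p) _)).
  apply: eq_bigr => q _.
  have -> : q - (e2 - i%:R) = q - e2 + i%:R by ring.
  by have -> : p - (e1 - n%:R + i%:R) = p - e1 + n%:R - i%:R by ring.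
have -> : Yo v (Yo u w (e1 - n%:R + i%:R)) (e2 - i%:R) =
    \sum_(p <- r) \sum_(q <- s)
      Y (oppser v q) (Y (oppser u p) w (p - e1 + n%:R - i%:R)) (q - e2 + i%:R).
  rewrite exchange_big hs; apply: eq_bigr => q _.
  rewrite hr (lin_sum (tw_linr (oppser v q) _)); apply: eq_bigr => p _.
  have -> : q - (e2 - i%:R) = q - e2 + i%:R by ring.
  by have -> : p - (e1 - n%:R + i%:R) = p - e1 + n%:R - i%:R by ring.
rewrite -sumrB scaler_sumr; apply: eq_bigr => p _.
by rewrite -sumrB scaler_sumr.
Qed.

End OppositeOperators.

(** * Regular vertex operators on the dual space *)

Section Clear.
Variables (R : realType) (V : voa R) (T : nat) (s1 s2 sigma : V -> V).
Local Notation C := R[i].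
Local Notation frac := (Defs.frac R).
Hypothesis H : twisting T s1 s2 sigma.
Variables (W : twmod T sigma) (z : C).

Lemma tws_aut : voa_aut sigma.
Proof.
have lg := tws_sigma_lin H; have [l1 b1 v1 o1 Y1] := tws_aut1 H.
have [l2 b2 v2 o2 Y2] := tws_aut2 H.
have K := tws_K H; have VK := tws_VK H.
split => //.
- by exists (s1 \o s2).
- by rewrite -[RHS]K /= v2 v1.
- by rewrite -[RHS]K /= o2 o1.
- move=> u v e; rewrite -{1}[u]VK -{1}[v]VK /= -Y1 -Y2.
  by rewrite -/((s1 \o s2) _) K.
Qed.

Lemma tws_spanned (P : V -> Prop) : (forall j v, eigV T sigma j v -> P v) ->
  (forall u v, P u -> P v -> P (u + v)) -> forall v, P v.
Proof.
move=> Pe; apply: (eigV2_ind H) => j1 j2 v /(eigV2_sigma H); exact: Pe.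
Qed.

Let autS := tws_aut.
Let spanS := tws_spanned.

Implicit Types f g : W -> C^o.

(* The coefficient of x^e in (x - z)^s Y_W^*(v, x) f; by [mul_xc_shift], the one of
   x^p in (x + z)^be Y_W^*(v, x + z) f is [clr (- p - 1) v f (- be - 1)]. *)
Definition clr (s : C) (v : V) f (e : C) : W -> C^o :=
  fun w => mul_xc (- z) s (fun p => f (Yo v w p)) e.

Lemma eq_clr s s' v f e e' : s = s' -> e = e' -> clr s v f e = clr s' v f e'.
Proof. by move=> -> ->. Qed.

Lemma dual0 f : dual f -> f 0 = 0.
Proof. exact: lin0. Qed.

Lemma mat_uptr f v (w : W) : dual f -> uptr (fun p => f (Yo v w p)).
Proof.
move=> df q; have [J hJ] := Yo_uptr spanS v w q.
by exists J => j /hJ ->; exact: dual0.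
Qed.

Lemma clr_dual f s v e : dual f -> dual (clr s v f e).
Proof.
move=> df a x y; rewrite /clr.
rewrite (@eq_mul_xc _ _ _ _ _ (fun p => a *: f (Yo v x p) + f (Yo v y p))).
  by rewrite (mul_xc_lin _ _ _ _ (mat_uptr _ _ df)) //; exact: mat_uptr.
by move=> p; rewrite (Yo_linr v p) df.
Qed.

Lemma clr_linl f s e : dual f -> linear (fun v => clr s v f e).
Proof.
move=> df a u v; apply/funext => w; rewrite /clr.
rewrite (@eq_mul_xc _ _ _ _ _ (fun p => a *: f (Yo u w p) + f (Yo v w p))).
  by rewrite (mul_xc_lin _ _ _ _ (mat_uptr _ _ df)) //; exact: mat_uptr.
by move=> p; rewrite (Yo_linl w p) df.
Qed.

Lemma clr_linr s v e a f g : dual f -> dual g ->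
  clr s v (a *: f + g) e = a *: clr s v f e + clr s v g e.
Proof.
move=> df dg; apply/funext => w; rewrite /clr.
rewrite (@eq_mul_xc _ _ _ _ _ (fun p => a *: f (Yo v w p) + g (Yo v w p))) //.
by rewrite mul_xc_lin //; exact: mat_uptr.
Qed.

Lemma clr_v0 f s e : dual f -> clr s 0 f e = 0.
Proof. by move=> /(clr_linl s e)/lin0. Qed.

Lemma clr_f0 s v e : clr s v (0 : W -> C^o) e = 0.
Proof. by apply/funext => w; apply: mul_xc0. Qed.

Lemma clrS f s v e : dual f ->
  clr (s + 1) v f e = clr s v f (e - 1) - z *: clr s v f e.
Proof.
by move=> df; apply/funext => w; rewrite /clr mul_xcS ?scaleNr //; exact: mat_uptr.
Qed.

Lemma clr_supp f s v e j1 j2 : dual f -> eigV2 T s1 s2 j1 j2 v -> clr s v f e <> 0 ->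
  exists m : int, e = s - frac T j1 - frac T j2 + m%:~R.
Proof.
move=> df vj h; apply: contrapT => ne; apply: h; apply/funext => w; apply: fsum0 => i.
have [->|/eqP h] := eqVneq (Yo v w (e - s + i%:R)) 0.
  by rewrite dual0 // scaler0.
have [m hm] := Yo_supp autS (eigV2_sigma H vj) h; case: ne; exists (m - i%:Z).
rewrite intrB; transitivity (e - s + i%:R + s - i%:R); first ring.
by rewrite hm fracN fracD /=; ring.
Qed.

(** The pole is cleared: by [laurent_clearR] and [laurent_clearL] these are, up to a shift, the
    memberships in W^*((x)) used to define D(W) and Y^L. In [goodL] the exponent of x stays fixed
    and the power of x - z varies. *)
Definition goodR s v f := lowtr (clr s v f).
Definition goodL be v f := lowtr (fun e => clr (- e - 1) v f (- be - 1)).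

Lemma goodRS s v f : dual f -> goodR s v f -> goodR (s + 1) v f.
Proof.
move=> df h q; have [J hJ] := h q; have [K hK] := h (q - 1).
exists (maxn J K) => j; rewrite geq_max => /andP[j1 j2].
by rewrite clrS // hJ // addrAC hK // scaler0 subrr.
Qed.

Lemma goodRD s v f (n : nat) : dual f -> goodR s v f -> goodR (s + n%:R) v f.
Proof.
move=> df h; elim: n => [|n IH]; first by rewrite addr0.
by rewrite -natr1 addrA; apply: goodRS.
Qed.

Lemma goodR_lin s v a f g : dual f -> dual g -> goodR s v f -> goodR s v g ->
  goodR s v (a *: f + g).
Proof.
move=> df dg hf hg; apply: (lowtr_supp (lowtr_lin a hf hg)) => e.
by rewrite clr_linr.
Qed.

Lemma goodR_linl s u v a f : dual f -> goodR s u f -> goodR s v f ->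
  goodR s (a *: u + v) f.
Proof.
move=> df hf hg; apply: (lowtr_supp (lowtr_lin a hf hg)) => e.
by rewrite (clr_linl _ _ df).
Qed.

Lemma clr_shift be v f e : dual f ->
  clr (- e - 1) v f (- (be + 1) - 1) =
  clr (- (e - 1) - 1) v f (- be - 1) + z *: clr (- e - 1) v f (- be - 1).
Proof.
move=> df; have -> : - (e - 1) - 1 = (- e - 1) + 1 by ring.
by rewrite clrS // subrK; apply: eq_clr; ring.
Qed.

Lemma goodLS be v f : dual f -> goodL be v f -> goodL (be + 1) v f.
Proof.
move=> df h q; have [J hJ] := h q; have [K hK] := h (q - 1).
exists (maxn J K) => j; rewrite geq_max => /andP[j1 j2].
rewrite clr_shift // hJ // scaler0 addr0.
by have <- := hK j j2; apply: eq_clr; ring.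
Qed.

Lemma goodLD be v f (n : nat) : dual f -> goodL be v f -> goodL (be + n%:R) v f.
Proof.
move=> df h; elim: n => [|n IH]; first by rewrite addr0.
by rewrite -natr1 addrA; apply: goodLS.
Qed.

(* Since multiplication by x - z preserves truncation, truncation of
   (x - z)^s Y^* gives the one of (x + z)^be Y^*(x + z) for large be, with a lower
   bound on the exponents that only depends on s. *)
Lemma goodR_goodL s be v f : dual f -> goodR s v f ->
  exists L : nat, forall (l i : nat), (L <= l)%N ->
    clr (s + i%:R) v f (- (be + l%:R) - 1) = 0.
Proof.
move=> df h; have [J hJ] := h (- be - 1); exists J => l i; elim: i l => [|i IH] l lJ.
  by rewrite addr0 (_ : - _ - 1 = - be - 1 - l%:R) ?hJ //; ring.
rewrite -natr1 addrA clrS // IH // scaler0 subr0.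
by have := IH l.+1 (leqW lJ); rewrite -natr1 => <-; apply: eq_clr; ring.
Qed.

Hypothesis z0 : z != 0.

(* Y^R and Y^L, for any exponents s, be clearing the poles *)
Definition opR (s : C) v f e : W -> C^o :=
  expipi (- s) *: ((fun w => mul_cx z (-1) (- s) (fun p => clr s v f p w) e) : W -> C^o).
Definition opL (be : C) v f e : W -> C^o :=
  fun w => mul_cx z 1 (- be) (fun p => clr (- p - 1) v f (- be - 1) w) e.

Lemma lowtr_app (A : C -> W -> C^o) (w : W) : lowtr A -> lowtr (fun p => A p w).
Proof. by move=> h; apply: (lowtr_supp h) => e ->. Qed.

Lemma opRS s v f e : dual f -> goodR s v f -> opR (s + 1) v f e = opR s v f e.
Proof.
move=> df h; have lw (w : W) := lowtr_app w h.
(* Raising s by 1 multiplies [clr] by x - z = - (z - x): the sign cancels against e^{- pi i}, and z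
   - x against the additional inverse power. *)
rewrite /opR opprD expipiD (expipiN 1) expipi1 invrN1 mulrN1.
apply/funext => w; rewrite /= !fctE.
rewrite (@eq_mul_cx _ _ _ _ _ _ (fun p => -1 *: mul_cx z (-1) 1 (fun p => clr s v f p w) p)).
  rewrite -(@lin_mul_cx _ _ _ _ _ _ _ _ _ (scale_linear (-1))); last exact: lowtr_mul_cx.
  by rewrite mul_cx_comp // subrK scalerA mulrN1 opprK.
move=> p; rewrite mul_cx_s1 // clrS // !scaleN1r opprB.
by rewrite fctE /= addrC.
Qed.

Lemma opRD s v f e (n : nat) : dual f -> goodR s v f ->
  opR (s + n%:R) v f e = opR s v f e.
Proof.
move=> df h; elim: n => [|n IH]; first by rewrite addr0.
by rewrite -natr1 addrA opRS //; exact: goodRD.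
Qed.

Lemma opLS be v f e : dual f -> goodL be v f -> opL (be + 1) v f e = opL be v f e.
Proof.
move=> df h; apply/funext => w; have lw := lowtr_app w h.
rewrite /opL (@eq_mul_cx _ _ _ _ _ _
  (mul_cx z 1 1 (fun p => clr (- p - 1) v f (- be - 1) w))).
  by rewrite mul_cx_comp // opprD subrK.
move=> p; rewrite mul_cx_s1 // clr_shift // fctE /=.
by rewrite [1 *: _]scale1r addrC.
Qed.

Lemma opLD be v f e (n : nat) : dual f -> goodL be v f ->
  opL (be + n%:R) v f e = opL be v f e.
Proof.
move=> df h; elim: n => [|n IH]; first by rewrite addr0.
by rewrite -natr1 addrA opLS //; exact: goodLD.
Qed.

End Clear.

(** * Weak commutativity and stability of truncation *)

Section Stability.
Variables (R : realType) (V : voa R) (T : nat) (s1 s2 sigma : V -> V).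
Local Notation C := R[i].
Local Notation frac := (Defs.frac R).
Hypothesis H : twisting T s1 s2 sigma.
Variables (W : twmod T sigma) (z : C).
Implicit Types f g : W -> C^o.

Let spanS := tws_spanned H.

(** The range of the inner sum depends on the outer index, but only finitely many outer indices
    contribute; a common square lets the two sums be exchanged. *)
Lemma clr_box f s s' u v p q (w : W) : dual f -> exists B0, forall B, (B0 <= B)%N ->
  clr z s' u (clr z s v f p) q w = \sum_(k < B) \sum_(i < B)
    ((binc s' k * (- z) ^+ k) * (binc s i * (- z) ^+ i)) *:
      (f (Yo v (Yo u w (q - s' + k%:R)) (p - s + i%:R)) : C^o).
Proof.
move=> df; have [I hI] := Yo_uptr spanS u w (q - s').
have [N hN] := @seq_bound _ (iota 0 I)
  (fun k i => Yo v (Yo u w (q - s' + k%:R)) (p - s + i%:R) = 0)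
  (fun k => Yo_uptr spanS v _ (p - s)).
exists (maxn I N) => B; rewrite geq_max => /andP[IB NB].
have cl0 : clr z s v f p 0 = 0 by apply: lin0; exact: (clr_dual H).
rewrite /clr /mul_xc (@fsum_nat _ _ B) => [|k kB]; last first.
  by rewrite hI ?(leq_trans IB) //; move: cl0; rewrite /clr /mul_xc => ->; rewrite scaler0.
apply: eq_bigr => k _; rewrite (@fsum_nat _ _ B) => [|i iB].
  by rewrite scaler_sumr; apply: eq_bigr => i _; rewrite scalerA.
have [kI|kI] := ltnP k I.
  by rewrite (hN k) ?mem_iota ?(leq_trans NB) // (dual0 df) scaler0.
by rewrite hI // (lin0 (Yo_linr v _)) (dual0 df) scaler0.
Qed.

(** Weak commutativity survives multiplication by powers of x1 - z and x - z since it applies to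
    each pair (k, i) of their terms. Its order n is fixed before f, the exponents and w. *)
Lemma clr_comm u v : exists n : nat, forall f s s' p q (w : W), dual f ->
  \sum_(j < n.+1) ((-1) ^+ j * 'C(n, j)%:R) *:
    ((clr z s' u (clr z s v f (p - j%:R)) (q - n%:R + j%:R) w : C^o)
     - clr z s v (clr z s' u f (q - n%:R + j%:R)) (p - j%:R) w) = 0.
Proof.
have [n hn] := Yo_weak_comm W spanS u v; exists n => f s s' p q w df.
have [B1 h1] := @seq_bound _ (iota 0 n.+1) _
  (fun j => clr_box s s' u v (p - j%:R) (q - n%:R + j%:R) w df).
have [B2 h2] := @seq_bound _ (iota 0 n.+1) _
  (fun j => clr_box s' s v u (q - n%:R + j%:R) (p - j%:R) w df).
set B := maxn B1 B2.
rewrite (eq_bigr (fun j : 'I_n.+1 => \sum_(k < B) \sum_(i < B)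
    ((binc s' k * (- z) ^+ k) * (binc s i * (- z) ^+ i)) *: (f
    (((-1) ^+ j * 'C(n, j)%:R) *:
      (Yo v (Yo u w (q - s' + k%:R - n%:R + j%:R)) (p - s + i%:R - j%:R)
     - Yo u (Yo v w (p - s + i%:R - j%:R)) (q - s' + k%:R - n%:R + j%:R))) : C^o))).
  rewrite exchange_big big1 // => k _; rewrite exchange_big big1 // => i _.
  rewrite -scaler_sumr -(lin_sum df); apply/eqP; rewrite scaler_eq0; apply/orP; right.
  (* Transposition reverses the order of the two operators, hence the sign. *)
  rewrite (_ : \sum_(j < n.+1) _ = - \sum_(j < n.+1) ((-1) ^+ j * 'C(n, j)%:R) *:
    (Yo u (Yo v w (p - s + i%:R - j%:R)) (q - s' + k%:R - n%:R + j%:R) -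
     Yo v (Yo u w (q - s' + k%:R - n%:R + j%:R)) (p - s + i%:R - j%:R))).
    by rewrite hn oppr0 (dual0 df).
  by rewrite -sumrN; apply: eq_bigr => j _; rewrite -scalerN opprB.
move=> j _.
have jn : nat_of_ord j \in iota 0 n.+1 by rewrite mem_iota add0n ltn_ord.
rewrite (h1 j B jn (leq_maxl _ _)).
have := h2 j B jn (leq_maxr _ _); rewrite exchange_big => ->.
rewrite -sumrB scaler_sumr; apply: eq_bigr => k _.
rewrite -sumrB scaler_sumr; apply: eq_bigr => i _.
rewrite (linZ df) (linD df) (linN df) [X in _ - X *: _]mulrC -scalerBr !scalerA mulrC.
have -> : q - n%:R + j%:R - s' + k%:R = q - s' + k%:R - n%:R + j%:R by ring.
by have -> : p - j%:R - s + i%:R = p - s + i%:R - j%:R by ring.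
Qed.

(* By weak commutativity, (x1 - x)^n (x1 - z)^s' Y^*(u, x1) (x - z)^s Y^*(v, x) f is
   truncated from below in both variables; the coefficients of the powers of x are
   then treated one by one, starting from the lowest. *)
Lemma goodR_clr f s s' u v p : dual f -> goodR z s v f -> goodR z s' u f ->
  goodR z s' u (clr z s v f p).
Proof.
move=> df hv hu q; have [n hn] := clr_comm u v.
have [J0 hJ] := hu q; have [I0 hI] := hv p.
(* m bounds how far i falls short of [I0]. The term of index k + 1 <= n raises i and lowers j by k +
   1; lowering m by as much keeps both bounds, and the summand n keeps j - (k + 1) >= [J0], where
   the product in the other order vanishes. *)
suff main m i j : (I0 <= i + m)%N -> (J0 + n + m <= j)%N ->
    clr z s' u (clr z s v f (p - i%:R)) (q - j%:R) = 0.
  by exists (J0 + n + I0)%N => j /(main I0 0%N); rewrite subr0; apply; rewrite add0n.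
elim/ltn_ind: m i j => m IH i j im jm.
have [iI|iI] := leqP I0 i; first by rewrite hI // clr_f0.
apply/funext => w.
have := hn f s s' (p - i%:R) (q - j%:R + n%:R) w df.
rewrite big_ord_recl big1 => [|k _].
  rewrite addr0 expr0 bin0 mul1r scale1r addrK subr0 addr0.
  rewrite -[q - j%:R as X in clr z s' u f X]/(q - j%:R) hJ ?clr_f0 ?subr0 //; lia.
have kn := ltn_ord k; rewrite /bump /= addrK.
have -> : p - i%:R - k.+1%:R = p - (i + k.+1)%:R by rewrite natrD; ring.
have -> : q - j%:R + k.+1%:R = q - (j - k.+1)%:R by rewrite natrB; [ring|lia].
rewrite hJ; last lia.
rewrite clr_f0; have [iI'|iI'] := leqP I0 (i + k.+1).
  by rewrite hI // clr_f0 subr0 scaler0.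
by rewrite (IH (m - k.+1)%N) ?subr0 ?scaler0 //; lia.
Qed.

(** Truncation below makes the sum finite in the dual space itself, not only against each w.
    Coefficients of Y^R f are thus finite combinations of those of [clr] and inherit its
    properties. *)
Lemma clr_lowsum f s v t sg p : goodR z s v f ->
  exists (J : nat) (c : nat -> C),
    (fun w => mul_cx z sg t (fun p => clr z s v f p w : C^o) p) =
    \sum_(i < J) c i *: clr z s v f (p - i%:R).
Proof.
move=> h; have [J hJ] := h p; exists J, (fun i : nat => binc t i * cpow z (t - i%:R) * sg ^+ i).
apply/funext => w; rewrite /mul_cx (@fsum_nat _ _ J) => [|i iJ]; last by rewrite hJ // scaler0.
by rewrite fct_sumE.
Qed.

Lemma dual_lin a f g : dual f -> dual g -> dual (a *: f + g).
Proof.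
move=> df dg b x y; rewrite !fctE df dg !scalerDr !scalerA mulrC -!addrA.
by congr (_ + _); rewrite addrCA.
Qed.

Lemma dual_zero : dual (0 : W -> C^o).
Proof. by move=> b x y; rewrite scaler0 addr0. Qed.

Lemma goodR_zero s v : goodR z s v (0 : W -> C^o).
Proof. by move=> q; exists 0%N => j _; exact: clr_f0. Qed.

Lemma opR_dual_good f s v p : dual f -> goodR z s v f ->
  dual (opR z s v f p) /\
  (forall s' u, goodR z s' u f -> goodR z s' u (opR z s v f p)).
Proof.
move=> df hv; rewrite /opR; have [J [c ->]] := clr_lowsum (- s) (-1) p hv.
rewrite scaler_sumr; split=> [|s' u hu].
  elim/big_rec: _ => [|i f' _]; first exact: dual_zero.
  by rewrite scalerA; apply: dual_lin; exact: (clr_dual H).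
suff [] : dual (\sum_(i < J) expipi (- s) *: (c i *: clr z s v f (p - i%:R))) /\
    goodR z s' u (\sum_(i < J) expipi (- s) *: (c i *: clr z s v f (p - i%:R))) by [].
elim/big_rec: _ => [|i f' _ [IH1 IH2]].
  by split; [exact: dual_zero|exact: goodR_zero].
have dc := clr_dual H z s v (p - i%:R) df.
by rewrite scalerA; split; [exact: dual_lin|apply: (goodR_lin H) => //; exact: goodR_clr].
Qed.

End Stability.

(** * Truncation for exponents in (1/T) Z *)

Section FractionalExponents.
Variables (R : realType) (T : nat).
Local Notation C := R[i].
Local Notation frac := (Defs.frac R).
(** When the support lies in one coset of the integers, truncation along every coset amounts to a
    single bound. *)
Lemma laurent_lowtr (U : nmodType) (b : C) (G : C -> U) :
  (forall e, G e <> 0 -> exists n : int, e = n%:~R - b) ->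
  laurent (xshift b G) <-> lowtr G.
Proof.
move=> supp; split=> [[_ [N hN]] q|low].
  have [[n hn]|nq] := pselect (exists n : int, q = n%:~R - b).
    exists `|n - N|.+1%N => j jJ; have := hN (n - j%:Z).
    rewrite /xshift intrB addrAC -hn; apply; lia.
  exists 0%N => j _; apply: contrapT => /supp[n hn]; apply: nq.
  by exists (n + j%:Z); rewrite intrD addrAC -hn subrK.
split=> [e /supp[n hn]|]; first by exists n; rewrite -[LHS](subrK b) hn subrK.
have [J hJ] := low (- b); exists (1 - J%:Z) => n nJ.
have -> : n%:~R = - (`|n|%N)%:R :> C.
  by rewrite pmulrn -intrN; congr (_ %:~R); lia.
by rewrite /xshift addrC; apply: hJ; lia.
Qed.

Hypothesis T_gt0 : (0 < T)%N.

(** (1/T) Z is a union of T cosets of Z, so the bounds along the cosets have a common one. *)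
Lemma low_frac (P : C -> Prop) :
  (forall q, exists J : nat, forall j, (J <= j)%N -> P (q - j%:R)) ->
  exists N : int, forall n : int, n < N -> P (frac T n).
Proof.
move=> h; have [J hJ] := @seq_bound _ (iota 0 T) (fun r j => P (frac T r%:Z - j%:R))
  (fun r => h (frac T r%:Z)).
exists (- (J * T)%:Z) => n nJ.
have TZ : T%:Z != 0 by rewrite -lt0n.
have r0 : 0 <= (n %% T%:Z)%Z by exact: modz_ge0.
have rT : (n %% T%:Z)%Z < T%:Z by apply: ltz_pmod; rewrite ltz_nat.
have := divz_eq n T%:Z.
move: (n %/ T%:Z)%Z (n %% T%:Z)%Z r0 rT => k r r0 rT nE.
have kJ : k <= - J%:Z by nia.
rewrite nE fracD frac_mul // addrC.
have -> : frac T r = frac T (`|r|%N)%:Z by congr (frac _ _); lia.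
have -> : k%:~R = - (`|k|%N)%:R :> C.
  by rewrite pmulrn -intrN; congr (_ %:~R); lia.
by apply: hJ; [rewrite mem_iota|]; lia.
Qed.

(** Serves the sums in [Ytens] and [Yreg]: lower bounds on p and on e - p leave finitely many p in
    (1/T) Z. *)
Lemma frac_conv_fins (U : nmodType) (g : C -> U) e (N1 N2 : int) :
  (forall p, g p <> 0 -> exists n : int, p = frac T n /\ N1 <= n) ->
  (forall p, g p <> 0 -> exists n : int, e - p = frac T n /\ N2 <= n) -> fins g.
Proof.
move=> h1 h2; have [[K eK]|ne] := pselect (exists K : int, e = frac T K); last first.
  exists [::] => p _; apply: contrapT => gp; apply: ne.
  have [n [pn _]] := h1 _ gp; have [m [pm _]] := h2 _ gp; exists (n + m).
  by rewrite fracD -pn -pm addrC subrK.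
exists [seq frac T (N1 + i%:Z) | i <- iota 0 (absz (K - N2 - N1)%R).+1] => p pr.
apply: contrapT => gp; have [n [pn n1]] := h1 _ gp; have [m [pm m1]] := h2 _ gp.
have KE : K = n + m.
  by apply: (@frac_inj R T T_gt0); rewrite fracD -pn -pm -eK addrC subrK.
case/negP: pr; rewrite pn; apply/mapP; exists (absz (n - N1)%R).
  by rewrite mem_iota; lia.
by congr (frac _ _); lia.
Qed.

End FractionalExponents.

(** * The operators Y^R, Y^L and Y^reg on D(W) *)

Section RegularOperators.
Variables (R : realType) (V : voa R) (T : nat) (s1 s2 sigma : V -> V).
Local Notation C := R[i].
Local Notation frac := (Defs.frac R).
Hypothesis H : twisting T s1 s2 sigma.
Variables (W : twmod T sigma) (z : C).
Hypothesis z0 : z != 0.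
Implicit Types f g : W -> C^o.

Let T_gt0 := tws_gt0 H.

Lemma clearRE j1 v f k :
  clearR z j1 v f k = clr z (k%:R + frac T j1) v f.
Proof. by apply/funext => e; apply/funext => w; rewrite /clearR /fmulW fmul_xc. Qed.

Lemma iter_dser (A : C -> C^o) i e :
  iter i (@dser R C^o) A e = ((i`!)%:R * binc (e + i%:R) i) *: A (e + i%:R).
Proof.
elim: i e => [|i IH] e; first by rewrite addr0 binc0 mulr1 scale1r.
rewrite iterS /dser IH scalerA -natr1 [_ + 1 in RHS]addrC addrA; congr (_ *: _).
by rewrite factS natrM [_%:R * (i`!)%:R]mulrC -[RHS]mulrA bincS; ring.
Qed.

Lemma Ystar_shiftE v f e (w : W) :
  Ystar_shift z v f e w = shiftser z (fun p => f (Yo v w p) : C^o) e.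
Proof.
apply: eq_fsum => i; rewrite iter_dser -[LHS]/((_ / _) *: _) scalerA; congr (_ *: _).
have : (i`!)%:R != 0 :> C by rewrite pnatr_eq0 -lt0n fact_gt0.
by move: (i`!)%:R => x x0; field.
Qed.

Lemma clearLE j2 v f l : dual f ->
  clearL z j2 v f l = fun e => clr z (- e - 1) v f (- (l%:R + frac T j2) - 1).
Proof.
move=> df; apply/funext => e; apply/funext => w; rewrite /clearL /fmulW fmul_xc.
rewrite (eq_mul_xc _ _ _ (Ystar_shiftE v f ^~ w)) mul_xc_shift //.
exact: (mat_uptr H).
Qed.

Lemma laurent_clearR j1 j2 v f k : dual f -> eigV2 T s1 s2 j1 j2 v ->
  laurent (xshift (frac T j2) (clearR z j1 v f k)) <->
  goodR z (k%:R + frac T j1) v f.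
Proof.
move=> df vj; rewrite clearRE; apply: laurent_lowtr => e.
case/(clr_supp H df vj) => m ->; exists (k%:Z + m); rewrite intrD /=; ring.
Qed.

Lemma laurent_clearL j1 j2 v f l : dual f -> eigV2 T s1 s2 j1 j2 v ->
  laurent (xshift (frac T j1) (clearL z j2 v f l)) <->
  goodL z (l%:R + frac T j2) v f.
Proof.
move=> df vj; rewrite clearLE //; apply: laurent_lowtr => e.
case/(clr_supp H df vj) => m hm; exists (l%:Z + m); rewrite intrD /=.
move: hm => /(congr1 (fun x => x + e + 1 + l%:R + frac T j2)) hm.
transitivity (- (l%:R + frac T j2) - 1 + e + 1 + l%:R + frac T j2); first ring.
by rewrite hm; ring.
Qed.

Lemma DzP f : Dz s1 s2 z f <-> dual f /\ forall j1 j2 v, eigV2 T s1 s2 j1 j2 v ->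
  exists k : nat, goodR z (k%:R + frac T j1) v f.
Proof.
split=> -[df h]; split=> // j1 j2 v vj; have [k hk] := h j1 j2 v vj; exists k.
  by move/(laurent_clearR k df vj): hk.
by apply/(laurent_clearR k df vj).
Qed.

Lemma opR_mod s (n : nat) s' (m : nat) v f e : dual f -> goodR z s v f ->
  goodR z s' v f -> s + n%:R = s' + m%:R -> opR z s v f e = opR z s' v f e.
Proof.
by move=> df h h' E; rewrite -(opRD H z0 e n df h) E (opRD H z0 e m df h').
Qed.

Lemma opL_mod s (n : nat) s' (m : nat) v f e : dual f -> goodL z s v f ->
  goodL z s' v f -> s + n%:R = s' + m%:R -> opL z s v f e = opL z s' v f e.
Proof.
by move=> df h h' E; rewrite -(opLD H z0 e n df h) E (opLD H z0 e m df h').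
Qed.

Lemma YRhomE j1 j2 v f k e : dual f -> eigV2 T s1 s2 j1 j2 v ->
  goodR z (k%:R + frac T j1) v f ->
  YRhom z j1 j2 v f e = opR z (k%:R + frac T j1) v f e.
Proof.
move=> df vj hk; rewrite /YRhom; set P := [set k0 | _].
have : P (xget 0%N P) by apply: xgetPex; exists k; apply/(laurent_clearR k df vj).
move: (xget 0%N P) => l /(laurent_clearR l df vj) hl.
transitivity (opR z (l%:R + frac T j1) v f e).
  by congr (_ *: _); apply/funext => w; rewrite /fmulW fmul_cx clearRE.
by apply: (@opR_mod _ k _ l) => //; ring.
Qed.

Lemma YLhomE j1 j2 v f l e : dual f -> eigV2 T s1 s2 j1 j2 v ->
  goodL z (l%:R + frac T j2) v f ->
  YLhom z j1 j2 v f e = opL z (l%:R + frac T j2) v f e.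
Proof.
move=> df vj hk; rewrite /YLhom; set P := [set k0 | _].
have : P (xget 0%N P) by apply: xgetPex; exists l; apply/(laurent_clearL l df vj).
move: (xget 0%N P) => k /(laurent_clearL k df vj) hl.
transitivity (opL z (k%:R + frac T j2) v f e).
  by apply/funext => w; rewrite /fmulW fmul_cx clearLE.
by apply: (@opL_mod _ l _ k) => //; ring.
Qed.

(** The vanishing in the second clause is what makes the column truncated, and later bounds the
    exponents of Y^L below in terms of k alone. *)
Lemma goodL_of_goodR j1 j2 v f k : dual f -> eigV2 T s1 s2 j1 j2 v ->
  goodR z (k%:R + frac T j1) v f ->
  exists L : nat, forall l, (L <= l)%N -> goodL z (l%:R + frac T j2) v f /\
    forall i : nat, clr z (k%:R + frac T j1 + i%:R) v f (- (l%:R + frac T j2) - 1) = 0.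
Proof.
move=> df vj hk; have [L hL] := goodR_goodL H (frac T j2) df hk.
have cl (l i : nat) : (L <= l)%N ->
    clr z (k%:R + frac T j1 + i%:R) v f (- (l%:R + frac T j2) - 1) = 0.
  by move=> /(hL l i) <-; apply: eq_clr; ring.
exists L => l lL; split=> [|i]; last exact: cl.
move=> q; have [[n hn]|nq] := pselect (exists n : int, q = n%:~R - frac T j1).
  (* With q = n - j1/T the power of x - z at q - j is k + j1/T + (j - 1 - n - k); beyond this bound
     the last integer is nonnegative and [cl] applies. *)
  exists (k + `|n|).+1%N => j jJ.
  rewrite -[RHS](cl l (absz (j%:Z - 1 - n - k%:Z)%R) lL); apply: eq_clr => //.
  have -> : (absz (j%:Z - 1 - n - k%:Z)%R)%:R = (j%:Z - 1 - n - k%:Z)%:~R :> C.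
    by rewrite pmulrn; congr (_ %:~R); lia.
  by rewrite hn !intrB /=; ring.
exists 0%N => j _; apply: contrapT => /(clr_supp H df vj)[m hm]; apply: nq.
move: hm => /(congr1 (fun x => x + (q - j%:R) + 1 + l%:R + frac T j2 + j%:R)) hm.
exists (l%:Z + m + j%:Z); rewrite !intrD /=.
transitivity (- (l%:R + frac T j2) - 1 + (q - j%:R) + 1 + l%:R + frac T j2 + j%:R).
  by ring.
by rewrite hm; ring.
Qed.

Lemma ord_mod (j : int) : exists i0 : 'I_T, (exists m, j - i0%:Z = m * T%:Z) /\
  forall i : 'I_T, (exists m, j - i%:Z = m * T%:Z) -> i = i0.
Proof.
have TZ : T%:Z != 0 by rewrite -lt0n.
have r0 : 0 <= (j %% T%:Z)%Z by exact: modz_ge0.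
have rT : (j %% T%:Z)%Z < T%:Z by apply: ltz_pmod; rewrite ltz_nat.
have jE := divz_eq j T%:Z.
move: (j %/ T%:Z)%Z (j %% T%:Z)%Z r0 rT jE => k r r0 rT jE.
have rT' : (absz r < T)%N by lia.
exists (Ordinal rT'); split => [|i [m im]] /=; first by exists k; rewrite jE; lia.
apply: val_inj => /=; have iT := ltn_ord i.
have E : (k - m) * T%:Z = i%:Z - r by rewrite mulrBl -im jE; ring.
have km : k - m = 0 by nia.
by move: E; rewrite km mul0r; lia.
Qed.

(** [YR] and [YL] sum over the representatives 0, ..., T - 1; on an eigenvector a single pair of
    residues contributes. *)
Lemma sum_proj2_eig (U : zmodType) (F : int -> int -> V -> U) j1 j2 v :
  eigV2 T s1 s2 j1 j2 v -> (forall i j, F i j 0 = 0) ->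
  exists i1 i2 : 'I_T, [/\ exists m, j1 - i1%:Z = m * T%:Z,
    exists m, j2 - i2%:Z = m * T%:Z &
    \sum_(i < T) \sum_(j < T) F i j (proj2 T s1 s2 i j v) = F i1 i2 v].
Proof.
move=> vj F0; have [i1 [h1 u1]] := ord_mod j1; have [i2 [h2 u2]] := ord_mod j2.
exists i1, i2; split => //.
rewrite (bigD1 i1) //= [X in _ + X]big1 => [|i ii]; last first.
  apply: big1 => j _; rewrite (proj2_of_eig H _ _ vj).
  by case: asboolP => [[/u1 iE]|_]; [rewrite iE eqxx in ii|rewrite scale0r].
rewrite addr0 (bigD1 i2) //= [X in _ + X]big1 => [|j jj]; last first.
  rewrite (proj2_of_eig H _ _ vj).
  by case: asboolP => [[_ /u2 jE]|_]; [rewrite jE eqxx in jj|rewrite scale0r].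
by rewrite addr0 (proj2_of_eig H _ _ vj); case: asboolP => [_|[]]; rewrite ?scale1r.
Qed.

Lemma goodR_v0 s f : dual f -> goodR z s 0 f.
Proof. by move=> df q; exists 0%N => j _; exact: (clr_v0 H). Qed.

Lemma eigV2_0 j1 j2 : eigV2 T s1 s2 j1 j2 0.
Proof. by split; rewrite /eigV ?(lin0 (tws_lin1 H)) ?(lin0 (tws_lin2 H)) scaler0. Qed.

Lemma opR_lin a s e v v' v'' f f' f'' : goodR z s v f -> goodR z s v' f' ->
  (forall p, clr z s v'' f'' p = a *: clr z s v f p + clr z s v' f' p) ->
  opR z s v'' f'' e = a *: opR z s v f e + opR z s v' f' e.
Proof.
move=> hu hv E; rewrite /opR scalerA mulrC -scalerA -scalerDr; congr (_ *: _).
apply/funext => w; rewrite !fctE.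
rewrite (@eq_mul_cx _ _ _ _ _ _ (fun p => a *: (clr z s v f p w : C^o) + clr z s v' f' p w)).
  by rewrite (mul_cx_lin _ _ _ _ _ (lowtr_app w hu) (lowtr_app w hv)).
by move=> p; rewrite E.
Qed.

Lemma opL_lin a s e v v' v'' f f' f'' : goodL z s v f -> goodL z s v' f' ->
  (forall p q, clr z p v'' f'' q = a *: clr z p v f q + clr z p v' f' q) ->
  opL z s v'' f'' e = a *: opL z s v f e + opL z s v' f' e.
Proof.
move=> hu hv E; apply/funext => w; rewrite /opL !fctE.
rewrite (@eq_mul_cx _ _ _ _ _ _ (fun p => a *: (clr z (- p - 1) v f (- s - 1) w : C^o)
   + clr z (- p - 1) v' f' (- s - 1) w)).
  by rewrite (mul_cx_lin _ _ _ _ _ (lowtr_app w hu) (lowtr_app w hv)).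
by move=> p; rewrite E.
Qed.

Lemma opR_linl a u v s f e : dual f -> goodR z s u f -> goodR z s v f ->
  opR z s (a *: u + v) f e = a *: opR z s u f e + opR z s v f e.
Proof. by move=> df hu hv; apply: opR_lin => // p; exact: (clr_linl H). Qed.

Lemma opR_linr a v s f g e : dual f -> dual g -> goodR z s v f -> goodR z s v g ->
  opR z s v (a *: f + g) e = a *: opR z s v f e + opR z s v g e.
Proof. by move=> df dg hu hv; apply: opR_lin => // p; exact: (clr_linr H). Qed.

Lemma opL_linl a u v s f e : dual f -> goodL z s u f -> goodL z s v f ->
  opL z s (a *: u + v) f e = a *: opL z s u f e + opL z s v f e.
Proof. by move=> df hu hv; apply: opL_lin => // p q; exact: (clr_linl H). Qed.

Lemma opL_linr a v s f g e : dual f -> dual g -> goodL z s v f -> goodL z s v g ->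
  opL z s v (a *: f + g) e = a *: opL z s v f e + opL z s v g e.
Proof. by move=> df dg hu hv; apply: opL_lin => // p q; exact: (clr_linr H). Qed.

Lemma YRhom0 f i j e : dual f -> YRhom z i j 0 f e = 0.
Proof.
move=> df; rewrite (@YRhomE i j 0 f 0%N) //; [|exact: eigV2_0|exact: goodR_v0].
rewrite /opR; have g0 := goodR_v0 (0%:R + frac T i) df.
have := opR_linl (-1) e df g0 g0; rewrite scaler0 addr0 scaleN1r addNr.
by rewrite /opR => ->.
Qed.

Lemma goodL_v0 be f : dual f -> goodL z be 0 f.
Proof. by move=> df q; exists 0%N => j _; exact: (clr_v0 H). Qed.

Lemma YLhom0 f i j e : dual f -> YLhom z i j 0 f e = 0.
Proof.
move=> df; rewrite (@YLhomE i j 0 f 0%N) //; [|exact: eigV2_0|exact: goodL_v0].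
have g0 := goodL_v0 (0%:R + frac T j) df.
by have := opL_linl (-1) e df g0 g0; rewrite scaler0 addr0 scaleN1r addNr => ->.
Qed.

Lemma Dz_goodL j1 j2 v f : Dz s1 s2 z f -> eigV2 T s1 s2 j1 j2 v ->
  exists l : nat, goodL z (l%:R + frac T j2) v f.
Proof.
move=> /DzP[df h] vj; have [k hk] := h _ _ _ vj.
by have [L hL] := goodL_of_goodR df vj hk; exists L; case: (hL L (leqnn L)).
Qed.

Lemma opR_int s s' (m : int) v f e : dual f -> goodR z s v f ->
  goodR z s' v f -> s' = s + m%:~R -> opR z s v f e = opR z s' v f e.
Proof.
move=> df h h' E; case: m E => n E.
  by apply: (@opR_mod _ n _ 0) => //; rewrite E addr0.
by apply: (@opR_mod _ 0 _ n.+1) => //; rewrite E NegzE mulrNz addr0 subrK.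
Qed.

Lemma opL_int s s' (m : int) v f e : dual f -> goodL z s v f ->
  goodL z s' v f -> s' = s + m%:~R -> opL z s v f e = opL z s' v f e.
Proof.
move=> df h h' E; case: m E => n E.
  by apply: (@opL_mod _ n _ 0) => //; rewrite E addr0.
by apply: (@opL_mod _ 0 _ n.+1) => //; rewrite E NegzE mulrNz addr0 subrK.
Qed.

Lemma frac_congr i j : (exists m, j - i = m * T%:Z) ->
  exists m : int, frac T j = frac T i + m%:~R.
Proof.
case=> m h; exists m; rewrite -(frac_mul R T_gt0) -fracD -h.
by congr (frac _ _); ring.
Qed.

(** Independence of choices: [YRhom] uses some k found by [xget] and the residue of j1, so its
    exponent differs from the given one by an integer, and [opR_int] applies. *)
Lemma YR_eig j1 j2 v f k e : Dz s1 s2 z f -> eigV2 T s1 s2 j1 j2 v ->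
  goodR z (k%:R + frac T j1) v f ->
  YR s1 s2 z v f e = opR z (k%:R + frac T j1) v f e.
Proof.
move=> Df vj hk; have [df hf] := (DzP f).1 Df.
have [i1 [i2 [h1 h2 E]]] :=
  @sum_proj2_eig _ (fun i j v => YRhom z i j v f e) _ _ _ vj (fun i j => YRhom0 i j e df).
rewrite /YR {}E; have vi := eigV2_mod H h1 h2 vj.
have [k' hk'] := hf _ _ _ vi; rewrite (YRhomE e df vi hk').
have [m hm] := frac_congr h1.
apply: (@opR_int _ _ (k%:Z - k'%:Z + m)) => //.
by rewrite hm !intrD intrN /=; ring.
Qed.

Lemma YL_eig j1 j2 v f l e : Dz s1 s2 z f -> eigV2 T s1 s2 j1 j2 v ->
  goodL z (l%:R + frac T j2) v f ->
  YL s1 s2 z v f e = opL z (l%:R + frac T j2) v f e.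
Proof.
move=> Df vj hl; have [df hf] := (DzP f).1 Df.
have [i1 [i2 [h1 h2 E]]] :=
  @sum_proj2_eig _ (fun i j v => YLhom z i j v f e) _ _ _ vj (fun i j => YLhom0 i j e df).
rewrite /YL {}E; have vi := eigV2_mod H h1 h2 vj.
have [l' hl'] := Dz_goodL Df vi; rewrite (YLhomE e df vi hl').
have [m hm] := frac_congr h2.
apply: (@opL_int _ _ (l%:Z - l'%:Z + m)) => //.
by rewrite hm !intrD intrN /=; ring.
Qed.

Lemma goodR_common a u v f g : dual f -> dual g ->
  (exists k : nat, goodR z (k%:R + a) u f) -> (exists k : nat, goodR z (k%:R + a) v g) ->
  exists k : nat, goodR z (k%:R + a) u f /\ goodR z (k%:R + a) v g.
Proof.
move=> df dg [k hk] [l hl]; exists (k + l)%N; split.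
  by rewrite natrD addrAC; exact: (goodRD H).
rewrite (_ : (k + l)%:R + a = l%:R + a + k%:R); first exact: (goodRD H).
by rewrite natrD; ring.
Qed.

Lemma YR_linear f e : Dz s1 s2 z f -> linear (fun v => YR s1 s2 z v f e).
Proof.
move=> /DzP[df hf] a u v; rewrite /YR scaler_sumr -big_split; apply: eq_bigr => i _.
rewrite scaler_sumr -big_split; apply: eq_bigr => j _ /=.
rewrite (proj2_linear H).
have eu := proj2_eig H i j u; have ev := proj2_eig H i j v.
have [k [gu gv]] := goodR_common df df (hf _ _ _ eu) (hf _ _ _ ev).
rewrite !(@YRhomE i j _ f k) //.
- exact: opR_linl.
- exact: (eigV2_lin H).
- exact: (goodR_linl H).
Qed.

Lemma Dz_goodL2 j1 j2 u v f g : Dz s1 s2 z f -> Dz s1 s2 z g ->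
  eigV2 T s1 s2 j1 j2 u -> eigV2 T s1 s2 j1 j2 v ->
  exists l : nat, goodL z (l%:R + frac T j2) u f /\ goodL z (l%:R + frac T j2) v g.
Proof.
move=> Df Dg eu ev; have [k hk] := Dz_goodL Df eu; have [k' hk'] := Dz_goodL Dg ev.
have gu := goodLD H k' Df.1 hk; have gv := goodLD H k Dg.1 hk'.
have E1 : k%:R + frac T j2 + k'%:R = (k + k')%:R + frac T j2 by rewrite natrD; ring.
have E2 : k'%:R + frac T j2 + k%:R = (k + k')%:R + frac T j2 by rewrite natrD; ring.
by rewrite E1 in gu; rewrite E2 in gv; exists (k + k')%N.
Qed.

Lemma goodL_linl s u v a f : dual f -> goodL z s u f -> goodL z s v f ->
  goodL z s (a *: u + v) f.
Proof.
move=> df hf hg; apply: (lowtr_supp (lowtr_lin a hf hg)) => e.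
by rewrite (clr_linl H z _ _ df).
Qed.

Lemma goodL_linr s v a f g : dual f -> dual g -> goodL z s v f -> goodL z s v g ->
  goodL z s v (a *: f + g).
Proof.
move=> df dg hf hg; apply: (lowtr_supp (lowtr_lin a hf hg)) => e.
by rewrite (clr_linr H z _ _ _ _ df dg).
Qed.

Lemma YL_linear f e : Dz s1 s2 z f -> linear (fun v => YL s1 s2 z v f e).
Proof.
move=> Df a u v; rewrite /YL scaler_sumr -big_split; apply: eq_bigr => i _.
rewrite scaler_sumr -big_split; apply: eq_bigr => j _ /=.
rewrite (proj2_linear H).
have eu := proj2_eig H i j u; have ev := proj2_eig H i j v.
have [l [gu gv]] := Dz_goodL2 Df Df eu ev; have df := Df.1.
rewrite !(@YLhomE i j _ f l) //.
- exact: opL_linl.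
- exact: (eigV2_lin H).
- exact: goodL_linl.
Qed.

Lemma Dz_lin a f g : Dz s1 s2 z f -> Dz s1 s2 z g -> Dz s1 s2 z (a *: f + g).
Proof.
move=> /DzP[df hf] /DzP[dg hg]; apply/DzP; split; first exact: dual_lin.
move=> j1 j2 v vj; have [k [gf gg]] := goodR_common df dg (hf _ _ _ vj) (hg _ _ _ vj).
by exists k; apply: (goodR_lin H).
Qed.

Lemma Dz_0 : Dz s1 s2 z (0 : W -> C^o).
Proof.
apply/DzP; split; first exact: dual_zero.
by move=> j1 j2 v _; exists 0%N; exact: goodR_zero.
Qed.

Lemma YL_linr a f g u e : Dz s1 s2 z f -> Dz s1 s2 z g ->
  YL s1 s2 z u (a *: f + g) e = a *: YL s1 s2 z u f e + YL s1 s2 z u g e.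
Proof.
move=> Df Dg; rewrite /YL scaler_sumr -big_split; apply: eq_bigr => i _.
rewrite scaler_sumr -big_split; apply: eq_bigr => j _ /=.
have eu := proj2_eig H i j u; have [l [gu gv]] := Dz_goodL2 Df Dg eu eu.
have df := Df.1; have dg := Dg.1; have dfg := dual_lin a df dg.
rewrite !(@YLhomE i j _ _ l) //; first exact: opL_linr.
exact: goodL_linr.
Qed.

Lemma YL_0 u e : YL s1 s2 z u (0 : W -> C^o) e = 0.
Proof.
by have := YL_linr (-1) u e Dz_0 Dz_0; rewrite scaler0 addr0 scaleN1r addNr.
Qed.

(** Any power that clears f also clears g. Coefficients of Y^R f have this property, which makes
    estimates on Y^L uniform over all of them. *)
Definition regular_above f g :=
  dual g /\ forall s v, goodR z s v f -> goodR z s v g.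

Lemma regular_above_Dz f g : Dz s1 s2 z f -> regular_above f g -> Dz s1 s2 z g.
Proof.
move=> /DzP[df hf] [dg hg]; apply/DzP; split => // j1 j2 v vj.
by have [k /hg hk] := hf _ _ _ vj; exists k.
Qed.

Lemma regular_above_YR f v p : Dz s1 s2 z f -> regular_above f (YR s1 s2 z v f p).
Proof.
move=> /DzP[df hf].
suff : forall i j : 'I_T, regular_above f (YRhom z i j (proj2 T s1 s2 i j v) f p).
  move=> h; have add g g' : regular_above f g -> regular_above f g' ->
      regular_above f (g + g').
    move=> [d1 g1] [d2 g2]; rewrite -[g]scale1r; split; first exact: dual_lin.
    by move=> s u hu; apply: (goodR_lin H) => //; [exact: g1|exact: g2].
  have zero : regular_above f 0.
    by split; [exact: dual_zero|move=> s u _; exact: goodR_zero].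
  by rewrite /YR; elim/big_ind: _ => // i _; elim/big_ind: _ => // j _; exact: h.
move=> i j; have ev := proj2_eig H i j v; have [k hk] := hf _ _ _ ev.
by rewrite (YRhomE p df ev hk); exact: (opR_dual_good H p df hk).
Qed.

Lemma mul_cx_supp (A : C -> C^o) sg s e : mul_cx z sg s A e <> 0 ->
  exists i : nat, A (e - i%:R) <> 0.
Proof.
move=> h; apply: contrapT => ni; apply: h; apply: fsum0 => i.
have [->|/eqP a0] := eqVneq (A (e - i%:R)) 0; first by rewrite scaler0.
by case: ni; exists i.
Qed.

Lemma fct_neq0 (g : W -> C^o) : g <> 0 -> exists w, g w <> 0.
Proof.
move=> g0; apply: contrapT => h; apply: g0; apply/funext => w.
by apply: contrapT => gw; apply: h; exists w.
Qed.

Lemma opR_supp f k j1 j2 v e : dual f -> eigV2 T s1 s2 j1 j2 v ->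
  opR z (k%:R + frac T j1) v f e <> 0 -> exists m : int, e = m%:~R - frac T j2.
Proof.
move=> df vj h.
have [w hw] : exists w, mul_cx z (-1) (- (k%:R + frac T j1))
    (fun p => clr z (k%:R + frac T j1) v f p w : C^o) e <> 0.
  apply: contrapT => nw; apply: h.
  rewrite /opR -[RHS](scaler0 _ (expipi (- (k%:R + frac T j1)))); congr (_ *: _).
  by apply/funext => w; apply: contrapT => hw; apply: nw; exists w.
have [i hi] := mul_cx_supp hw.
have [m hm] : exists m : int, e - i%:R =
    k%:R + frac T j1 - frac T j1 - frac T j2 + m%:~R.
  by apply: (@clr_supp _ _ _ _ _ _ H W z _ _ _ _ _ _ df vj) => h'; apply: hi; rewrite h'.
exists (k%:Z + m + i%:Z); rewrite !intrD /=; transitivity (e - i%:R + i%:R); first ring.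
by rewrite hm; ring.
Qed.

Lemma YR_supp f v e : Dz s1 s2 z f -> YR s1 s2 z v f e <> 0 ->
  exists n : int, e = frac T n.
Proof.
move=> /DzP[df hf] h; apply: contrapT => ne; apply: h.
apply: big1 => i _; apply: big1 => j _; have ev := proj2_eig H i j v.
have [k hk] := hf _ _ _ ev; rewrite (YRhomE e df ev hk).
apply: contrapT => /(opR_supp df ev)[m hm]; apply: ne.
by exists (m * T%:Z - j%:Z); rewrite fracD fracN frac_mul.
Qed.

Lemma YR_low f v : Dz s1 s2 z f -> exists N : int, forall n : int, n < N ->
  YR s1 s2 z v f (frac T n) = 0.
Proof.
move=> Df; have [df hf] := (DzP f).1 Df.
apply: (@low_frac R T T_gt0 (fun q => YR s1 s2 z v f q = 0)).
pose Z (i j : 'I_T) q := YRhom z i j (proj2 T s1 s2 i j v) f q.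
apply: (@lowtr_sum R _ _ _ (fun i q => \sum_(j < T) Z i j q)) => i.
apply: (@lowtr_sum R _ _ _ (Z i)) => j q; rewrite /Z.
have ev := proj2_eig H i j v; have [k hk] := hf _ _ _ ev; have [J hJ] := hk q.
exists J => m mJ; rewrite (YRhomE _ df ev hk) /opR.
rewrite (_ : (fun w => _) = 0) ?scaler0 //; apply/funext => w; apply: fsum0 => l.
have -> : q - m%:R - l%:R = q - (m + l)%:R by rewrite natrD; ring.
rewrite hJ ?scaler0 //.
by apply: (leq_trans mJ); exact: leq_addr.
Qed.

Lemma opL_supp f l k j1 j2 v e : dual f -> eigV2 T s1 s2 j1 j2 v ->
  (forall i : nat, clr z (k%:R + frac T j1 + i%:R) v f (- (l%:R + frac T j2) - 1) = 0) ->
  opL z (l%:R + frac T j2) v f e <> 0 ->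
  exists m : int, e = m%:~R - frac T j1 /\ - k%:Z <= m.
Proof.
move=> df vj hcl /fct_neq0[w hw]; have [i hi] := mul_cx_supp hw.
have h : clr z (- (e - i%:R) - 1) v f (- (l%:R + frac T j2) - 1) <> 0.
  by move=> h'; apply: hi; rewrite h'.
have [m hm] := clr_supp H df vj h.
have eE : e = (l%:Z + m + i%:Z)%:~R - frac T j1.
  move: hm => /(congr1 (fun x => x + e + 1 + l%:R + frac T j2)) hm.
  transitivity (- (l%:R + frac T j2) - 1 + e + 1 + l%:R + frac T j2); first ring.
  by rewrite hm !intrD /=; ring.
exists (l%:Z + m + i%:Z); split => //; rewrite leNgt; apply/negP => lt; apply: h.
rewrite -[RHS](hcl (absz (- (l%:Z + m + k%:Z) - 1)%R)); apply: eq_clr => //.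
have -> : (absz (- (l%:Z + m + k%:Z) - 1)%R)%:R = (- (l%:Z + m + k%:Z) - 1)%:~R :> C.
  by rewrite pmulrn; congr (_ %:~R); lia.
by rewrite eE !intrD !intrN !intrD /=; ring.
Qed.

(** N comes from the powers that clear f, so one bound serves all the coefficients g of Y^R(v, x) f
    at once. *)
Lemma YL_supp f u : Dz s1 s2 z f -> exists N : int, forall g e, regular_above f g ->
  YL s1 s2 z u g e <> 0 -> exists n : int, e = frac T n /\ N <= n.
Proof.
move=> Df; have [df hf] := (DzP f).1 Df.
have hk i j := cid (hf _ _ _ (proj2_eig H i j u)).
pose K := \max_(i < T) \max_(j < T) sval (hk i j).
(* An exponent m - i/T with m >= - K and i < T has numerator m T - i > - (K + 1) T. *)
exists (- (K%:Z + 1) * T%:Z) => g e hg h.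
have Dg := regular_above_Dz Df hg; have dg := Dg.1.
apply: contrapT => ne; apply: h; apply: big1 => i _; apply: big1 => j _.
have ev := proj2_eig H i j u.
have kg := hg.2 _ _ (svalP (hk i j)).
have [L hL] := goodL_of_goodR dg ev kg; have [gL cl] := hL L (leqnn L).
rewrite (YLhomE e dg ev gL); apply: contrapT => /(opL_supp dg ev cl)[m [em km]].
apply: ne; exists (m * T%:Z - i%:Z); split; first by rewrite fracD fracN frac_mul.
have : (sval (hk i j) <= K)%N.
  by apply: leq_trans (leq_bigmax i); exact: (leq_bigmax j).
have := ltn_ord i; nia.
Qed.

(** Guarantees that the sum in [Yreg] is the genuine coefficient of the product and not the default
    value 0. *)
Lemma Yreg_fins f u v e : Dz s1 s2 z f ->
  fins (fun p => YL s1 s2 z u (YR s1 s2 z v f p) (e - p)).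
Proof.
move=> Df; have [N hN] := YR_low v Df; have [N' hN'] := YL_supp u Df.
apply: (@frac_conv_fins _ _ T_gt0 _ _ e N N') => p h.
  have h' : YR s1 s2 z v f p <> 0 by move=> h'; apply: h; rewrite h' YL_0.
  have [n pn] := YR_supp Df h'; exists n; split => //; rewrite leNgt.
  by apply/negP => /hN; rewrite -pn.
by apply: (hN' _ _ _ h); exact: regular_above_YR.
Qed.

Lemma Yreg_bilin f e : Dz s1 s2 z f ->
  bilin (fun u v => \sum_(p \in [set: C]) YL s1 s2 z u (YR s1 s2 z v f p) (e - p)).
Proof.
move=> Df; have DY v p := regular_above_Dz Df (regular_above_YR v p Df).
split=> [u a x y|v a x y]; rewrite -fsum_lincomb; try exact: Yreg_fins.
  by apply: eq_fsum => p; rewrite (YR_linear p Df) YL_linr.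
by apply: eq_fsum => p; rewrite (YL_linear _ (DY v p)).
Qed.

Lemma vac_eig : eigV2 T s1 s2 0 0 (vac V).
Proof.
have [_ _ v1 _ _] := tws_aut1 H; have [_ _ v2 _ _] := tws_aut2 H.
by split; rewrite /eigV rootu0 scale1r.
Qed.

Lemma clr_vac f e : dual f -> clr z 0 (vac V) f e = mono 0 e *: f.
Proof.
move=> df; apply/funext => w; rewrite /clr /mul_xc (@fsum1 _ _ _ 0%N).
  by rewrite binc0 !mul1r scale1r subr0 addr0 Yo_vac (linZ df).
by move=> [|i] // _; rewrite binc0S mul0r scale0r.
Qed.

Lemma lowtr_mono (U : lmodType C) h (u : U) : lowtr (fun e => mono h e *: u).
Proof.
move=> q; have [[i qi]|nq] := pselect (exists i : nat, q - h = i%:R).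
  exists i.+1 => j ij; rewrite /mono subr_eq addrC -subr_eq qi eqr_nat.
  by rewrite ltn_eqF // scale0r.
exists 0%N => j _; rewrite /mono; case: eqP => [qj|_]; last by rewrite scale0r.
by case: nq; exists j; rewrite -qj; ring.
Qed.

Lemma clr_vacL f e : dual f -> clr z (- e - 1) (vac V) f (-1) = mono 0 e *: f.
Proof.
move=> df; apply/funext => w; rewrite /clr /mul_xc (@fsum1 _ _ _ 0%N).
  rewrite binc0 !mul1r scale1r Yo_vac (linZ df) addr0; congr (mono _ _ *: _); ring.
(* The term of index i + 1 could only contribute when - e - 1 = i, and then its binomial
   coefficient, i over i + 1, is zero. *)
move=> [|i] // _; rewrite Yo_vac /mono; case: eqP => [h|_]; last first.
  by rewrite scale0r (dual0 df) scaler0.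
have -> : - e - 1 = i%:R.
  by move: h => /(congr1 (fun x => x - e - 1)); rewrite add0r -natr1 => <-; ring.
by rewrite binc_small // mul0r scale0r.
Qed.

(** Together with [YL_vac] this isolates either factor of Y^reg by putting the vacuum in the other
    slot. *)
Lemma YR_vac f e : Dz s1 s2 z f -> YR s1 s2 z (vac V) f e = mono 0 e *: f.
Proof.
move=> Df; have df := Df.1.
have E0 : 0%:R + frac T 0 = 0 by rewrite frac0 addr0.
have good : goodR z (0%:R + frac T 0) (vac V) f.
  by rewrite E0; apply: (lowtr_supp (lowtr_mono 0 f)) => p; rewrite clr_vac.
rewrite (YR_eig e Df vac_eig good) E0 /opR oppr0 expipi0 scale1r.
by apply/funext => w; rewrite mul_cx_s0 clr_vac.
Qed.

Lemma YL_vac f e : Dz s1 s2 z f -> YL s1 s2 z (vac V) f e = mono 0 e *: f.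
Proof.
move=> Df; have df := Df.1.
have E0 : 0%:R + frac T 0 = 0 by rewrite frac0 addr0.
have good : goodL z (0%:R + frac T 0) (vac V) f.
  rewrite E0; apply: (lowtr_supp (lowtr_mono 0 f)) => p.
  by rewrite oppr0 sub0r clr_vacL.
rewrite (YL_eig e Df vac_eig good) E0 /opL oppr0 sub0r.
by apply/funext => w; rewrite mul_cx_s0 clr_vacL.
Qed.

Lemma YR_linr a f g u e : Dz s1 s2 z f -> Dz s1 s2 z g ->
  YR s1 s2 z u (a *: f + g) e = a *: YR s1 s2 z u f e + YR s1 s2 z u g e.
Proof.
move=> Df Dg; have [df hf] := (DzP f).1 Df; have [dg hg] := (DzP g).1 Dg.
rewrite /YR scaler_sumr -big_split; apply: eq_bigr => i _.
rewrite scaler_sumr -big_split; apply: eq_bigr => j _ /=.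
have eu := proj2_eig H i j u.
have [k [gf gg]] := goodR_common df dg (hf _ _ _ eu) (hg _ _ _ eu).
have dfg := dual_lin a df dg.
rewrite !(@YRhomE i j _ _ k) //; first exact: opR_linr.
exact: (goodR_lin H).
Qed.

Lemma YR_0 u e : YR s1 s2 z u (0 : W -> C^o) e = 0.
Proof.
by have := YR_linr (-1) u e Dz_0 Dz_0; rewrite scaler0 addr0 scaleN1r addNr.
Qed.

Section LinearCombinations.
Variables (I : Type) (r : seq I) (c : I -> C) (f : I -> W -> C^o).
Hypothesis Df : forall i, Dz s1 s2 z (f i).

Lemma Dz_sum : Dz s1 s2 z (\sum_(i <- r) c i *: f i).
Proof.
by elim/big_rec: _ => [|i g _ Dg]; [exact: Dz_0|exact: Dz_lin].
Qed.

(** The operators are linear on D(W) only, so membership has to be carried along the induction. *)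
Lemma Dz_linear_sum (O : (W -> C^o) -> W -> C^o) : O 0 = 0 ->
  (forall a g g', Dz s1 s2 z g -> Dz s1 s2 z g' -> O (a *: g + g') = a *: O g + O g') ->
  O (\sum_(i <- r) c i *: f i) = \sum_(i <- r) c i *: O (f i).
Proof.
move=> O0 OD; suff [] : Dz s1 s2 z (\sum_(i <- r) c i *: f i) /\
  O (\sum_(i <- r) c i *: f i) = \sum_(i <- r) c i *: O (f i) by [].
elim/big_rec2: _ => [|i g g' _ [Dg IH]]; first by split; [exact: Dz_0|].
by split; [exact: Dz_lin|rewrite OD // IH].
Qed.

Lemma YR_sum u e : YR s1 s2 z u (\sum_(i <- r) c i *: f i) e =
  \sum_(i <- r) c i *: YR s1 s2 z u (f i) e.
Proof.
apply: (Dz_linear_sum (O := fun g => YR s1 s2 z u g e)); first exact: YR_0.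
by move=> a g g'; exact: YR_linr.
Qed.

Lemma YL_sum u e : YL s1 s2 z u (\sum_(i <- r) c i *: f i) e =
  \sum_(i <- r) c i *: YL s1 s2 z u (f i) e.
Proof.
apply: (Dz_linear_sum (O := fun g => YL s1 s2 z u g e)); first exact: YL_0.
by move=> a g g'; exact: YL_linr.
Qed.

End LinearCombinations.

End RegularOperators.

(** * P(z)-intertwining maps as homomorphisms *)

Section TensorFacts.
Variables (K : fieldType) (M N : lmodType K).

Lemma tens_repr (t : tens M N) : t = \sum_(x <- trepr t) x.1.1 *: tpure x.1.2 x.2.
Proof.
apply: tens_ext => U f bf.
have lf := tlift_linear bf.
have f0 : tlift f 0 = 0 by have := lf (-1) 0 0; rewrite scaler0 addr0 scaleN1r addNr.
have -> : tlift f (\sum_(x <- trepr t) x.1.1 *: tpure x.1.2 x.2) =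
    \sum_(x <- trepr t) x.1.1 *: tlift f (tpure x.1.2 x.2).
  by elim/big_rec2: _ => // x y1 y2 _ <-; rewrite lf.
by apply: eq_bigr => x _; rewrite tlift_pure.
Qed.

Lemma tens_pure_ind (P : tens M N -> Prop) : P 0 ->
  (forall a m n t, P t -> P (a *: tpure m n + t)) -> forall t, P t.
Proof.
move=> P0 PD t; rewrite [t]tens_repr; elim/big_rec: _ => // x t' _ Pt'.
exact: PD.
Qed.

(** Read directly on the representative chosen by [trepr]; this unfolds the nested lifts of
    [Ytens]. *)
Lemma tlift_seq (U U' : lmodType K) (F : U -> U') (f : M -> N -> U) (t : tens M N) :
  linear F -> F (tlift f t) = \sum_(x <- trepr t) x.1.1 *: F (f x.1.2 x.2).
Proof.
move=> lF; rewrite /tlift /teval.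
have F0 : F 0 = 0 by have := lF (-1) 0 0; rewrite scaler0 addr0 scaleN1r addNr.
by elim/big_rec2: _ => // x y1 y2 _ <-; rewrite lF.
Qed.

End TensorFacts.

Section PzMaps.
Variables (R : realType) (V : voa R) (T : nat) (s1 s2 sigma : V -> V).
Local Notation C := R[i].
Local Notation frac := (Defs.frac R).
Local Notation expipi := (@Defs.expipi R).
Hypothesis H : twisting T s1 s2 sigma.
Variables (W : twmod T sigma) (W1 : twmod T s1) (W2 : twmod T s2) (z : C).
Hypothesis z0 : z != 0.

Let T_gt0 := tws_gt0 H.

Lemma tws_spanned1 (P : V -> Prop) : (forall j v, eigV T s1 j v -> P v) ->
  (forall u v, P u -> P v -> P (u + v)) -> forall v, P v.
Proof. by move=> Pe; apply: (eigV2_ind H) => j1 j2 v [/Pe]. Qed.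

Lemma tws_spanned2 (P : V -> Prop) : (forall j v, eigV T s2 j v -> P v) ->
  (forall u v, P u -> P v -> P (u + v)) -> forall v, P v.
Proof. by move=> Pe; apply: (eigV2_ind H) => j1 j2 v [_ /Pe]. Qed.

Lemma tpureDl (w1 w1' : W1) (w2 : W2) a :
  tpure (a *: w1 + w1') w2 = a *: tpure w1 w2 + tpure w1' w2.
Proof. exact: (@tpure_bilin _ W1 W2).2. Qed.

Lemma tpureDr (w1 : W1) (w2 w2' : W2) a :
  tpure w1 (a *: w2 + w2') = a *: tpure w1 w2 + tpure w1 w2'.
Proof. exact: (@tpure_bilin _ W1 W2).1. Qed.

Lemma tpure_linl (w2 : W2) : linear (fun w1 : W1 => tpure w1 w2).
Proof. by move=> a x y; exact: tpureDl. Qed.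

Lemma tpure_linr (w1 : W1) : linear (fun w2 : W2 => tpure w1 w2).
Proof. by move=> a x y; exact: tpureDr. Qed.

Section Coefficients.
Variable F : tens W1 W2 -> W -> C^o.
Hypotheses (linF : linear F) (dF : forall t, dual (F t)).

Definition serA v w1 w2 (w : W) : C -> C^o := fun p => F (tpure w1 w2) (Yo v w p).
Definition serB v (w1 : W1) (w2 : W2) (w : W) : C -> C^o :=
  fun p => F (tpure w1 (twY v w2 p)) w.
Definition serC v (w1 : W1) (w2 : W2) (w : W) : C -> C^o :=
  fun p => F (tpure (twY v w1 p) w2) w.

Lemma F_B0 v w1 w2 p : twY v w2 p = 0 -> F (tpure w1 (twY v w2 p)) = 0.
Proof. by move=> ->; rewrite (lin0 (tpure_linr w1)) (lin0 linF). Qed.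

Lemma F_C0 v w1 w2 p : twY v w1 p = 0 -> F (tpure (twY v w1 p) w2) = 0.
Proof. by move=> ->; rewrite (lin0 (tpure_linl w2)) (lin0 linF). Qed.

Lemma lowB v w1 w2 : lowtr (fun p => F (tpure w1 (twY v w2 p))).
Proof. by move=> q; have [J hJ] := tw_lowtr tws_spanned2 v w2 q; exists J => j /hJ /F_B0. Qed.

Lemma lowC v w1 w2 : lowtr (fun p => F (tpure (twY v w1 p) w2)).
Proof. by move=> q; have [J hJ] := tw_lowtr tws_spanned1 v w1 q; exists J => j /hJ /F_C0. Qed.

Lemma serA_uptr v w1 w2 w : uptr (serA v w1 w2 w).
Proof. exact: (mat_uptr H). Qed.

Lemma serB_lowtr v w1 w2 w : lowtr (serB v w1 w2 w).
Proof. exact: (lowtr_app w (lowB v w1 w2)). Qed.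

Lemma serC_lowtr v w1 w2 w : lowtr (serC v w1 w2 w).
Proof. exact: (lowtr_app w (lowC v w1 w2)). Qed.

Lemma serB_supp j1 j2 v w1 w2 w p : eigV2 T s1 s2 j1 j2 v -> serB v w1 w2 w p <> 0 ->
  exists m : int, p = m%:~R - frac T j2.
Proof.
case=> _ vj h; apply: (tw_supp_eig (w := w2) vj) => h'.
by apply: h; rewrite /serB F_B0.
Qed.

Lemma serC_supp j1 j2 v w1 w2 w p : eigV2 T s1 s2 j1 j2 v -> serC v w1 w2 w p <> 0 ->
  exists m : int, p = m%:~R - frac T j1.
Proof.
case=> vj _ h; apply: (tw_supp_eig (w := w1) vj) => h'.
by apply: h; rewrite /serC F_C0.
Qed.

Lemma clr_F_supp j1 j2 v w1 w2 s e w : eigV2 T s1 s2 j1 j2 v ->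
  clr z s v (F (tpure w1 w2)) e w <> 0 ->
  exists m : int, e = s - frac T j1 - frac T j2 + m%:~R.
Proof.
move=> vj A0; apply: (@clr_supp _ _ _ _ _ _ H W z _ _ _ _ _ _ (dF (tpure w1 w2)) vj).
by move=> h; apply: A0; rewrite h.
Qed.

(* The coefficient of x0^{-n-1-j1/T} x1^{m-j2/T} in the Jacobi identity *)
Definition Jcoef (j1 j2 : int) v w1 w2 w (n m : int) : C :=
  mul_xc (- z) (n%:~R + frac T j1) (serA v w1 w2 w) (m%:~R - frac T j2)
  - expipi (frac T j1) * ((-1) ^ n *
      mul_cx z (-1) (n%:~R + frac T j1) (serB v w1 w2 w) (m%:~R - frac T j2))
  - mul_cx z 1 (- (m%:~R - frac T j2) - 1) (serC v w1 w2 w) (- n%:~R - 1 - frac T j1).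

(** On all three delta functions multiplication by x1 - z is multiplication by x0, which raises n by
    one; in the third one x1 may be replaced by z + x0. *)
Lemma Jcoef_rec j1 j2 v w1 w2 w n m :
  Jcoef j1 j2 v w1 w2 w (n + 1) m =
  Jcoef j1 j2 v w1 w2 w n (m - 1) - z * Jcoef j1 j2 v w1 w2 w n m.
Proof.
rewrite /Jcoef; set a := frac T j1; set b := frac T j2.
have -> : (n + 1)%:~R + a = n%:~R + a + 1 by rewrite intrD addrAC.
have -> : (m - 1)%:~R - b = m%:~R - b - 1 by rewrite intrB addrAC.
rewrite mul_xcS; last exact: serA_uptr.
rewrite mul_cxS //; last exact: serB_lowtr.
have -> : - (m%:~R - b - 1) - 1 = - (m%:~R - b) - 1 + 1 by ring.
rewrite (mul_cxS z0) //; last exact: serC_lowtr.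
have -> : - (n + 1)%:~R - 1 - a = - n%:~R - 1 - a - 1 by rewrite intrD; ring.
rewrite expfzDr ?oppr_eq0 ?oner_eq0 // expr1z.
move: (mul_xc _ _ _ _) (mul_xc _ _ _ _) (mul_cx _ _ _ _ _) (mul_cx _ _ _ _ _)
  (mul_cx _ _ _ _ _) (mul_cx _ _ _ _ _) ((-1) ^ n) => x1 x2 x3 x4 x5 x6 x7.
rewrite /GRing.scale /=; ring.
Qed.

(** At exponents of x0 or x1 outside the cosets indexed by n and m all three terms vanish by their
    supports. *)
Lemma Pz_jacobiP : Pz_jacobi z F <->
  forall j1 j2 v w1 w2 w n m, eigV2 T s1 s2 j1 j2 v -> Jcoef j1 j2 v w1 w2 w n m = 0.
Proof.
split=> [h j1 j2 v w1 w2 w n m vj|h j1 j2 v w1 w2 w [e0 e1] vj].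
  have := h j1 j2 v w1 w2 w (- n%:~R - 1 - frac T j1, m%:~R - frac T j2) vj.
  rewrite (fmul_delta_xz z (frac T j1) (serA v w1 w2 w)).
  rewrite (fmul_delta_zx z (frac T j1) (serB v w1 w2 w)).
  rewrite (@fmul_delta_z _ z _ _ (serC v w1 w2 w) m _ _ erefl) => E.
  by rewrite /Jcoef -E; apply: subrr.
have [[n ->]|ne0] := pselect (exists n : int, e0 = - n%:~R - 1 - frac T j1).
  rewrite (fmul_delta_xz z (frac T j1) (serA v w1 w2 w)).
  rewrite (fmul_delta_zx z (frac T j1) (serB v w1 w2 w)).
  have [[m ->]|ne1] := pselect (exists m : int, e1 = m%:~R - frac T j2).
    rewrite (@fmul_delta_z _ z _ _ (serC v w1 w2 w) m _ _ erefl).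
    by apply/eqP; rewrite -subr_eq0; apply/eqP; exact: h.
  rewrite fmul_delta_z_eq0 => [|m em]; last by apply: ne1; exists m.
  have -> : mul_xc (- z) (n%:~R + frac T j1) (serA v w1 w2 w) e1 = 0.
    apply: contrapT => /(clr_F_supp vj)[m em].
    by apply: ne1; exists (n + m); rewrite em intrD; ring.
  have -> : mul_cx z (-1) (n%:~R + frac T j1) (serB v w1 w2 w) e1 = 0.
    apply: contrapT => /mul_cx_supp[i /(serB_supp vj)[m em]]; apply: ne1.
    by exists (m + i%:Z); rewrite intrD addrAC -em subrK.
  by rewrite !scaler0 subr0.
rewrite (@fmul_delta_xz_eq0 _ z _ _ (serA v w1 w2 w)) => [|n en]; last by apply: ne0; exists n.
rewrite (@fmul_delta_zx_eq0 _ z _ _ (serB v w1 w2 w)) => [|n en]; last by apply: ne0; exists n.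
rewrite scaler0 subr0.
have [[m em]|ne1] := pselect (exists m : int, e1 = m%:~R - frac T j2); last first.
  by rewrite fmul_delta_z_eq0 // => m em; apply: ne1; exists m.
rewrite (@fmul_delta_z _ z _ _ (serC v w1 w2 w) m _ _ em); symmetry.
apply: contrapT => /mul_cx_supp[i /(serC_supp vj)[k ek]]; apply: ne0.
exists (- (k + i%:Z) - 1); transitivity (e0 - i%:R + i%:R); first ring.
by rewrite ek !intrD !intrN !intrD /=; ring.
Qed.

(** The relations Y^R(v, x) F(w1 (x) w2) = F(w1 (x) Y(v, x) w2) and, below, Y^L(v, x) F(w1 (x) w2) =
    F(Y(v, x) w1 (x) w2) with poles cleared. In this form they make sense before F is known to take
    values in D(W), and they imply it. *)
Definition right_compat (j1 : int) v w1 w2 := exists k0, forall k : nat, (k0 <= k)%N ->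
  forall e w, clr z (k%:R + frac T j1) v (F (tpure w1 w2)) e w =
    expipi (k%:R + frac T j1) *:
      mul_cx z (-1) (k%:R + frac T j1) (serB v w1 w2 w) e.
Definition left_compat (j2 : int) v w1 w2 := exists l0, forall l : nat, (l0 <= l)%N ->
  forall e w, clr z (- e - 1) v (F (tpure w1 w2)) (- (l%:R + frac T j2) - 1) w =
      mul_cx z 1 (l%:R + frac T j2) (serC v w1 w2 w) e.

Lemma expipi_sign (k : nat) a : expipi (k%:R + a) = expipi a * (-1) ^ k%:Z.
Proof. by rewrite expipiD mulrC -(expipi_int R k). Qed.

(** For large n the third term only involves powers of x0 below the truncation of Y(v, x0) w1. *)
Lemma Jcoef_large j1 j2 v w1 w2 : exists k0, forall k : nat, (k0 <= k)%N -> forall w m,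
  Jcoef j1 j2 v w1 w2 w k m =
  clr z (k%:R + frac T j1) v (F (tpure w1 w2)) (m%:~R - frac T j2) w
  - expipi (k%:R + frac T j1) *
    mul_cx z (-1) (k%:R + frac T j1) (serB v w1 w2 w) (m%:~R - frac T j2).
Proof.
have [k0 hk0] := lowC v w1 w2 (- 1 - frac T j1).
exists k0 => k kk w m; rewrite /Jcoef [X in _ - _ - X]fsum0 => [|i].
  by rewrite subr0 mulrA -expipi_sign.
rewrite /serC (_ : - k%:~R - 1 - frac T j1 - i%:R = -1 - frac T j1 - (k + i)%:R).
  by rewrite hk0 ?scaler0 //; apply: (leq_trans kk); exact: leq_addr.
by rewrite natrD -pmulrn; ring.
Qed.

(** At m = - l - 1 with l large the second term is killed by the truncation of Y(v, x1) w2, and the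
    power of z + x0 in the third is exactly l + j2/T, as in [left_compat]. *)
Lemma Jcoef_small j1 j2 v w1 w2 : exists l0, forall l : nat, (l0 <= l)%N -> forall w n,
  let e := - n%:~R - 1 - frac T j1 in
  Jcoef j1 j2 v w1 w2 w n (- l%:Z - 1) =
  (clr z (- e - 1) v (F (tpure w1 w2)) (- (l%:R + frac T j2) - 1) w : C)
  - mul_cx z 1 (l%:R + frac T j2) (serC v w1 w2 w) e.
Proof.
have [l0 hl0] := lowB v w1 w2 (- 1 - frac T j2).
exists l0 => l ll w n e; rewrite /Jcoef.
have -> : (- l%:Z - 1)%:~R - frac T j2 = - (l%:R + frac T j2) - 1.
  by rewrite intrB intrN /=; ring.
rewrite [X in _ - _ * (_ * X) - _ = _]fsum0 => [|i]; last first.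
  rewrite /serB (_ : - (l%:R + frac T j2) - 1 - i%:R = -1 - frac T j2 - (l + i)%:R).
    by rewrite hl0 ?scaler0 //; apply: (leq_trans ll); exact: leq_addr.
  by rewrite natrD; ring.
rewrite !mulr0 subr0; have -> : n%:~R + frac T j1 = - e - 1 by rewrite /e; ring.
by have -> : - (- (l%:R + frac T j2) - 1) - 1 = l%:R + frac T j2 by ring.
Qed.

Lemma compat_of_Jcoef j1 j2 v w1 w2 : eigV2 T s1 s2 j1 j2 v ->
  (forall w n m, Jcoef j1 j2 v w1 w2 w n m = 0) ->
  right_compat j1 v w1 w2 /\ left_compat j2 v w1 w2.
Proof.
move=> vj hJ; have supp s e w := @clr_F_supp j1 j2 v w1 w2 s e w vj.
split.
  have [k0 hk0] := Jcoef_large j1 j2 v w1 w2; exists k0 => k kk e w.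
  have [[m em]|ne] := pselect (exists m : int, e = m%:~R - frac T j2).
    have := hJ w k m; rewrite hk0 // -em => /eqP; rewrite subr_eq0 => /eqP; exact.
  transitivity (0 : C).
    apply: contrapT => /supp[m em]; apply: ne; exists (k%:Z + m).
    by rewrite em intrD /=; ring.
  symmetry; apply/eqP; rewrite scaler_eq0; apply/orP; right; apply/eqP.
  apply: contrapT => /mul_cx_supp[i /(serB_supp vj)[m em]]; apply: ne.
  by exists (m + i%:Z); rewrite intrD addrAC -em subrK.
have [l0 hl0] := Jcoef_small j1 j2 v w1 w2; exists l0 => l ll e w.
have [[n en]|ne] := pselect (exists n : int, e = - n%:~R - 1 - frac T j1).
  by have := hJ w n (- l%:Z - 1); rewrite hl0 // -en => /eqP; rewrite subr_eq0 => /eqP.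
transitivity (0 : C).
  apply: contrapT => /supp[m]; move/(congr1 (fun x => x + e + frac T j2)) => em.
  apply: ne; exists (- l%:Z - 1 - m).
  transitivity (- (l%:R + frac T j2) - 1 + e + frac T j2 + l%:R + 1); first ring.
  by rewrite em !intrD !intrN /=; ring.
symmetry; apply: contrapT => /mul_cx_supp[i /(serC_supp vj)[m em]]; apply: ne.
exists (- (m + i%:Z) - 1); transitivity (e - i%:R + i%:R); first ring.
by rewrite em !intrD !intrN !intrD /=; ring.
Qed.

Lemma Jcoef_of_compat j1 j2 v w1 w2 :
  right_compat j1 v w1 w2 -> left_compat j2 v w1 w2 ->
  forall w n m, Jcoef j1 j2 v w1 w2 w n m = 0.
Proof.
move=> [k0 hk] [l0 hl] w.
apply: (recursive_array_eq0 z0); first exact: Jcoef_rec.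
  have [k1 hk1] := Jcoef_large j1 j2 v w1 w2; exists (maxn k0 k1)%:Z => n m nk.
  have [k nE] : exists k : nat, n = k%:Z by exists (absz n); lia.
  rewrite nE hk1; last by lia.
  by rewrite hk ?subrr //; lia.
have [l1 hl1] := Jcoef_small j1 j2 v w1 w2; exists (- (maxn l0 l1)%:Z - 1) => n m mk.
have [l mE] : exists l : nat, m = - l%:Z - 1 by exists (absz (m + 1)%R); lia.
rewrite mE hl1; last by lia.
by rewrite hl ?subrr //; lia.
Qed.

End Coefficients.
End PzMaps.

Lemma fsum_bigsum (I : choiceType) (J : Type) (U : nmodType) (r : seq J)
    (g : J -> I -> U) : (forall j, fins (g j)) ->
  \sum_(i \in [set: I]) \sum_(j <- r) g j i =
  \sum_(j <- r) \sum_(i \in [set: I]) g j i.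
Proof.
move=> fg; suff [] : fins (fun i => \sum_(j <- r) g j i) /\
    \sum_(i \in [set: I]) \sum_(j <- r) g j i =
    \sum_(j <- r) \sum_(i \in [set: I]) g j i by [].
elim: r => [|j r [fr IH]].
  split; first by exists [::] => i _; rewrite big_nil.
  by rewrite big_nil; apply: fsum0 => i; rewrite big_nil.
have E i : \sum_(k <- j :: r) g k i = g j i + \sum_(k <- r) g k i by rewrite big_cons.
split; first by apply: (fins_supp (finsD (fg j) fr)) => i; rewrite E.
by rewrite (eq_fsum E) fsumD // IH big_cons.
Qed.

(** * P(z)-intertwining maps and the homomorphism property *)

Section PzHom.
Variables (R : realType) (V : voa R) (T : nat) (s1 s2 sigma : V -> V).
Local Notation C := R[i].
Local Notation frac := (Defs.frac R).
Hypothesis H : twisting T s1 s2 sigma.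
Variables (W : twmod T sigma) (W1 : twmod T s1) (W2 : twmod T s2) (z : C).
Hypothesis z0 : z != 0.

Let T_gt0 := tws_gt0 H.

Lemma Ytens_fins u v (w1 : W1) (w2 : W2) e :
  fins (fun p => tpure (twY u w1 p) (twY v w2 (e - p))).
Proof.
have [N1 h1] := @low_frac R T T_gt0 (fun q => twY u w1 q = 0)
  (tw_lowtr (tws_spanned1 H) u w1).
have [N2 h2] := @low_frac R T T_gt0 (fun q => twY v w2 q = 0)
  (tw_lowtr (tws_spanned2 H) v w2).
apply: (@frac_conv_fins _ _ T_gt0 _ _ e N1 N2) => p h.
  have h' : twY u w1 p <> 0.
    by move=> h'; apply: h; rewrite h' (lin0 (tpure_linl (twY v w2 (e - p)))).
  have [n pn] := twY_supp h'; exists n; split => //; rewrite leNgt; apply/negP => /h1.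
  by rewrite -pn.
have h' : twY v w2 (e - p) <> 0.
  by move=> h'; apply: h; rewrite h' (lin0 (tpure_linr (twY u w1 p))).
have [n pn] := twY_supp h'; exists n; split => //; rewrite leNgt; apply/negP => /h2.
by rewrite -pn.
Qed.

Section Compatibility.
Variable F : tens W1 W2 -> W -> C^o.
Hypotheses (linF : linear F) (dF : forall t, dual (F t)).

Lemma right_compat_good j1 v w1 w2 : right_compat z F j1 v w1 w2 ->
  exists k : nat, goodR z (k%:R + frac T j1) v (F (tpure w1 w2)).
Proof.
case=> k hk; exists k => q; have [J hJ] := lowB H linF v w1 w2 q; exists J => j jJ.
apply/funext => w; rewrite hk //.
suff -> : mul_cx z (-1) (k%:R + frac T j1) (serB F v w1 w2 w) (q - j%:R) = 0.
  by rewrite scaler0.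
apply: fsum0 => i; rewrite /serB (_ : q - j%:R - i%:R = q - (j + i)%:R).
  by rewrite hJ ?scaler0 // (leq_trans jJ) // leq_addr.
by rewrite natrD; ring.
Qed.

(** The compatibility presents the cleared series as e^{pi i s} (z - x)^s times the wanted one;
    [opR] cancels both factors. *)
Lemma right_compat_YR j1 j2 v w1 w2 e : Dz s1 s2 z (F (tpure w1 w2)) ->
  eigV2 T s1 s2 j1 j2 v -> right_compat z F j1 v w1 w2 ->
  YR s1 s2 z v (F (tpure w1 w2)) e = F (tpure w1 (twY v w2 e)).
Proof.
move=> Df vj rc; have [k0 hk0] := right_compat_good rc; case: rc => k1 hk1.
set k := (k0 + k1)%N.
have hk : goodR z (k%:R + frac T j1) v (F (tpure w1 w2)).
  have := goodRD H k1 (dF _) hk0.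
  by rewrite (_ : k0%:R + frac T j1 + k1%:R = k%:R + frac T j1) // /k natrD; ring.
rewrite (YR_eig H z0 e Df vj hk); set s := _ + _; apply/funext => w.
rewrite /opR fctE.
rewrite (@eq_mul_cx _ _ _ _ _ _
   (fun p => expipi s *: mul_cx z (-1) s (serB F v w1 w2 w) p)); last first.
  by move=> p; rewrite hk1 // leq_addl.
have lB := serB_lowtr H linF v w1 w2 w.
rewrite -(@lin_mul_cx _ z _ _ (fun x => expipi s *: x) _ _ _ _ (scale_linear _) (lowtr_mul_cx _ _ _ lB)).
rewrite mul_cx_comp // addNr mul_cx_s0 scalerA -expipiD addNr expipi0.
exact: scale1r.
Qed.

Lemma YR_right_compat j1 j2 v w1 w2 : Dz s1 s2 z (F (tpure w1 w2)) ->
  eigV2 T s1 s2 j1 j2 v ->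
  (forall e, YR s1 s2 z v (F (tpure w1 w2)) e = F (tpure w1 (twY v w2 e))) ->
  right_compat z F j1 v w1 w2.
Proof.
move=> Df vj hY; have [df hf] := (DzP H z _).1 Df; have [k0 hk0] := hf _ _ _ vj.
exists k0 => k kk e w; set s := _ + _.
have hk : goodR z s v (F (tpure w1 w2)).
  have := goodRD H (k - k0) (dF _) hk0.
  rewrite (_ : k0%:R + frac T j1 + (k - k0)%:R = s) // /s natrB //; ring.
have lc := lowtr_app w hk.
rewrite (@eq_mul_cx _ _ _ _ _ _ (fun p => expipi (- s) *:
    mul_cx z (-1) (- s) (fun p => clr z s v (F (tpure w1 w2)) p w : C^o) p)).
  rewrite -(@lin_mul_cx _ z _ _ (fun x => expipi (- s) *: x) _ _ _ _ (scale_linear _) (lowtr_mul_cx _ _ _ lc)).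
  by rewrite mul_cx_comp // addrN mul_cx_s0 scalerA -expipiD addrN expipi0 scale1r.
by move=> p; rewrite /serB -hY (YR_eig H z0 p Df vj hk).
Qed.

Lemma left_compat_good j2 v w1 w2 : left_compat z F j2 v w1 w2 ->
  exists l0, forall l : nat, (l0 <= l)%N ->
    goodL z (l%:R + frac T j2) v (F (tpure w1 w2)).
Proof.
case=> l0 hl; exists l0 => l ll q; have [J hJ] := lowC H linF v w1 w2 q; exists J => j jJ.
apply/funext => w; rewrite hl //.
apply: fsum0 => i; rewrite /serC (_ : q - j%:R - i%:R = q - (j + i)%:R).
  by rewrite hJ ?scaler0 // (leq_trans jJ) // leq_addr.
by rewrite natrD; ring.
Qed.

Lemma left_compat_YL j1 j2 v w1 w2 e : Dz s1 s2 z (F (tpure w1 w2)) ->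
  eigV2 T s1 s2 j1 j2 v -> left_compat z F j2 v w1 w2 ->
  YL s1 s2 z v (F (tpure w1 w2)) e = F (tpure (twY v w1 e) w2).
Proof.
move=> Df vj rc; have [l0 hl0] := left_compat_good rc; case: rc => l1 hl1.
set l := (l0 + l1)%N.
have hl : goodL z (l%:R + frac T j2) v (F (tpure w1 w2)) by apply: hl0; exact: leq_addr.
rewrite (YL_eig H z0 e Df vj hl); set s := _ + _; apply/funext => w.
rewrite /opL (@eq_mul_cx _ _ _ _ _ _ (mul_cx z 1 s (serC F v w1 w2 w))); last first.
  by move=> p; rewrite hl1 // leq_addl.
have lC := serC_lowtr H linF v w1 w2 w.
by rewrite mul_cx_comp // addNr mul_cx_s0.
Qed.

Lemma YL_left_compat j1 j2 v w1 w2 : Dz s1 s2 z (F (tpure w1 w2)) ->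
  eigV2 T s1 s2 j1 j2 v ->
  (forall e, YL s1 s2 z v (F (tpure w1 w2)) e = F (tpure (twY v w1 e) w2)) ->
  left_compat z F j2 v w1 w2.
Proof.
move=> Df vj hY; have [l0 hl0] := Dz_goodL H z0 Df vj.
exists l0 => l ll e w; set s := l%:R + frac T j2.
have hl : goodL z s v (F (tpure w1 w2)).
  have := goodLD H (l - l0) (dF _) hl0.
  rewrite (_ : l0%:R + frac T j2 + (l - l0)%:R = s) // /s natrB //; ring.
have lc := lowtr_app w hl.
rewrite (@eq_mul_cx _ _ _ _ _ _ (mul_cx z 1 (- s)
    (fun p => clr z (- p - 1) v (F (tpure w1 w2)) (- s - 1) w : C^o))).
  by rewrite mul_cx_comp // addrN mul_cx_s0.
by move=> p; rewrite /serC -hY (YL_eig H z0 p Df vj hl).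
Qed.

End Compatibility.

Lemma Pz_hom (F : tens W1 W2 -> W -> C^o) : Pz_map z F ->
  (forall t, Dz s1 s2 z (F t)) /\
  forall (a : tens V V) (t : tens W1 W2) e, F (Ytens a t e) = Yreg s1 s2 z a (F t) e.
Proof.
case=> linF dF /(Pz_jacobiP H z linF dF) hJ.
have compat j1 j2 v w1 w2 : eigV2 T s1 s2 j1 j2 v ->
    right_compat z F j1 v w1 w2 /\ left_compat z F j2 v w1 w2.
  by move=> vj; apply: (compat_of_Jcoef H linF dF vj) => w n m; exact: hJ.
have Dpure w1 w2 : Dz s1 s2 z (F (tpure w1 w2)).
  apply/(DzP H); split => // j1 j2 v vj.
  exact: (right_compat_good linF (compat _ _ _ w1 w2 vj).1).
have Ft t : F t = \sum_(x <- trepr t) x.1.1 *: F (tpure x.1.2 x.2).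
  rewrite {1}[t]tens_repr; elim/big_rec2: _ => [|x y1 y2 _ <-]; first exact: lin0.
  exact: linF.
have RY v w1 w2 e : YR s1 s2 z v (F (tpure w1 w2)) e = F (tpure w1 (twY v w2 e)).
  elim/(eigV2_ind H): v => [j1 j2 v vj|u v hu hv].
    exact: (right_compat_YR linF dF _ (Dpure _ _) vj (compat _ _ _ _ _ vj).1).
  rewrite (linD (YR_linear H z0 e (Dpure w1 w2))) hu hv (linD (tw_linl w2 e)).
  by rewrite (linD (tpure_linr w1)) (linD linF).
have LY v w1 w2 e : YL s1 s2 z v (F (tpure w1 w2)) e = F (tpure (twY v w1 e) w2).
  elim/(eigV2_ind H): v => [j1 j2 v vj|u v hu hv].
    exact: (left_compat_YL linF _ (Dpure _ _) vj (compat _ _ _ _ _ vj).2).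
  rewrite (linD (YL_linear H z0 e (Dpure w1 w2))) hu hv (linD (tw_linl w1 e)).
  by rewrite (linD (tpure_linl w2)) (linD linF).
split=> [t|a t e]; first by rewrite Ft; apply: (Dz_sum H); move=> x; exact: Dpure.
rewrite /Ytens (tlift_seq _ _ linF) /Yreg {2}/tlift /teval.
apply: eq_bigr => -[[c u] v] _ /=; congr (_ *: _).
rewrite (tlift_seq _ _ linF).
pose G (y : C * W1 * W2) p : W -> C^o :=
  y.1.1 *: F (tpure (twY u y.1.2 (e - p)) (twY v y.2 p)).
have E p : YL s1 s2 z u (YR s1 s2 z v (F t) p) (e - p) =
    \sum_(y <- trepr t) G y p.
  rewrite Ft (YR_sum H z0) => [|x]; last exact: Dpure.
  rewrite (eq_bigr _ (fun x _ => congr1 (GRing.scale _) (RY _ _ _ _))).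
  rewrite (YL_sum H z0) => [|x]; last exact: Dpure.
  by apply: eq_bigr => x _; rewrite LY.
have fT u' v' w1 w2 := Ytens_fins u' v' w1 w2 e.
(* [Yreg] sums over the exponent of Y^R, which acts on the side of W2, and [Ytens] over the exponent
   on the side of W1; p -> e - p matches them. *)
have refl : injective (fun p : C => e - p) by move=> p q /addrI/oppr_inj.
have reflK p : exists q : C, p = e - q by exists (e - p); rewrite subKr.
rewrite (eq_fsum E) fsum_bigsum => [|y]; last first.
  have [r hr] := fT u v y.1.2 y.2; exists [seq e - p | p <- r] => p pr.
  have h := hr (e - p); rewrite subKr in h; rewrite /G h ?(lin0 linF) ?scaler0 //.
  by apply: contra pr => ep; apply/mapP; exists (e - p); rewrite ?subKr.
apply: eq_bigr => y _; rewrite (lin_fsum linF (fT u v _ _)).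
rewrite /G fsumZr; congr (_ *: _).
rewrite (fsum_reindex refl (fun p _ => reflK p)); apply: eq_fsum => p.
by rewrite subKr.
Qed.

(** The lifts are nested, so bilinearity is checked first in (w1, w2) and then in (u, v). *)
Lemma Ytens_pure u v (w1 : W1) (w2 : W2) e : Ytens (tpure u v) (tpure w1 w2) e =
  \sum_(p \in [set: C]) tpure (twY u w1 p) (twY v w2 (e - p)).
Proof.
pose g (w1 : W1) (w2 : W2) (u v : V) :=
  \sum_(p \in [set: C]) tpure (twY u w1 p) (twY v w2 (e - p)).
have fT u' v' w1' w2' := Ytens_fins u' v' w1' w2' e.
have bw (u' v' : V) : bilin (fun w1 w2 => g w1 w2 u' v').
  split=> [m a x y|n a x y]; rewrite /g -fsum_lincomb //;
    apply: eq_fsum => p; rewrite (tw_linr _ _); [exact: tpureDr|exact: tpureDl].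
have E : (fun u v => tlift (fun w1 w2 => g w1 w2 u v) (tpure w1 w2)) = g w1 w2.
  by apply/funext => u'; apply/funext => v'; exact: tlift_pure.
rewrite /Ytens E tlift_pure //.
split=> [m a x y|n a x y]; rewrite /g -fsum_lincomb //;
  apply: eq_fsum => p; rewrite (tw_linl _ _); [exact: tpureDr|exact: tpureDl].
Qed.

Lemma hom_Pz (F : tens W1 W2 -> W -> C^o) : linear F ->
  (forall t, Dz s1 s2 z (F t)) ->
  (forall (a : tens V V) (t : tens W1 W2) e, F (Ytens a t e) = Yreg s1 s2 z a (F t) e) ->
  Pz_map z F.
Proof.
move=> linF Df hom; have dF t : dual (F t) := (Df t).1.
have Yp u v w1 w2 e : \sum_(p \in [set: C])
      YL s1 s2 z u (YR s1 s2 z v (F (tpure w1 w2)) p) (e - p) =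
    \sum_(p \in [set: C]) F (tpure (twY u w1 p) (twY v w2 (e - p))).
  have := hom (tpure u v) (tpure w1 w2) e.
  rewrite Ytens_pure (lin_fsum linF (Ytens_fins _ _ _ _ _)) => ->.
  by rewrite /Yreg tlift_pure //; exact: (Yreg_bilin H z0).
have RY v w1 w2 e : YR s1 s2 z v (F (tpure w1 w2)) e = F (tpure w1 (twY v w2 e)).
  (* With the vacuum as left vector only p = e remains on the left and p = 0 on the right, which
     isolates Y^R. The symmetric choice isolates Y^L below. *)
  have := Yp (vac V) v w1 w2 e.
  have DY p : Dz s1 s2 z (YR s1 s2 z v (F (tpure w1 w2)) p).
    by apply: (regular_above_Dz H (Df _)); exact: (regular_above_YR H z0).
  rewrite (@fsum1 _ _ _ e) => [|p pe]; last first.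
    by rewrite (YL_vac H z0) // /mono subr_eq0 eq_sym (negPf pe) scale0r.
  rewrite (@fsum1 _ _ _ 0) => [|p pe]; last first.
    by rewrite twY_vac /mono (negPf pe) scale0r (lin0 (tpure_linl _)) (lin0 linF).
  by rewrite (YL_vac H z0) // twY_vac subrr subr0 /mono eqxx !scale1r.
have LY v w1 w2 e : YL s1 s2 z v (F (tpure w1 w2)) e = F (tpure (twY v w1 e) w2).
  have := Yp v (vac V) w1 w2 e.
  rewrite (@fsum1 _ _ _ 0) => [|p pe]; last first.
    by rewrite (YR_vac H z0) // /mono (negPf pe) scale0r (YL_0 H W z0).
  rewrite (@fsum1 _ _ _ e) => [|p pe]; last first.
    rewrite twY_vac /mono subr_eq0 eq_sym (negPf pe) scale0r.
    by rewrite (lin0 (tpure_linr _)) (lin0 linF).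
  by rewrite (YR_vac H z0) // twY_vac subrr subr0 /mono eqxx !scale1r.
split => //; apply/(Pz_jacobiP H z linF dF) => j1 j2 v w1 w2 w n m vj.
apply: (Jcoef_of_compat H z0 linF dF).
  exact: (YR_right_compat dF (Df _) vj (RY v w1 w2)).
exact: (YL_left_compat dF (Df _) vj (LY v w1 w2)).
Qed.

Lemma Pz_map_star_homVV : Pz_map_star W W1 W2 z = homVV W W1 W2 z.
Proof.
apply/seteqP; split=> F.
  case=> Fz star; have [Df hom] := Pz_hom Fz; case: Fz => linF _ _.
  by split=> // t; split.
case=> linF SD hom; split; last by move=> t; case: (SD t).
by apply: hom_Pz => // t; case: (SD t).
Qed.

End PzHom.

(** * Intertwining operators and P(z)-intertwining maps *)

Section Correspondence.
Variables (R : realType) (V : voa R) (T : nat) (s1 s2 sigma : V -> V).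
Local Notation C := R[i].
Local Notation frac := (Defs.frac R).
Local Notation expipi := (@Defs.expipi R).
Hypothesis H : twisting T s1 s2 sigma.
Variables (W : twmod T sigma) (W1 : twmod T s1) (W2 : twmod T s2) (z : C).
Hypothesis z0 : z != 0.
Hypotheses (ssW : semisimple (L0 (M := W))) (ssW1 : semisimple (L0 (M := W1)))
  (ssW2 : semisimple (L0 (M := W2))).
Implicit Types (F : tens W1 W2 -> W -> C^o) (Y : W1 -> W2 -> ser R (W -> C^o)).

Section JcoefLinear.
Variables (F F' F'' : tens W1 W2 -> W -> C^o) (a : C).
Hypotheses (linF : linear F) (dF : forall t, dual (F t))
  (linF' : linear F') (dF' : forall t, dual (F' t)).

(** The three tuples of vectors and maps are independent, so one statement yields linearity in F and
    in each of v, w1, w2, w. *)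
Lemma Jcoef_lin j1 j2 n m v w1 w2 w v' w1' w2' w' v'' w1'' w2'' w'' :
  (forall p, serA F'' v'' w1'' w2'' w'' p =
     a *: serA F v w1 w2 w p + serA F' v' w1' w2' w' p) ->
  (forall p, serB F'' v'' w1'' w2'' w'' p =
     a *: serB F v w1 w2 w p + serB F' v' w1' w2' w' p) ->
  (forall p, serC F'' v'' w1'' w2'' w'' p =
     a *: serC F v w1 w2 w p + serC F' v' w1' w2' w' p) ->
  Jcoef z F'' j1 j2 v'' w1'' w2'' w'' n m =
  a * Jcoef z F j1 j2 v w1 w2 w n m + Jcoef z F' j1 j2 v' w1' w2' w' n m.
Proof.
move=> hA hB hC; rewrite /Jcoef (eq_mul_xc _ _ _ hA) (eq_mul_cx _ _ _ _ hB).
rewrite (eq_mul_cx _ _ _ _ hC).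
have uA := serA_uptr H dF v w1 w2 w; have uA' := serA_uptr H dF' v' w1' w2' w'.
have lB := serB_lowtr H linF v w1 w2 w; have lB' := serB_lowtr H linF' v' w1' w2' w'.
have lC := serC_lowtr H linF v w1 w2 w; have lC' := serC_lowtr H linF' v' w1' w2' w'.
rewrite (mul_xc_lin _ _ _ _ uA uA') (mul_cx_lin _ _ _ _ _ lB lB').
rewrite (mul_cx_lin _ _ _ _ _ lC lC').
rewrite /GRing.scale /=; ring.
Qed.

End JcoefLinear.

Section Icoefs.
Variable Y : W1 -> W2 -> ser R (W -> C^o).
Hypotheses (bY : forall e, bilin (fun w1 w2 => Y w1 w2 e))
  (dY : forall w1 w2 e, dual (Y w1 w2 e)).

Definition serIA v w1 w2 (w : W) : C -> C -> C^o := fun p q => Y w1 w2 q (Yo v w p).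
Definition serIB v (w1 : W1) (w2 : W2) (w : W) : C -> C -> C^o :=
  fun p q => Y w1 (twY v w2 p) q w.
Definition serIC v (w1 : W1) (w2 : W2) (w : W) : C -> C -> C^o :=
  fun p q => Y (twY v w1 p) w2 q w.

Lemma itw_linl w2 e : linear (fun w1 => Y w1 w2 e).
Proof. exact: (bY e).2. Qed.

Lemma itw_linr w1 e : linear (fun w2 => Y w1 w2 e).
Proof. exact: (bY e).1. Qed.

Lemma serIA_uptr v w1 w2 w : uptr (serIA v w1 w2 w).
Proof.
move=> q; have [J hJ] := Yo_uptr (tws_spanned H) v w q; exists J => j jJ.
by apply/funext => p; rewrite /serIA hJ //; exact: lin0 (dY _ _ _).
Qed.

Lemma serIB_lowtr v w1 w2 w : lowtr (serIB v w1 w2 w).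
Proof.
move=> q; have [J hJ] := tw_lowtr (tws_spanned2 H) v w2 q; exists J => j jJ.
by apply/funext => p; rewrite /serIB hJ // (lin0 (itw_linr w1 p)).
Qed.

Lemma serIC_lowtr v w1 w2 w : lowtr (serIC v w1 w2 w).
Proof.
move=> q; have [J hJ] := tw_lowtr (tws_spanned1 H) v w1 q; exists J => j jJ.
by apply/funext => p; rewrite /serIC hJ // (lin0 (itw_linl w2 p)).
Qed.

(* The coefficient of x0^{-n-1-j1/T} x1^{m-j2/T} x2^q in the Jacobi identity *)
Definition Icoef (j1 j2 : int) v w1 w2 w (n m : int) (q : C) : C :=
  let s := n%:~R + frac T j1 in let e := m%:~R - frac T j2 in
  \sum_(i \in [set: nat]) (binc s i * (-1) ^+ i) *:
    serIA v w1 w2 w (e - s + i%:R) (q - i%:R)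
  - expipi (frac T j1) * ((-1) ^ n * \sum_(i \in [set: nat]) (binc s i * (-1) ^+ i) *:
    serIB v w1 w2 w (e - i%:R) (q - s + i%:R))
  - \sum_(i \in [set: nat]) binc (- e - 1) i *:
    serIC v w1 w2 w (- n%:~R - 1 - frac T j1 - i%:R) (q + e + 1 + i%:R).

Lemma itw_jacobiP : itw_jacobi Y <->
  forall j1 j2 v w1 w2 w n m q, eigV2 T s1 s2 j1 j2 v ->
    Icoef j1 j2 v w1 w2 w n m q = 0.
Proof.
split=> [h j1 j2 v w1 w2 w n m q vj|h j1 j2 v w1 w2 w [[e0 e1] e2] vj].
  have := h j1 j2 v w1 w2 w (- n%:~R - 1 - frac T j1, m%:~R - frac T j2, q) vj.
  rewrite (fmul_delta12 (frac T j1) (serIA v w1 w2 w)).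
  rewrite (fmul_delta21 (frac T j1) (serIB v w1 w2 w)).
  rewrite (@fmul_delta02 _ _ _ (serIC v w1 w2 w) m _ _ _ erefl) => E.
  by rewrite /Icoef -E; apply: subrr.
have [[n ->]|ne0] := pselect (exists n : int, e0 = - n%:~R - 1 - frac T j1).
  rewrite (fmul_delta12 (frac T j1) (serIA v w1 w2 w)).
  rewrite (fmul_delta21 (frac T j1) (serIB v w1 w2 w)).
  have [[m ->]|ne1] := pselect (exists m : int, e1 = m%:~R - frac T j2).
    rewrite (@fmul_delta02 _ _ _ (serIC v w1 w2 w) m _ _ _ erefl).
    by apply/eqP; rewrite -subr_eq0; apply/eqP; exact: h.
  rewrite fmul_delta02_eq0 => [|m em]; last by apply: ne1; exists m.
  rewrite fsum0 => [|i]; last first.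
    apply: contrapT => A0; apply: ne1.
    have [m em] : exists m : int, e1 - (n%:~R + frac T j1) + i%:R =
        m%:~R + frac T (- (j1 + j2)).
      apply: (Yo_supp (w := w) (tws_aut H) (eigV2_sigma H vj)) => h0; apply: A0.
      by rewrite /serIA h0 (lin0 (dY _ _ _)) scaler0.
    exists (n + m - i%:Z).
    transitivity (e1 - (n%:~R + frac T j1) + i%:R + (n%:~R + frac T j1) - i%:R).
      by ring.
    by rewrite em fracN fracD !intrB intrD /=; ring.
  rewrite fsum0 ?scaler0 ?subr0 // => i.
  apply: contrapT => A0; apply: ne1.
  have [m em] : exists m : int, e1 - i%:R = m%:~R - frac T j2.
    apply: (tw_supp_eig (w := w2) vj.2) => h0; apply: A0.
    by rewrite /serIB h0 (lin0 (itw_linr w1 _)) scaler0.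
  by exists (m + i%:Z); rewrite intrD addrAC -em subrK.
rewrite (@fmul_delta12_eq0 _ _ _ (serIA v w1 w2 w)) => [|n en]; last by apply: ne0; exists n.
rewrite (@fmul_delta21_eq0 _ _ _ (serIB v w1 w2 w)) => [|n en]; last by apply: ne0; exists n.
rewrite scaler0 subr0.
have [[m em]|ne1] := pselect (exists m : int, e1 = m%:~R - frac T j2); last first.
  by rewrite fmul_delta02_eq0 // => m em; apply: ne1; exists m.
rewrite (@fmul_delta02 _ _ _ (serIC v w1 w2 w) m _ _ _ em); symmetry.
apply: fsum0 => i; apply: contrapT => A0; apply: ne0.
have [k ek] : exists k : int, e0 - i%:R = k%:~R - frac T j1.
  apply: (tw_supp_eig (w := w1) vj.1) => h0; apply: A0.
  by rewrite /serIC h0 (lin0 (itw_linl w2 _)) scaler0.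
exists (- (k + i%:Z) - 1); transitivity (e0 - i%:R + i%:R); first ring.
by rewrite ek !intrD !intrN !intrD /=; ring.
Qed.

End Icoefs.

Section IcoefLinear.
Variables (Y Y' Y'' : W1 -> W2 -> ser R (W -> C^o)) (a : C).
Hypotheses (bY : forall e, bilin (fun w1 w2 => Y w1 w2 e))
  (dY : forall w1 w2 e, dual (Y w1 w2 e))
  (bY' : forall e, bilin (fun w1 w2 => Y' w1 w2 e))
  (dY' : forall w1 w2 e, dual (Y' w1 w2 e)).

Lemma fsum_linear_series (c : nat -> C) (X X' X'' : nat -> C^o) : fins X -> fins X' ->
  (forall i, X'' i = a *: X i + X' i) ->
  \sum_(i \in [set: nat]) c i *: X'' i =
  a *: (\sum_(i \in [set: nat]) c i *: X i) + \sum_(i \in [set: nat]) c i *: X' i.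
Proof.
move=> fX fX' E; have fc (Z : nat -> C^o) : fins Z -> fins (fun i => c i *: Z i).
  by move=> fZ; apply: (fins_supp fZ) => i ->; rewrite scaler0.
rewrite -fsum_lincomb; try exact: fc.
by apply: eq_fsum => i; rewrite E scalerDr !scalerA mulrC.
Qed.

Lemma uptr_fins2 (A : C -> C -> C^o) e (g : nat -> C) : uptr A ->
  fins (fun i : nat => A (e + i%:R) (g i)).
Proof.
by move=> /(_ e)[J hJ]; apply: (fins_nat (B := J)) => j /hJ ->.
Qed.

Lemma lowtr_fins2 (A : C -> C -> C^o) e (g : nat -> C) : lowtr A ->
  fins (fun i : nat => A (e - i%:R) (g i)).
Proof.
by move=> /(_ e)[J hJ]; apply: (fins_nat (B := J)) => j /hJ ->.
Qed.

Lemma Icoef_lin j1 j2 n m q v w1 w2 w v' w1' w2' w' v'' w1'' w2'' w'' :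
  (forall p e, serIA Y'' v'' w1'' w2'' w'' p e =
     a *: serIA Y v w1 w2 w p e + serIA Y' v' w1' w2' w' p e) ->
  (forall p e, serIB Y'' v'' w1'' w2'' w'' p e =
     a *: serIB Y v w1 w2 w p e + serIB Y' v' w1' w2' w' p e) ->
  (forall p e, serIC Y'' v'' w1'' w2'' w'' p e =
     a *: serIC Y v w1 w2 w p e + serIC Y' v' w1' w2' w' p e) ->
  Icoef Y'' j1 j2 v'' w1'' w2'' w'' n m q =
  a * Icoef Y j1 j2 v w1 w2 w n m q + Icoef Y' j1 j2 v' w1' w2' w' n m q.
Proof.
move=> hA hB hC; rewrite /Icoef.
rewrite [X in X - _ - _ = _](fsum_linear_series _ (uptr_fins2 _ _ (serIA_uptr dY v w1 w2 w))
  (uptr_fins2 _ _ (serIA_uptr dY' v' w1' w2' w')) (fun i => hA _ _)).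
rewrite [X in _ - _ * (_ * X) - _ = _](fsum_linear_series _ (lowtr_fins2 _ _ (serIB_lowtr bY v w1 w2 w))
  (lowtr_fins2 _ _ (serIB_lowtr bY' v' w1' w2' w')) (fun i => hB _ _)).
rewrite [X in _ - _ - X = _](fsum_linear_series _ (lowtr_fins2 _ _ (serIC_lowtr bY v w1 w2 w))
  (lowtr_fins2 _ _ (serIC_lowtr bY' v' w1' w2' w')) (fun i => hC _ _)).
move: (\sum_(_ \in _) _) (\sum_(_ \in _) _) (\sum_(_ \in _) _)
  (\sum_(_ \in _) _) (\sum_(_ \in _) _) (\sum_(_ \in _) _) ((-1) ^ n) => x1 x2 x3 x4 x5 x6 x7.
rewrite /GRing.scale /=; ring.
Qed.

End IcoefLinear.

(* Y(w1, x) w2 = (x/z)^{L(0)} F((x/z)^{-L(0)} w1 (x) (x/z)^{-L(0)} w2), where L(0)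
   acts on the values of F by duality *)
Definition related Y F := forall h1 h2 h w1 w2 w e,
  L0 w1 = h1 *: w1 -> L0 w2 = h2 *: w2 -> L0 w = h *: w ->
  Y w1 w2 e w = if e == h - h1 - h2 then cpow z (- e) * F (tpure w1 w2) w else 0.

(** In each sum the weight condition on the exponent of x2 becomes the same condition on q, whatever
    the index i. The remaining powers of z turn the coefficients of the expansions in x1, x2 into
    those with x2 = z, for instance (-1)^i z^i = (- z)^i. *)
Lemma related_Icoef Y F (k : int) h1 h2 h j1 j2 v w1 w2 w n m q :
  related Y F -> eigV2 T s1 s2 j1 j2 v -> LV 0 v = k%:~R *: v ->
  L0 w1 = h1 *: w1 -> L0 w2 = h2 *: w2 -> L0 w = h *: w ->
  Icoef Y j1 j2 v w1 w2 w n m q =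
  if q == h - k%:~R - (m%:~R - frac T j2) + (n%:~R + frac T j1) - h1 - h2
  then cpow z (- q) * Jcoef z F j1 j2 v w1 w2 w n m else 0.
Proof.
move=> rel vj vk hw1 hw2 hw; rewrite /Icoef /Jcoef.
set s := n%:~R + frac T j1; set e := m%:~R - frac T j2.
have autW := tws_aut H; have spW := tws_spanned H.
have EA i : serIA Y v w1 w2 w (e - s + i%:R) (q - i%:R) =
    if q == h - k%:~R - e + s - h1 - h2
    then cpow z (- q) * (z ^+ i * serA F v w1 w2 w (e - s + i%:R)) else 0.
  rewrite /serIA (rel h1 h2 _ _ _ _ _ hw1 hw2 (Yo_weight autW spW (e - s + i%:R) vk hw)).
  rewrite -(inj_eq (addIr i%:R)) subrK.
  rewrite (_ : _ - _ - _ + i%:R = h - k%:~R - e + s - h1 - h2); last by ring.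
  case: eqP => // _; rewrite opprB addrC cpowD cpow_nat //.
  by rewrite -mulrA.
have EB i : serIB Y v w1 w2 w (e - i%:R) (q - s + i%:R) =
    if q == h - k%:~R - e + s - h1 - h2
    then cpow z (- q) * (cpow z (s - i%:R) * serB F v w1 w2 w (e - i%:R)) else 0.
  have aut2 := tws_aut2 H.
  rewrite /serIB (rel h1 _ _ _ _ _ _ hw1
    (tw_weight aut2 (tws_spanned2 H) (e - i%:R) vk hw2) hw).
  rewrite -(inj_eq (addIr (s - i%:R))).
  rewrite (_ : q - s + i%:R + (s - i%:R) = q); last by ring.
  rewrite (_ : _ - _ - _ + (s - i%:R) = h - k%:~R - e + s - h1 - h2); last by ring.
  case: eqP => // _; rewrite (_ : - (q - s + i%:R) = - q + (s - i%:R)) ?cpowD -?mulrA //.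
  by ring.
have EC i : serIC Y v w1 w2 w (- n%:~R - 1 - frac T j1 - i%:R) (q + e + 1 + i%:R) =
    if q == h - k%:~R - e + s - h1 - h2
    then cpow z (- q) * (cpow z (- e - 1 - i%:R) *
      serC F v w1 w2 w (- n%:~R - 1 - frac T j1 - i%:R)) else 0.
  have aut1 := tws_aut1 H.
  rewrite /serIC (rel _ h2 _ _ _ _ _ (tw_weight aut1 (tws_spanned1 H)
    (- n%:~R - 1 - frac T j1 - i%:R) vk hw1) hw2 hw).
  rewrite -(inj_eq (addIr (- e - 1 - i%:R))).
  rewrite (_ : q + e + 1 + i%:R + (- e - 1 - i%:R) = q); last by ring.
  rewrite (_ : _ - _ - _ + (- e - 1 - i%:R) = h - k%:~R - e + s - h1 - h2); last first.
    by rewrite /s; ring.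
  case: eqP => // _.
  rewrite (_ : - (q + e + 1 + i%:R) = - q + (- e - 1 - i%:R)) ?cpowD -?mulrA //.
  by ring.
rewrite [X in X - _ - _ = _](eq_fsum (fun i => congr1 (GRing.scale _) (EA i))).
rewrite [X in _ - _ * (_ * X) - _ = _](eq_fsum (fun i => congr1 (GRing.scale _) (EB i))).
rewrite [X in _ - _ - X = _](eq_fsum (fun i => congr1 (GRing.scale _) (EC i))).
case: eqP => _; last by rewrite !fsum0 ?mulr0 ?subrr // => i; rewrite scaler0.
rewrite /mul_xc /mul_cx !mulrBr; congr (_ - _ - _).
- rewrite -[RHS]/(_ *: (_ : C^o)) -fsumZr; apply: eq_fsum => i.
  by rewrite [(- z) ^+ i]exprNn /GRing.scale /=; ring.
- rewrite [RHS]mulrCA; congr (_ * _); rewrite [RHS]mulrCA; congr (_ * _).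
  rewrite -[RHS]/(_ *: (_ : C^o)) -fsumZr; apply: eq_fsum => i.
  by rewrite /GRing.scale /=; ring.
- rewrite -[RHS]/(_ *: (_ : C^o)) -fsumZr; apply: eq_fsum => i.
  by rewrite expr1n /GRing.scale /=; ring.
Qed.

End Correspondence.

Section WeightInduction.
Variables (R : realType) (V : voa R) (T : nat) (s1 s2 sigma : V -> V).
Local Notation C := R[i].
Hypothesis H : twisting T s1 s2 sigma.

(** Automorphisms fix omega, hence commute with L(0), so the weight components of v stay in the
    joint eigenspace. *)
Lemma weight_eig_ind (P : V -> Prop) j1 j2 :
  (forall (k : int) v, LV 0 v = k%:~R *: v -> eigV2 T s1 s2 j1 j2 v -> P v) ->
  (forall u v, P u -> P v -> P (u + v)) ->
  forall v, eigV2 T s1 s2 j1 j2 v -> P v.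
Proof.
move=> Ph PD v [v1 v2].
have lL := LV_linear (V := V) 0; have sL := semisimple_LV (V := V).
have Pc h : P (eigcomp (LV 0) h v).
  have e : eigV2 T s1 s2 j1 j2 (eigcomp (LV 0) h v).
    have l1 := tws_lin1 H; have l2 := tws_lin2 H.
    split; rewrite /eigV.
      rewrite -(eigcomp_comm lL sL h v l1) => [|u]; last exact: aut_LV (tws_aut1 H) 0 u.
      by rewrite v1 (linZ (eigcomp_linear lL sL h)).
    rewrite -(eigcomp_comm lL sL h v l2) => [|u]; last exact: aut_LV (tws_aut2 H) 0 u.
    by rewrite v2 (linZ (eigcomp_linear lL sL h)).
  have hv := eigcomp_eig lL sL h v.
  have [c0|/eqP c0] := eqVneq (eigcomp (LV 0) h v) 0.
    by apply: (Ph 0) => //; rewrite c0 scaler0 (lin0 lL).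
  by have [k hk] := weight_int hv c0; apply: (Ph k) => //; rewrite -hk.
rewrite [v](eigcomp_sum lL sL).
have [r [ur hr]] := fins_uniq (eigcomp_fins lL sL v); rewrite (fsum_seq ur) //.
elim: (r) => [|h r' IH]; last by rewrite big_cons; apply: PD.
rewrite big_nil; apply: (Ph 0); first by rewrite scaler0 (lin0 lL).
by split; rewrite /eigV scaler0 ?(lin0 (tws_lin1 H)) ?(lin0 (tws_lin2 H)).
Qed.

End WeightInduction.

(** * From intertwining operators to P(z)-intertwining maps *)

Section Isomorphism.
Variables (R : realType) (V : voa R) (T : nat) (s1 s2 sigma : V -> V).
Local Notation C := R[i].
Local Notation frac := (Defs.frac R).
Local Notation expipi := (@Defs.expipi R).
Hypothesis H : twisting T s1 s2 sigma.
Variables (W : twmod T sigma) (W1 : twmod T s1) (W2 : twmod T s2) (z : C).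
Hypothesis z0 : z != 0.
Hypotheses (ssW : semisimple (L0 (M := W))) (ssW1 : semisimple (L0 (M := W1)))
  (ssW2 : semisimple (L0 (M := W2))).
Implicit Types (F : tens W1 W2 -> W -> C^o) (Y : W1 -> W2 -> ser R (W -> C^o)).

Let indW := ss_ind (L0_linear (M := W)) ssW.
Let indW1 := ss_ind (L0_linear (M := W1)) ssW1.
Let indW2 := ss_ind (L0_linear (M := W2)) ssW2.

(** Multilinearity reduces the identity to weight vectors, on which [related] can be applied. *)
Lemma Jcoef_ext F j1 j2 n m : linear F -> (forall t, dual (F t)) ->
  (forall (k : int) h1 h2 h v w1 w2 w, eigV2 T s1 s2 j1 j2 v -> LV 0 v = k%:~R *: v ->
     L0 w1 = h1 *: w1 -> L0 w2 = h2 *: w2 -> L0 w = h *: w ->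
     Jcoef z F j1 j2 v w1 w2 w n m = 0) ->
  forall v w1 w2 w, eigV2 T s1 s2 j1 j2 v -> Jcoef z F j1 j2 v w1 w2 w n m = 0.
Proof.
move=> lF dF hom v w1 w2 w vj.
have add v w1 w2 w v' w1' w2' w' v'' w1'' w2'' w'' :=
  @Jcoef_lin _ _ _ _ _ _ H W W1 W2 z F F F 1 lF dF lF dF j1 j2 n m
    v w1 w2 w v' w1' w2' w' v'' w1'' w2'' w''.
elim/(weight_eig_ind H): v / vj w1 w2 w => [k v kv vj|u v hu hv] w1 w2 w; last first.
  rewrite (add u w1 w2 w v w1 w2 w); first by rewrite hu hv mulr0 addr0.
  - by move=> p; rewrite scale1r /serA (linD (Yo_linl w p)) (linD (dF _)).
  - move=> p; rewrite scale1r /serB (linD (tw_linl w2 p)) (linD (tpure_linr w1)).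
    by rewrite (linD lF).
  - move=> p; rewrite scale1r /serC (linD (tw_linl w1 p)) (linD (tpure_linl w2)).
    by rewrite (linD lF).
elim/indW1: w1 w2 w => [h1 w1 hw1|w1 w1' hu hv] w2 w; last first.
  rewrite (add v w1 w2 w v w1' w2 w); first by rewrite hu hv mulr0 addr0.
  - by move=> p; rewrite scale1r /serA (linD (tpure_linl w2)) (linD lF).
  - by move=> p; rewrite scale1r /serB (linD (tpure_linl _)) (linD lF).
  - by move=> p; rewrite scale1r /serC (linD (tw_linr v p)) (linD (tpure_linl w2)) (linD lF).
elim/indW2: w2 w => [h2 w2 hw2|w2 w2' hu hv] w; last first.
  rewrite (add v w1 w2 w v w1 w2' w); first by rewrite hu hv mulr0 addr0.
  - by move=> p; rewrite scale1r /serA (linD (tpure_linr w1)) (linD lF).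
  - by move=> p; rewrite scale1r /serB (linD (tw_linr v p)) (linD (tpure_linr w1)) (linD lF).
  - by move=> p; rewrite scale1r /serC (linD (tpure_linr _)) (linD lF).
elim/indW: w => [h w hw|w w' hu hv]; last first.
  rewrite (add v w1 w2 w v w1 w2 w'); first by rewrite hu hv mulr0 addr0.
  - by move=> p; rewrite scale1r /serA (linD (Yo_linr v p)) (linD (dF _)).
  - by move=> p; rewrite scale1r /serB (linD (dF _)).
  - by move=> p; rewrite scale1r /serC (linD (dF _)).
exact: (hom k h1 h2 h).
Qed.

Lemma Icoef_ext Y j1 j2 n m q : (forall e, bilin (fun w1 w2 => Y w1 w2 e)) ->
  (forall w1 w2 e, dual (Y w1 w2 e)) ->
  (forall (k : int) h1 h2 h v w1 w2 w, eigV2 T s1 s2 j1 j2 v -> LV 0 v = k%:~R *: v ->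
     L0 w1 = h1 *: w1 -> L0 w2 = h2 *: w2 -> L0 w = h *: w ->
     Icoef Y j1 j2 v w1 w2 w n m q = 0) ->
  forall v w1 w2 w, eigV2 T s1 s2 j1 j2 v -> Icoef Y j1 j2 v w1 w2 w n m q = 0.
Proof.
move=> bY dY hom v w1 w2 w vj.
have add v w1 w2 w v' w1' w2' w' v'' w1'' w2'' w'' :=
  @Icoef_lin _ _ _ _ _ _ H W W1 W2 Y Y Y 1 bY dY bY dY j1 j2 n m q
    v w1 w2 w v' w1' w2' w' v'' w1'' w2'' w''.
have lY1 := itw_linl bY; have lY2 := itw_linr bY.
elim/(weight_eig_ind H): v / vj w1 w2 w => [k v kv vj|u v hu hv] w1 w2 w; last first.
  rewrite (add u w1 w2 w v w1 w2 w); first by rewrite hu hv mulr0 addr0.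
  - by move=> p e; rewrite scale1r /serIA (linD (Yo_linl w p)) (linD (dY _ _ _)).
  - by move=> p e; rewrite scale1r /serIB (linD (tw_linl w2 p)) (linD (lY2 w1 e)).
  - by move=> p e; rewrite scale1r /serIC (linD (tw_linl w1 p)) (linD (lY1 w2 e)).
elim/indW1: w1 w2 w => [h1 w1 hw1|w1 w1' hu hv] w2 w; last first.
  rewrite (add v w1 w2 w v w1' w2 w); first by rewrite hu hv mulr0 addr0.
  - by move=> p e; rewrite scale1r /serIA (linD (lY1 w2 e)).
  - by move=> p e; rewrite scale1r /serIB (linD (lY1 _ e)).
  - by move=> p e; rewrite scale1r /serIC (linD (tw_linr v p)) (linD (lY1 w2 e)).
elim/indW2: w2 w => [h2 w2 hw2|w2 w2' hu hv] w; last first.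
  rewrite (add v w1 w2 w v w1 w2' w); first by rewrite hu hv mulr0 addr0.
  - by move=> p e; rewrite scale1r /serIA (linD (lY2 w1 e)).
  - by move=> p e; rewrite scale1r /serIB (linD (tw_linr v p)) (linD (lY2 w1 e)).
  - by move=> p e; rewrite scale1r /serIC (linD (lY2 _ e)).
elim/indW: w => [h w hw|w w' hu hv]; last first.
  rewrite (add v w1 w2 w v w1 w2 w'); first by rewrite hu hv mulr0 addr0.
  - by move=> p e; rewrite scale1r /serIA (linD (Yo_linr v p)) (linD (dY _ _ _)).
  - by move=> p e; rewrite scale1r /serIB (linD (dY _ _ _)).
  - by move=> p e; rewrite scale1r /serIC (linD (dY _ _ _)).
exact: (hom k h1 h2 h).
Qed.

Lemma omega_eig : eigV2 T s1 s2 0 0 (omega V).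
Proof.
have [_ _ _ o1 _] := tws_aut1 H; have [_ _ _ o2 _] := tws_aut2 H.
by split; rewrite /eigV rootu0 scale1r.
Qed.

Local Notation LM1 := (Lmode (@twY R V T s1 W1) (omega V) (-1)).

Lemma LM1_weight h (w1 : W1) : L0 w1 = h *: w1 -> L0 (LM1 w1) = (h + 1) *: LM1 w1.
Proof.
move=> hw; rewrite (tw_weight (tws_aut1 H) (tws_spanned1 H) _ (LV0_omega V) hw).
congr (_ *: _); rewrite mulrNz opprK -pmulrn; ring.
Qed.

Lemma Icoef_omega Y (w1 : W1) (w2 : W2) (w : W) q :
  Icoef Y 0 0 (omega V) w1 w2 w 0 (-2) q =
  Y w1 w2 q (L0 w) - Y w1 (L0 w2) q w - (Y (LM1 w1) w2 (q - 1) w + Y (L0 w1) w2 q w).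
Proof.
rewrite /Icoef frac0 mulr0z !addr0 !subr0 expipi0 expr0z !mul1r.
have e2 : (-2)%:~R = - 2 :> C by rewrite mulrNz.
rewrite e2; congr (_ - _ - _).
- rewrite (@fsum1 _ _ _ 0%N) => [|[|i] // _]; last by rewrite binc0S mul0r scale0r.
  by rewrite binc0 mulr1 scale1r ?addr0 ?subr0 /serIA Yo_omega.
- rewrite (@fsum1 _ _ _ 0%N) => [|[|i] // _]; last by rewrite binc0S mul0r scale0r.
  rewrite binc0 mulr1 scale1r ?addr0 ?subr0 /serIB /L0 /Lmode.
  by rewrite mulr0z oppr0 sub0r.
- have -> : - - 2 - 1 = 1 :> C by ring.
  rewrite (@fsum_nat _ _ 2) => [|[|[|i]] // _]; last by rewrite binc1SS scale0r.
  rewrite !big_ord_recl big_ord0 ?addr0 /= binc0 (binc_nat R 1 1) bin1 !scale1r /serIC.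
  rewrite /L0 /Lmode !mulrNz ?mulr0z ?oppr0 ?sub0r ?opprK ?subr0 ?addr0 -?pmulrn.
  have -> : 1 - 2 = -1 :> C by ring.
  have -> : (bump 0 0)%:R = 1 :> C by [].
  have -> : q - 2 + 1 = q - 1 by ring.
  by rewrite subrK (_ : -1 - 1 = -2) //; ring.
Qed.

Lemma Jcoef_omega F w1 w2 w :
  Jcoef z F 0 0 (omega V) w1 w2 w 0 (-2) =
  F (tpure w1 w2) (L0 w) - F (tpure w1 (L0 w2)) w
  - (z * F (tpure (LM1 w1) w2) w + F (tpure (L0 w1) w2) w).
Proof.
rewrite /Jcoef frac0 mulr0z !addr0 !subr0 expipi0 expr0z !mul1r.
have e2 : (-2)%:~R = - 2 :> C by rewrite mulrNz.
rewrite e2 mul_cx_s0; congr (_ - _ - _).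
- rewrite /mul_xc (@fsum1 _ _ _ 0%N) => [|[|i] // _]; last by rewrite binc0S mul0r scale0r.
  by rewrite binc0 expr0 mulr1 scale1r ?addr0 ?subr0 /serA Yo_omega.
- by rewrite /serB /L0 /Lmode mulr0z oppr0 sub0r.
- have -> : - - 2 - 1 = 1 :> C by ring.
  rewrite mul_cx_s1 // scale1r /serC /L0 /Lmode mulrNz mulr0z oppr0 !sub0r opprK -pmulrn.
  have -> : 1 - 2 = -1 :> C by ring.
  by rewrite (_ : -1 - 1 = -2) //; ring.
Qed.

(** An Euler equation: with the L(-1)-derivative property, the coefficient of the Jacobi identity
    computed in [Icoef_omega] says that h - h1 - h2 - e annihilates this matrix coefficient. *)
Lemma itw_weight Y h1 h2 h w1 w2 w e : itw_op W W1 W2 Y ->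
  L0 w1 = h1 *: w1 -> L0 w2 = h2 *: w2 -> L0 w = h *: w ->
  e != h - h1 - h2 -> Y w1 w2 e w = 0.
Proof.
case=> bY rY _ jY LY hw1 hw2 hw ne.
have dY u1 u2 q : dual (Y u1 u2 q) by case: (rY u1 u2 q).
have := (itw_jacobiP H bY dY).1 jY 0 0 _ w1 w2 w 0 (-2) e omega_eig.
rewrite Icoef_omega LY hw hw1 hw2 (linZ (dY _ _ _)) (linZ (itw_linr bY w1 e)).
rewrite (linZ (itw_linl bY w2 e)) /dser subrK !fctE.
rewrite -[X in _ = X -> _]/(0 : C^o).
rewrite -[h *: _ - _ - _]/(h * Y w1 w2 e w - h2 * Y w1 w2 e w -
  (e * Y w1 w2 e w + h1 * Y w1 w2 e w)) => E.
have : (h - h1 - h2 - e) * Y w1 w2 e w = 0 by rewrite -[RHS]E; ring.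
by move/eqP; rewrite mulf_eq0 subr_eq0 eq_sym (negPf ne) /= => /eqP.
Qed.

(** Makes the substitution x = z a finite sum against each w: weight vectors contribute one exponent
    each. *)
Lemma itw_fins Y w1 w2 w : itw_op W W1 W2 Y -> fins (fun e => Y w1 w2 e w).
Proof.
move=> IY; have [bY rY _ _ _] := IY.
have dY u1 u2 q : dual (Y u1 u2 q) by case: (rY u1 u2 q).
elim/indW1: w1 w2 w => [h1 w1 hw1|w1 w1' hu hv] w2 w; last first.
  apply: (fins_supp (finsD (hu w2 w) (hv w2 w))) => e.
  by rewrite (linD (itw_linl bY w2 e)).
elim/indW2: w2 w => [h2 w2 hw2|w2 w2' hu hv] w; last first.
  by apply: (fins_supp (finsD (hu w) (hv w))) => e; rewrite (linD (itw_linr bY w1 e)).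
elim/indW: w => [h w hw|w w' hu hv]; last first.
  by apply: (fins_supp (finsD hu hv)) => e; rewrite (linD (dY w1 w2 e)).
exists [:: h - h1 - h2] => e; rewrite inE; exact: (itw_weight IY hw1 hw2 hw).
Qed.

Definition evalz Y (w1 : W1) (w2 : W2) : W -> C^o := fun w =>
  \sum_(n \in [set: C]) cexp ((- n - 1) * clog z) * Y w1 w2 (- n - 1) w.

Lemma evalzE Y w1 w2 w :
  evalz Y w1 w2 w = \sum_(e \in [set: C]) cpow z e *: (Y w1 w2 e w : C^o).
Proof.
rewrite [RHS](@fsum_reindex _ C _ (fun n => - n - 1)).
- by [].
- by move=> p q /addIr/oppr_inj.
- by move=> e _; exists (- e - 1); rewrite opprB opprK addrAC subrr add0r.
Qed.

Lemma evalz_fins Y w1 w2 w : itw_op W W1 W2 Y ->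
  fins (fun e => cpow z e *: (Y w1 w2 e w : C^o)).
Proof.
by move=> IY; have [r hr] := itw_fins w1 w2 w IY; exists r => e /hr ->; rewrite scaler0.
Qed.

Lemma evalz_bilin Y : itw_op W W1 W2 Y -> bilin (evalz Y).
Proof.
move=> IY; have [bY rY _ _ _] := IY.
have fz (w1 : W1) (w2 : W2) (w : W) := evalz_fins w1 w2 w IY.
split=> [u a x y|u a x y]; apply/funext => w; rewrite !fctE !evalzE -fsum_lincomb //;
    apply: eq_fsum => e.
  by rewrite (itw_linr bY u e) !fctE scalerDr !scalerA [_ * a]mulrC.
by rewrite (itw_linl bY u e) !fctE scalerDr !scalerA [_ * a]mulrC.
Qed.

Lemma FzE Y w1 w2 : itw_op W W1 W2 Y -> Fz z Y (tpure w1 w2) = evalz Y w1 w2.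
Proof. by move=> IY; exact: tlift_pure (evalz_bilin IY) w1 w2. Qed.

Lemma Fz_linear Y : itw_op W W1 W2 Y -> linear (Fz z Y).
Proof. by move=> IY; exact: tlift_linear (evalz_bilin IY). Qed.

Lemma related_Fz Y : itw_op W W1 W2 Y -> related z Y (Fz z Y).
Proof.
move=> IY h1 h2 h w1 w2 w e hw1 hw2 hw; case: eqP => [->|/eqP ne]; last first.
  exact: (itw_weight IY hw1 hw2 hw ne).
rewrite FzE // evalzE (@fsum1 _ _ _ (h - h1 - h2)) => [|p ne]; last first.
  by rewrite (itw_weight IY hw1 hw2 hw ne) scaler0.
by rewrite -[_ *: _]/(_ * _) mulrA -cpowD addNr cpow0 mul1r.
Qed.

Lemma evalz_dual Y w1 w2 : itw_op W W1 W2 Y -> dual (evalz Y w1 w2).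
Proof.
move=> IY a x y; have [_ rY _ _ _] := IY.
rewrite !evalzE -fsum_lincomb; try exact: evalz_fins.
apply: eq_fsum => e.
by rewrite (rY w1 w2 e).1 scalerDr !scalerA [_ * a]mulrC.
Qed.

Lemma stardual_lin a (f g : W -> C^o) : stardual f -> stardual g ->
  stardual (a *: f + g).
Proof.
move=> [df hf] [dg hg]; split; first exact: dual_lin.
move=> h; have [N hN] := hf h; have [N' hN'] := hg h.
exists (Num.min N N') => n w; rewrite lt_min => /andP[n1 n2] hw.
by rewrite !fctE (hN n) // (hN' n) // scaler0 addr0.
Qed.

Lemma stardual_0 : stardual (0 : W -> C^o).
Proof. by split; [exact: dual_zero|move=> h; exists 0]. Qed.

Lemma Fz_star Y t : itw_op W W1 W2 Y -> stardual (Fz z Y t).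
Proof.
move=> IY; have lF := Fz_linear IY.
elim/tens_pure_ind: t => [|a w1 w2 t IH]; first by rewrite (lin0 lF); exact: stardual_0.
rewrite lF; apply: stardual_lin => //.
elim/indW1: w1 w2 => [h1 w1 hw1|u u' hu hv] w2; last first.
  rewrite (linD (tpure_linl w2)) (linD lF) -[X in X + _]scale1r.
  exact: stardual_lin.
elim/indW2: w2 => [h2 w2 hw2|u u' hu hv]; last first.
  rewrite (linD (tpure_linr w1)) (linD lF) -[X in X + _]scale1r.
  exact: stardual_lin.
split; first by rewrite FzE //; exact: evalz_dual.
move=> h; have [_ _ trunc _ _] := IY.
(* A functional on weight h + n/T is read at the exponent h + n/T - h1 - h2 = - ((h1 + h2 - h - 1) +
   (- n)/T) - 1, so very negative n falls in the truncated range. *)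
have [N hN] := trunc w1 w2 (h1 + h2 - h - 1).
exists (- N) => n w nN hw.
have := related_Fz IY (h + frac T n - h1 - h2) hw1 hw2 hw.
rewrite eqxx.
have -> : h + frac T n - h1 - h2 = - (h1 + h2 - h - 1 + frac T (- n)) - 1.
  by rewrite fracN; ring.
rewrite hN; last by rewrite ltrNr.
by move/esym/eqP; rewrite mulf_eq0 (negPf (cpow_neq0 _ _)) => /eqP.
Qed.

Lemma Fz_Pz Y : itw_op W W1 W2 Y -> Pz_map_star W W1 W2 z (Fz z Y).
Proof.
move=> IY; have lF := Fz_linear IY; have star t := Fz_star t IY.
have dF t : dual (Fz z Y t) := (star t).1.
split => //; split => //; apply/(Pz_jacobiP H z lF dF) => j1 j2 v w1 w2 w n m.
apply: Jcoef_ext => // k h1 h2 h {}v {}w1 {}w2 {}w vj kv hw1 hw2 hw.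
have [bY rY _ jY _] := IY.
have dY u1 u2 q : dual (Y u1 u2 q) by case: (rY u1 u2 q).
have hI q := (itw_jacobiP H bY dY).1 jY j1 j2 v w1 w2 w n m q vj.
(* This is the one exponent of x2 at which [related_Icoef] has content; the nonzero power of z then
   cancels. *)
have := hI (h - k%:~R - (m%:~R - frac T j2) + (n%:~R + frac T j1) - h1 - h2).
rewrite (related_Icoef H z0 _ _ _ (related_Fz IY) vj kv hw1 hw2 hw) eqxx.
by move/eqP; rewrite mulf_eq0 (negPf (cpow_neq0 _ _)) => /eqP.
Qed.

End Isomorphism.

(** * The inverse map and the linear structure *)

Section Inverse.
Variables (R : realType) (V : voa R) (T : nat) (s1 s2 sigma : V -> V).
Local Notation C := R[i].
Local Notation frac := (Defs.frac R).
Hypothesis H : twisting T s1 s2 sigma.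
Variables (W : twmod T sigma) (W1 : twmod T s1) (W2 : twmod T s2) (z : C).
Hypothesis z0 : z != 0.
Hypotheses (ssW : semisimple (L0 (M := W))) (ssW1 : semisimple (L0 (M := W1)))
  (ssW2 : semisimple (L0 (M := W2))).
Implicit Types (F : tens W1 W2 -> W -> C^o) (Y : W1 -> W2 -> ser R (W -> C^o)).

Let indW := ss_ind (L0_linear (M := W)) ssW.
Let indW1 := ss_ind (L0_linear (M := W1)) ssW1.
Let indW2 := ss_ind (L0_linear (M := W2)) ssW2.
Local Notation cW := (eigcomp (L0 (M := W))).
Local Notation c1 := (eigcomp (L0 (M := W1))).
Local Notation c2 := (eigcomp (L0 (M := W2))).

Let lcW h : linear (cW h). Proof. exact: (eigcomp_linear (L0_linear (M := W)) ssW h). Qed.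
Let lc1 h : linear (c1 h). Proof. exact: (eigcomp_linear (L0_linear (M := W1)) ssW1 h). Qed.
Let lc2 h : linear (c2 h). Proof. exact: (eigcomp_linear (L0_linear (M := W2)) ssW2 h). Qed.
Let f1 w1 : fins (fun h => c1 h w1).
Proof. exact: (eigcomp_fins (L0_linear (M := W1)) ssW1 w1). Qed.
Let f2 w2 : fins (fun h => c2 h w2).
Proof. exact: (eigcomp_fins (L0_linear (M := W2)) ssW2 w2). Qed.

(** Forced by [related]: components of weights h1, h2 of w1, w2 reach the exponent e only through
    the component of w of weight e + h1 + h2, and z^{-e} normalises the value at x = z. *)
Definition invFz F : W1 -> W2 -> ser R (W -> C^o) := fun w1 w2 e w =>
  \sum_(h1 \in [set: C]) \sum_(h2 \in [set: C])
    cpow z (- e) *: (F (tpure (c1 h1 w1) (c2 h2 w2)) (cW (e + h1 + h2) w) : C^o).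

Section FixedMap.
Variable F : tens W1 W2 -> W -> C^o.
Hypotheses (linF : linear F) (dF : forall t, dual (F t)).

Lemma invFz_fins2 w1 w2 w e h1 : fins (fun h2 =>
  cpow z (- e) *: (F (tpure (c1 h1 w1) (c2 h2 w2)) (cW (e + h1 + h2) w) : C^o)).
Proof.
have [r hr] := f2 w2; exists r => h2 /hr ->.
by rewrite (lin0 (tpure_linr _)) (lin0 linF) scaler0.
Qed.

Lemma invFz_fins1 w1 w2 w e : fins (fun h1 => \sum_(h2 \in [set: C])
  cpow z (- e) *: (F (tpure (c1 h1 w1) (c2 h2 w2)) (cW (e + h1 + h2) w) : C^o)).
Proof.
have [r hr] := f1 w1; exists r => h1 /hr ->; apply: fsum0 => h2.
by rewrite (lin0 (tpure_linl _)) (lin0 linF) scaler0.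
Qed.

Lemma invFz_linl w2 e w : linear (fun w1 => invFz F w1 w2 e w : C^o).
Proof.
move=> a x y; rewrite /invFz -fsum_lincomb; try exact: invFz_fins1.
apply: eq_fsum => h1; rewrite -fsum_lincomb; try exact: invFz_fins2.
by apply: eq_fsum => h2; rewrite lc1 tpureDl linF !fctE scalerDr !scalerA [_ * a]mulrC.
Qed.

Lemma invFz_linr w1 e w : linear (fun w2 => invFz F w1 w2 e w : C^o).
Proof.
move=> a x y; rewrite /invFz -fsum_lincomb; try exact: invFz_fins1.
apply: eq_fsum => h1; rewrite -fsum_lincomb; try exact: invFz_fins2.
by apply: eq_fsum => h2; rewrite lc2 tpureDr linF !fctE scalerDr !scalerA [_ * a]mulrC.
Qed.

Lemma invFz_dual w1 w2 e : dual (invFz F w1 w2 e).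
Proof.
move=> a x y; rewrite /invFz -fsum_lincomb; try exact: invFz_fins1.
apply: eq_fsum => h1; rewrite -fsum_lincomb; try exact: invFz_fins2.
by apply: eq_fsum => h2; rewrite lcW dF scalerDr !scalerA [_ * a]mulrC.
Qed.

Lemma invFz_bilin e : bilin (fun w1 w2 => invFz F w1 w2 e).
Proof.
split=> [u a x y|u a x y]; apply/funext => w; first exact: invFz_linr.
exact: invFz_linl.
Qed.

Lemma related_invFz : related z (invFz F) F.
Proof.
move=> h1 h2 h w1 w2 w e hw1 hw2 hw; rewrite /invFz.
have E1 := eigcomp_hom (L0_linear (M := W1)) _ hw1.
have E2 := eigcomp_hom (L0_linear (M := W2)) _ hw2.
have E := eigcomp_hom (L0_linear (M := W)) _ hw.
rewrite (@fsum1 _ _ _ h1) => [|k1 /negPf k1h]; last first.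
  by apply: fsum0 => k2; rewrite E1 k1h (lin0 (tpure_linl _)) (lin0 linF) scaler0.
rewrite (@fsum1 _ _ _ h2) => [|k2 /negPf k2h]; last first.
  by rewrite E2 k2h (lin0 (tpure_linr _)) (lin0 linF) scaler0.
rewrite E1 E2 E !eqxx.
have -> : (e + h1 + h2 == h) = (e == h - h1 - h2).
  by rewrite -[RHS](inj_eq (addIr (h1 + h2))) addrA; congr (_ == _); ring.
by case: eqP => // _; rewrite (lin0 (dF _)) scaler0.
Qed.

(** Only the finitely many weights e + h1 + h2, with h1 and h2 occurring in w1 and w2, are seen;
    this places the coefficient in W'. *)
Lemma invFz_rdual w1 w2 e : rdual (invFz F w1 w2 e).
Proof.
split; first exact: invFz_dual.
have [r1 hr1] := f1 w1; have [r2 hr2] := f2 w2.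
exists [seq e + h1 + h2 | h1 <- r1, h2 <- r2] => h w hs hw.
apply: fsum0 => h1; apply: fsum0 => h2.
have [h1r|/hr1 ->] := boolP (h1 \in r1); last first.
  by rewrite (lin0 (tpure_linl _)) (lin0 linF) scaler0.
have [h2r|/hr2 ->] := boolP (h2 \in r2); last first.
  by rewrite (lin0 (tpure_linr _)) (lin0 linF) scaler0.
rewrite (eigcomp_hom (L0_linear (M := W)) _ hw).
case: eqP => [eh|_]; last by rewrite (lin0 (dF _)) scaler0.
by case/negP: hs; rewrite -eh; exact: (allpairs_f (fun h1 h2 => e + h1 + h2)).
Qed.

Hypothesis starF : forall t, stardual (F t).

(** This is where values in [stardual] are used: large n corresponds to very negative weights of
    w. *)
Lemma invFz_trunc w1 w2 (h : C) : exists N : int, forall n : int, N < n ->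
  invFz F w1 w2 (- (h + frac T n) - 1) = 0.
Proof.
elim/indW1: w1 w2 => [h1 w1 hw1|u u' hu hv] w2; last first.
  have [N hN] := hu w2; have [N' hN'] := hv w2; exists (Num.max N N') => n.
  rewrite gt_max => /andP[n1 n2]; rewrite (linD (itw_linl invFz_bilin _ _)).
  by rewrite hN // hN' // addr0.
elim/indW2: w2 => [h2 w2 hw2|u u' [N hN] [N' hN']]; last first.
  exists (Num.max N N') => n; rewrite gt_max => /andP[n1 n2].
  by rewrite (linD (itw_linr invFz_bilin _ _)) hN // hN' // addr0.
(* The exponent - (h + n/T) - 1 equals k - h1 - h2 exactly for k = (h1 + h2 - h - 1) + (- n)/T. *)
have [N hN] := (starF (tpure w1 w2)).2 (h1 + h2 - h - 1).
exists (- N) => n nN; apply/funext => w.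
elim/indW: w => [k w hw|w w' hw hw']; last first.
  by rewrite (linD (invFz_dual w1 w2 _)) hw hw' addr0.
rewrite (related_invFz _ hw1 hw2 hw); case: eqP => // ek.
rewrite (hN (- n)) ?mulr0 //; first by rewrite ltrNl.
rewrite hw; congr (_ *: _).
transitivity (k - h1 - h2 + h1 + h2); first ring.
by rewrite -ek fracN; ring.
Qed.

Hypothesis jacF : Pz_jacobi z F.

Lemma invFz_L1der w1 w2 :
  invFz F (Lmode (@twY R V T s1 W1) (omega V) (-1) w1) w2 = dser (invFz F w1 w2).
Proof.
apply/funext => e; apply/funext => w; rewrite /dser fctE.
have lL : linear (Lmode (@twY R V T s1 W1) (omega V) (-1)) by exact: tw_linr.
elim/indW1: w1 w2 w => [h1 w1 hw1|u u' hu hv] w2 w; last first.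
  rewrite (linD lL) (linD (invFz_linl w2 _ _)) hu hv.
  by rewrite (linD (invFz_linl w2 _ _)) scalerDr.
elim/indW2: w2 w => [h2 w2 hw2|u u' hu hv] w; last first.
  by rewrite !(linD (invFz_linr _ _ _)) hu hv scalerDr.
elim/indW: w => [h w hw|w w' hu hv]; last first.
  by rewrite !(linD (invFz_dual _ _ _)) hu hv scalerDr.
rewrite (related_invFz _ (LM1_weight H hw1) hw2 hw) (related_invFz _ hw1 hw2 hw).
have -> : (e == h - (h1 + 1) - h2) = (e + 1 == h - h1 - h2).
  by rewrite -[LHS](inj_eq (addIr 1)); congr (_ == _); ring.
case: eqP => [eh|_]; last by rewrite scaler0.
(* On weight vectors this coefficient for omega reads z F(L(-1) w1 (x) w2) = (h - h1 - h2) F(w1 (x)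
   w2), evaluated at w. The factor z makes up for the exponents e and e + 1 on the two sides. *)
have := (Pz_jacobiP H z linF dF).1 jacF 0 0 _ w1 w2 w 0 (-2) (omega_eig H).
rewrite (Jcoef_omega z0) hw hw1 hw2 (linZ (dF _)).
rewrite (linZ (tpure_linr w1)) (linZ (tpure_linl w2)) !(linZ linF) !fctE.
move: (F (tpure w1 w2) w) => x; move: (F (tpure _ w2) w) => y.
rewrite -[h *: x]/(h * x) -[h1 *: x]/(h1 * x) -[h2 *: x]/(h2 * x) => E.
have zy : z * y = (e + 1) * x.
  by rewrite eh; apply/eqP; rewrite -subr_eq0; apply/eqP; rewrite -[RHS]oppr0 -E; ring.
rewrite -[RHS]/(_ * (_ * x)) mulrCA -zy opprD cpowD [cpow z (-1)]cpowN cpow1 //.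
by rewrite mulrA mulfVK.
Qed.

Lemma invFz_itw : itw_op W W1 W2 (invFz F).
Proof.
split.
- exact: invFz_bilin.
- exact: invFz_rdual.
- exact: invFz_trunc.
- apply/(itw_jacobiP H invFz_bilin invFz_dual) => j1 j2 v w1 w2 w n m q vj.
  apply: (Icoef_ext H ssW ssW1 ssW2 invFz_bilin invFz_dual) => //.
  move=> k h1 h2 h {}v {}w1 {}w2 {}w {}vj kv hw1 hw2 hw.
  rewrite (related_Icoef H z0 _ _ _ related_invFz vj kv hw1 hw2 hw).
  by rewrite ((Pz_jacobiP H z linF dF).1 jacF) // mulr0 if_same.
- exact: invFz_L1der.
Qed.

Lemma Fz_invFz : Fz z (invFz F) = F.
Proof.
have IY := invFz_itw; have lG := Fz_linear H z ssW ssW1 ssW2 IY.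
apply/funext => t; elim/tens_pure_ind: t => [|a w1 w2 t IH].
  by rewrite (lin0 lG) (lin0 linF).
rewrite lG linF IH; congr (_ *: _ + _).
apply/funext => w.
have dG t' : dual (Fz z (invFz F) t') := (Fz_star H z ssW ssW1 ssW2 t' IY).1.
elim/indW1: w1 w2 w => [h1 w1 hw1|u u' hu hv] w2 w; last first.
  by rewrite (linD (tpure_linl w2)) (linD lG) (linD linF) !fctE hu hv.
elim/indW2: w2 w => [h2 w2 hw2|u u' hu hv] w; last first.
  by rewrite (linD (tpure_linr w1)) (linD lG) (linD linF) !fctE hu hv.
elim/indW: w => [h w hw|w w' hu hv]; last first.
  by rewrite (linD (dG _)) (linD (dF _)) hu hv.
have := related_Fz H z ssW ssW1 ssW2 IY (h - h1 - h2) hw1 hw2 hw.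
rewrite (related_invFz _ hw1 hw2 hw) eqxx => /(mulfI (cpow_neq0 _ _)).
by move=> ->.
Qed.

End FixedMap.

Lemma Fz_inj Y Y' : itw_op W W1 W2 Y -> itw_op W W1 W2 Y' -> Fz z Y = Fz z Y' -> Y = Y'.
Proof.
move=> IY IY' E; have [bY rY _ _ _] := IY; have [bY' rY' _ _ _] := IY'.
apply/funext => w1; apply/funext => w2; apply/funext => e; apply/funext => w.
elim/indW1: w1 w2 w => [h1 w1 hw1|u u' hu hv] w2 w; last first.
  by rewrite (linD (itw_linl bY w2 e)) (linD (itw_linl bY' w2 e)) !fctE hu hv.
elim/indW2: w2 w => [h2 w2 hw2|u u' hu hv] w; last first.
  by rewrite (linD (itw_linr bY w1 e)) (linD (itw_linr bY' w1 e)) !fctE hu hv.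
elim/indW: w => [h w hw|w w' hu hv]; last first.
  by rewrite (linD (rY w1 w2 e).1) (linD (rY' w1 w2 e).1) hu hv.
rewrite (related_Fz H z ssW ssW1 ssW2 IY e hw1 hw2 hw).
by rewrite (related_Fz H z ssW ssW1 ssW2 IY' e hw1 hw2 hw) E.
Qed.

Lemma itw_op_subspace : is_subspace (itw_op W W1 W2).
Proof.
have b0 e : bilin (fun w1 w2 => (0 : W1 -> W2 -> ser R (W -> C^o)) w1 w2 e).
  by split=> [u a x y|u a x y]; rewrite -[RHS]/(a *: (0 : W -> C^o) + 0) scaler0 addr0.
have d0 w1 w2 e : dual ((0 : W1 -> W2 -> ser R (W -> C^o)) w1 w2 e) by exact: dual_zero.
split.
  split=> //.
  - by move=> w1 w2 e; split; [exact: d0|exists [::]].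
  - by move=> w1 w2 h; exists 0.
  - apply/(itw_jacobiP H b0 d0) => j1 j2 v w1 w2 w n m q vj.
    rewrite /Icoef !fsum0 ?mulr0 ?subrr //; by move=> i; rewrite scaler0.
  - move=> w1 w2; apply/funext => e; apply/funext => w.
    by rewrite /dser !fctE scaler0.
move=> a Y Y' [bY rY tY jY LY] [bY' rY' tY' jY' LY'].
have dY w1 w2 e : dual (Y w1 w2 e) by case: (rY w1 w2 e).
have dY' w1 w2 e : dual (Y' w1 w2 e) by case: (rY' w1 w2 e).
have b e : bilin (fun w1 w2 => (a *: Y + Y') w1 w2 e).
  split=> [u c x y|u c x y]; apply/funext => w; rewrite !fctE.
    rewrite (itw_linr bY u e) (itw_linr bY' u e) !fctE.
    by rewrite !scalerDr !scalerA [c * a]mulrC -!addrA; congr (_ + _); rewrite addrCA.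
  rewrite (itw_linl bY u e) (itw_linl bY' u e) !fctE.
  by rewrite !scalerDr !scalerA [c * a]mulrC -!addrA; congr (_ + _); rewrite addrCA.
have d w1 w2 e : dual ((a *: Y + Y') w1 w2 e) by exact: dual_lin.
split=> //.
- move=> w1 w2 e; split; first exact: d.
  have [_ [r hr]] := rY w1 w2 e; have [_ [s hs]] := rY' w1 w2 e.
  exists (r ++ s) => h w; rewrite mem_cat => /norP[h1 h2] hw.
  by rewrite !fctE (hr h) // (hs h) // scaler0 addr0.
- move=> w1 w2 h; have [N hN] := tY w1 w2 h; have [N' hN'] := tY' w1 w2 h.
  exists (Num.max N N') => n; rewrite gt_max => /andP[n1 n2].
  rewrite -[LHS]/(a *: Y w1 w2 (- (h + frac T n) - 1) + Y' w1 w2 (- (h + frac T n) - 1)).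
  by rewrite hN // hN' // scaler0 addr0.
- apply/(itw_jacobiP H b d) => j1 j2 v w1 w2 w n m q vj.
  rewrite (@Icoef_lin _ _ _ _ _ _ H _ _ _ Y Y' (a *: Y + Y') a bY dY bY' dY'
    j1 j2 n m q v w1 w2 w v w1 w2 w) //.
  rewrite ((itw_jacobiP H bY dY).1 jY) // ((itw_jacobiP H bY' dY').1 jY') //.
  by rewrite mulr0 addr0.
- move=> w1 w2; apply/funext => e; apply/funext => w; rewrite !fctE LY LY' /dser !fctE.
  by rewrite scalerDr !scalerA mulrC.
Qed.

Lemma Pz_map_star_subspace : is_subspace (Pz_map_star W W1 W2 z).
Proof.
have l0 : linear (0 : tens W1 W2 -> W -> C^o).
  by move=> a x y; rewrite -[RHS]/(a *: (0 : W -> C^o) + 0) scaler0 addr0.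
have d0 t : dual ((0 : tens W1 W2 -> W -> C^o) t) by exact: dual_zero.
split.
  split; last by move=> t; exact: stardual_0.
  split=> //; apply/(Pz_jacobiP H z l0 d0) => j1 j2 v w1 w2 w n m vj.
  by rewrite /Jcoef mul_xc0 // !mul_cx0 // !mulr0 !subrr.
move=> a F F' [[lF dF jF] sF] [[lF' dF' jF'] sF'].
have l : linear (a *: F + F').
  move=> c x y; apply/funext => w; rewrite !fctE lF lF' !fctE !scalerDr !scalerA [c * a]mulrC -!addrA.
  by congr (_ + _); rewrite addrCA.
have s t : stardual ((a *: F + F') t) by exact: stardual_lin.
have d t : dual ((a *: F + F') t) := (s t).1.
split=> //; split=> //; apply/(Pz_jacobiP H z l d) => j1 j2 v w1 w2 w n m vj.
rewrite (@Jcoef_lin _ _ _ _ _ _ H _ _ _ z F F' (a *: F + F') a lF dF lF' dF'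
    j1 j2 n m v w1 w2 w v w1 w2 w) //.
rewrite ((Pz_jacobiP H z lF dF).1 jF) // ((Pz_jacobiP H z lF' dF').1 jF') //.
by rewrite mulr0 addr0.
Qed.

(** The lift and the substitution x = z are known to be linear for genuine intertwining operators,
    so the combination is first recognised as one by [itw_op_subspace]. *)
Lemma Fz_additive a Y Y' : itw_op W W1 W2 Y -> itw_op W W1 W2 Y' ->
  Fz z (a *: Y + Y') = a *: Fz z Y + Fz z Y'.
Proof.
move=> IY IY'; have IZ := itw_op_subspace.2 a _ _ IY IY'.
have lF Z (IZ' : itw_op W W1 W2 Z) := Fz_linear H z ssW ssW1 ssW2 IZ'.
apply/funext => t; rewrite -[RHS]/(a *: Fz z Y t + Fz z Y' t); elim/tens_pure_ind: t => [|c w1 w2 t IH].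
  by rewrite !(lin0 (lF _ _)) // scaler0 addr0.
rewrite !(lF _ _ c) // IH !scalerDr addrACA; congr (_ + _).
rewrite !(FzE H z ssW ssW1 ssW2) // !scalerA mulrC -scalerA -scalerDr; congr (_ *: _).
apply/funext => w; rewrite !fctE !evalzE.
rewrite -fsum_lincomb; try exact: (evalz_fins H).
by apply: eq_fsum => e; rewrite !fctE scalerDr !scalerA [_ * a]mulrC.
Qed.

End Inverse.

Theorem theorem4p16 (R : realType) (V : voa R) (T : nat)
    (sigma1 sigma2 sigma : V -> V) (z : R[i])
    (aut1 : voa_aut sigma1) (aut2 : voa_aut sigma2)
    (commute : forall v, sigma1 (sigma2 v) = sigma2 (sigma1 v))
    (T_gt0 : (0 < T)%N)
    (order1 : forall v, iter T sigma1 v = v)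
    (order2 : forall v, iter T sigma2 v = v)
    (sigmaK : cancel (sigma1 \o sigma2) sigma)
    (Ksigma : cancel sigma (sigma1 \o sigma2))
    (z_neq0 : z != 0)
    (W : twmod T sigma) (W1 : twmod T sigma1) (W2 : twmod T sigma2)
    (ssW : semisimple (L0 (M := W)))
    (ssW1 : semisimple (L0 (M := W1)))
    (ssW2 : semisimple (L0 (M := W2))) :
  linear_iso (itw_op W W1 W2) (Pz_map_star W W1 W2 z) (Fz z)
  /\ Pz_map_star W W1 W2 z = homVV W W1 W2 z.
Proof.
have H : twisting T sigma1 sigma2 sigma by split.
split; last exact: Pz_map_star_homVV.
split; first exact: itw_op_subspace.
- exact: Pz_map_star_subspace.
- by move=> a x y; apply: Fz_additive.
split.
- by move=> Y /=; exact: Fz_Pz.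
- by move=> Y Y'; rewrite !inE => IY IY'; apply: (Fz_inj H ssW ssW1 ssW2 IY IY').
move=> F [[lF dF jF] sF]; exists (invFz z F); first exact: invFz_itw.
exact: Fz_invFz.
Qed.
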